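(* Let $C$ be a positive integer, and let $PQ$ be the largest squarefree divisor of $C$, where the positive integer $P$ is chosen so that $(C/P)^{1/2}$ is an integer. Suppose the equation $$x^2 + C = y^n$$ has a solution $(x,y,n)$ in positive integers with $y$ a prime, $x$ divisible by at most one prime, $\gcd(x,y)=1$, and $$(x,y,n) \notin \{(401,11,5),\ (7,3,4),\ (1,2,2),\ (5,2,5),\ (11,2,7),\ (181,2,15),\ (11,2,8),\ (61,2,12),\ (13,2,9)\}.$$ Then either $n=3$ or $$(n-s) \mid N, \qquad N = 2\cdot 3^{\ell}\, h(-P)\, \left\langle q_1 - \left(\frac{-P}{q_1}\right), \dots, q_m - \left(\frac{-P}{q_m}\right)\right\rangle,$$ where $s=2$ if $y=2$ and $s=0$ otherwise; $\ell=1$ if $P>3$ and $P\equiv 3 \pmod 8$, and $\ell=0$ otherwise; and $q_1q_2\cdots q_m = Q$ is the prime factorization of $Q$ (with $m=0$ if $Q=1$).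
   Context: $P$ is the squarefree part of $C$ (so $C/P$ is a perfect square), and $Q$ is the product of the distinct primes dividing $C$ but not $P$. $h(-P)$ denotes the lowest positive integer $k$ such that $\mathfrak{a}^k$ is principal for every ideal $\mathfrak{a}$ in (the ring of integers of) $\mathbb{Q}(\sqrt{-P})$. $\langle a_1,\dots,a_m\rangle$ denotes the least common multiple of $a_1,\dots,a_m$, with the convention that it equals $1$ when the list is empty. For an odd prime $q$, $\left(\frac{a}{q}\right)$ is the Legendre symbol; for $q=2$, the convention is $\left(\frac{a}{2}\right)=0$. *)

(* Defs.v *)
From mathcomp Require Import all_boot all_order all_algebra all_field.

Set Implicit Arguments.
Unset Strict Implicit.
Unset Printing Implicit Defensive.

Import GRing.Theory Num.Theory.
Local Open Scope ring_scope.

Definition squarefree (n : nat) : Prop :=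
  forall d : nat, (d ^ 2 %| n)%N -> d = 1%N.

Definition largest_squarefree_divisor (n r : nat) : Prop :=
  [/\ (r %| n)%N, squarefree r
    & forall d : nat, (d %| n)%N -> squarefree d -> (d <= r)%N].

(* Intended for prime q only; (a / 2) is 0 by convention. *)
Definition legendre (a : int) (q : nat) : int :=
  if (q == 2%N) || (q %| a)%Z then 0
  else if [exists t : 'I_q, ((t%:Z ^+ 2)%R == a %[mod q])%Z] then 1
  else -1.

(* Q(sqrt (- P)), as a subfield of the field of algebraic numbers. *)
Definition Qsqrt_neg (P : nat) (z : algC) : Prop :=
  exists a b : algC,
    [/\ a \in Crat, b \in Crat & z = a + b * sqrtC (- P%:R)].

Definition ring_of_integers (P : nat) (z : algC) : Prop :=
  Qsqrt_neg P z /\ z \in Aint.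

Section Ideals.

(* Subsets of algC are predicates; O is meant to be a subring of algC. *)
Variable O : algC -> Prop.

Definition is_ideal (I : algC -> Prop) : Prop :=
  [/\ forall u, I u -> O u,
      I 0,
      forall u v, I u -> I v -> I (u + v)
    & forall a u, O a -> I u -> I (a * u)].

Definition ideal_mul (I J : algC -> Prop) (z : algC) : Prop :=
  exists2 s : seq (algC * algC),
    forall u, u \in s -> I u.1 /\ J u.2
    & z = \sum_(u <- s) u.1 * u.2.

Definition ideal_exp (I : algC -> Prop) (k : nat) : algC -> Prop :=
  iter k (ideal_mul I) O.

Definition principal (I : algC -> Prop) : Prop :=
  exists2 g : algC, O g
    & forall z, I z <-> exists2 a : algC, O a & z = a * g.

End Ideals.

Definition kills_class_group (P k : nat) : Prop :=
  forall I, is_ideal (ring_of_integers P) I ->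
    principal (ring_of_integers P) (ideal_exp (ring_of_integers P) I k).

(* h = h(-P): the exponent, not the order, of the class group. *)
Definition is_class_exponent (P h : nat) : Prop :=
  [/\ (0 < h)%N, kills_class_group P h
    & forall k : nat, (0 < k)%N -> kills_class_group P k -> (h <= k)%N].

Definition ell (P : nat) : nat :=
  if (3 < P)%N && (P %% 8 == 3)%N then 1 else 0.

Definition shift (y : nat) : nat := if y == 2%N then 2 else 0.

Definition bigN (P Q h : nat) : int :=
  2 * 3 ^+ ell P * h%:Z *
  \big[lcmz/1]_(q <- primes Q) (q%:Z - legendre (- P%:Z) q).

Definition exceptional_solutions : seq (nat * nat * nat) :=
  [:: (401, 11, 5); (7, 3, 4); (1, 2, 2); (5, 2, 5); (11, 2, 7);
      (181, 2, 15); (11, 2, 8); (61, 2, 12); (13, 2, 9)]%N.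

(* Main.v *)
(* Write M = y ^ i for the norm of gamma = (a + b sqrt (- P)) / 2.  Elements of
   norm a power of y and trace prime to y, in the order of conductor 2 Q (Q when
   y = 2), have exponents closed under subtraction, hence under gcd.  One
   exponent is N = n (n - 2 when y = 2), from x + c sqrt (- P); another is
   H = 3 ^ ell h lcm (q - (- P / q)): a generator of the h-th power of a prime
   above y, raised to the 3 ^ ell to enter Z[sqrt (- P)] and then, by the law of
   apparition, to the lcm to make Q divide the coefficient of sqrt (- P).  So
   x + c sqrt (- P) is a t-th power with t = N / gcd (N, H), and it remains to
   see that t divides 2.

   If a prime r > 3 divides t, then x + c sqrt (- P) is the r-th power of some
   gamma, and x = a V, c = b U with U, V given by Lucas sequences.  Every prime
   factor of U divides the discriminant, hence equals r, so U is 1, -1, r or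
   - r; as x has only one prime factor, either V is 1, -1, r or - r too, which
   the norm forbids, or a = 1 (up to sign).  In the latter case gamma is
   1 + sqrt (- B) with 1 + B a power of the odd prime y, or (1 + sqrt (- B)) / 2
   with 1 + B = 2 ^ (i + 2).
   - If U = r or - r, then r divides B, and congruences modulo r ^ 2, and modulo
     4 ^ i when y = 2, leave finitely many cases.
   - If U = -1 for odd y, then r = -1 (mod B), so r + 1 is a multiple of y - 1,
     while 2 ^ (r - 1) = U = -1 (mod y); thus 1 = 2 ^ (r + 1) = -4 (mod y) and
     y = 5.  Then i = 1 is settled by lifting at 2, and i > 1 by congruences
     modulo 7, 11 and 19.
   - If U = 1 for odd y, valuations at the primes dividing B leave B = 2, 6.
   - For y = 2 one gets i = 1, which is the Ramanujan-Nagell equation.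
   For r = 3 the case a = 1 leads to 3 ^ j + 4 = y ^ i, which forces i = 1. *)

(* The conductor [f] ([2 Q], or [Q] when [y = 2]) serves twice. As [P f^2 > 4], the only units are 1
   and -1, so a prescribed norm determines an element up to sign and conjugation. And since every
   root of [x + c sqrt (- P)] keeps a coefficient divisible by [Q], each prime factor of [c], hence
   of [U], divides the discriminant. The first property fails only for odd [y] with [P = Q = 1],
   where [sqrt (- 1)] is a unit; that case is elementary. A trace prime to [y] means that an element
   generates a power of one of the two primes above [y]. This replaces ideals by integers: of the
   traces of [gamma delta] and of [gamma] times the conjugate of [delta], the sum is prime to [y]
   and the product is divisible by the smaller norm, so one of the traces absorbs that norm and an
   exact division results. That [t] divides 2 means that neither an odd prime nor 4 divides [t]. The
   exponent 4 is therefore excluded separately, and it yields the exception [(7, 3, 4)]. *)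
Require Import Defs.
From mathcomp Require Import all_boot all_order all_algebra all_field.
From mathcomp Require Import zify ring.

Set Implicit Arguments.
Unset Strict Implicit.
Unset Printing Implicit Defensive.

Import Order.TTheory GRing.Theory Num.Theory.
Local Open Scope ring_scope.

(** * Lucas sequences *)

(** For the roots [alpha], [beta] of [X^2 - a X + M], [lucU] is
    [(alpha^n - beta^n) / (alpha - beta)] and [lucV] is [alpha^n + beta^n], so
    [alpha^n = (V + U sqrt D) / 2] with [D = a^2 - 4 M]. The recurrences keep everything in
    [int]. *)
Fixpoint lucU (a M : int) (n : nat) : int :=
  if n is m.+1 then
    if m is k.+1 then a * lucU a M m - M * lucU a M k else 1
  else 0.

Fixpoint lucV (a M : int) (n : nat) : int :=
  if n is m.+1 then
    if m is k.+1 then a * lucV a M m - M * lucV a M k else a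
  else 2.

Lemma lucU0 a M : lucU a M 0 = 0. Proof. by []. Qed.
Lemma lucU1 a M : lucU a M 1 = 1. Proof. by []. Qed.
Lemma lucUSS a M n : lucU a M n.+2 = a * lucU a M n.+1 - M * lucU a M n.
Proof. by []. Qed.
Lemma lucV0 a M : lucV a M 0 = 2. Proof. by []. Qed.
Lemma lucV1 a M : lucV a M 1 = a. Proof. by []. Qed.
Lemma lucVSS a M n : lucV a M n.+2 = a * lucV a M n.+1 - M * lucV a M n.
Proof. by []. Qed.

(** Multiplication by [(a + sqrt D) / 2] in coordinates; the doubled form avoids halves. *)
Lemma lucUV_step a M n :
  2 * lucU a M n.+1 = a * lucU a M n + lucV a M n /\
  2 * lucV a M n.+1 = a * lucV a M n + (a ^+ 2 - 4 * M) * lucU a M n.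
Proof.
elim: n => [|n [hU hV]]; first by rewrite lucU1 lucU0 lucV1 lucV0; split; ring.
have eV : lucV a M n = 2 * lucU a M n.+1 - a * lucU a M n by rewrite hU; ring.
have eV1 : lucV a M n.+1 = a * lucU a M n.+1 - 2 * M * lucU a M n.
  by apply: (@mulfI _ (2 : int)) => //; rewrite hV eV; ring.
by rewrite lucUSS lucVSS eV1 eV; split; ring.
Qed.

Lemma lucU_step a M n : 2 * lucU a M n.+1 = a * lucU a M n + lucV a M n.
Proof. by case: (lucUV_step a M n). Qed.

Lemma lucV_step a M n :
  2 * lucV a M n.+1 = a * lucV a M n + (a ^+ 2 - 4 * M) * lucU a M n.
Proof. by case: (lucUV_step a M n). Qed.

Lemma lucV_lucU a M n : lucV a M n = 2 * lucU a M n.+1 - a * lucU a M n.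
Proof. by rewrite lucU_step; ring. Qed.

Lemma lucVS_lucU a M n :
  lucV a M n.+1 = a * lucU a M n.+1 - 2 * M * lucU a M n.
Proof. by rewrite lucV_lucU lucUSS; ring. Qed.

Lemma lucUV_norm a M n :
  lucV a M n ^+ 2 - (a ^+ 2 - 4 * M) * lucU a M n ^+ 2 = 4 * M ^+ n.
Proof.
elim: n => [|n IH]; first by rewrite lucV0 lucU0; ring.
apply: (@mulfI _ (4 : int)) => //.
transitivity ((2 * lucV a M n.+1) ^+ 2 -
  (a ^+ 2 - 4 * M) * (2 * lucU a M n.+1) ^+ 2); first by ring.
rewrite lucU_step lucV_step [M ^+ n.+1]exprS.
transitivity (4 * M * (lucV a M n ^+ 2 - (a ^+ 2 - 4 * M) * lucU a M n ^+ 2)).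
  by ring.
by rewrite IH; ring.
Qed.

Lemma lucV_mod_norm a M n : (M %| lucV a M n.+1 - a ^+ n.+1)%Z.
Proof.
elim: n => [|n /dvdzP[k /eqP]]; first by rewrite lucV1 expr1 subrr dvdz0.
rewrite subr_eq => /eqP hk; apply/dvdzP; exists (a * k - lucV a M n).
by rewrite lucVSS hk !exprS; ring.
Qed.

Lemma lucU_mod_norm a M n : (M %| lucU a M n.+1 - a ^+ n)%Z.
Proof.
elim: n => [|n /dvdzP[k /eqP]]; first by rewrite lucU1 expr0 subrr dvdz0.
rewrite subr_eq => /eqP hk; apply/dvdzP; exists (a * k - lucU a M n).
by rewrite lucUSS hk !exprS; ring.
Qed.

Lemma lucU_opp a M n : lucU (- a) M n = (-1) ^+ n.+1 * lucU a M n.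
Proof.
elim/ltn_ind: n => -[|[|n]] IH; rewrite ?lucU0 ?lucU1 ?lucUSS; [ring|ring|].
by rewrite !IH // !exprS; ring.
Qed.

Lemma lucV_opp a M n : lucV (- a) M n = (-1) ^+ n * lucV a M n.
Proof.
elim/ltn_ind: n => -[|[|n]] IH; rewrite ?lucV0 ?lucV1 ?lucVSS; [ring|ring|].
by rewrite !IH // !exprS; ring.
Qed.

Lemma lucU_addS a M m n :
  lucU a M (m + n).+1 =
  lucU a M m.+1 * lucU a M n.+1 - M * lucU a M m * lucU a M n.
Proof.
elim/ltn_ind: n => -[|[|n]] IH.
- by rewrite addn0 lucU1 lucU0; ring.
- by rewrite addn1 !lucUSS lucU1 lucU0; ring.
- have h1 := IH n.+1 (ltnSn _); have h0 := IH n (leqnSn _).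
  by move: h1; rewrite !addnS [lucU a M (m + n).+3]lucUSS h0 => ->; rewrite !lucUSS; ring.
Qed.

Lemma dvdz_lucU a M k m : (lucU a M k %| lucU a M (k * m))%Z.
Proof.
case: k => [|k]; first by rewrite mul0n.
elim: m => [|m IH]; first by rewrite muln0 lucU0 dvdz0.
rewrite mulnS addSn addnC lucU_addS.
by apply: rpredB; [exact: dvdz_mull | apply/dvdz_mulr/dvdz_mull].
Qed.

(* Up to powers of 2 these are the coordinates of [(a + sqrt D) ^ n]. *)
Lemma lucUV_sum a M n (D := a ^+ 2 - 4 * M) :
  2 ^+ n * lucU a M n =
    2 * \sum_(0 <= k < n) 'C(n, k.*2.+1)%:R * a ^+ (n - k.*2.+1) * D ^+ k /\
  2 ^+ n * lucV a M n =
    2 * \sum_(0 <= k < n.+1) 'C(n, k.*2)%:R * a ^+ (n - k.*2) * D ^+ k.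
Proof.
elim: n => [|n [hU hV]].
  by rewrite big_nil big_nat1 bin0 lucU0 lucV0 !expr0; split; ring.
have hU' : 2 ^+ n.+1 * lucU a M n.+1 =
   a * (2 ^+ n * lucU a M n) + 2 ^+ n * lucV a M n.
  by rewrite exprSr -mulrA lucU_step; ring.
have hV' : 2 ^+ n.+1 * lucV a M n.+1 =
   a * (2 ^+ n * lucV a M n) + D * (2 ^+ n * lucU a M n).
  by rewrite exprSr -mulrA lucV_step -/D; ring.
have aE (m j : nat) : a * ('C(m, j)%:R * a ^+ (m - j)) =
    'C(m, j)%:R * a ^+ (m.+1 - j).
  have [jm|mj] := leqP j m; first by rewrite subSn// exprS; ring.
  by rewrite bin_small// !mul0r mulr0.
split.
- rewrite hU' hU hV mulrCA -mulrDr; congr (_ * _).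
  have -> : \sum_(0 <= k < n) 'C(n, k.*2.+1)%:R * a ^+ (n - k.*2.+1) * D ^+ k =
     \sum_(0 <= k < n.+1) 'C(n, k.*2.+1)%:R * a ^+ (n - k.*2.+1) * D ^+ k.
    by rewrite big_nat_recr//= bin_small ?mul0r ?addr0//; lia.
  rewrite mulr_sumr -big_split; apply: eq_bigr => k _ /=.
  by rewrite !mulrA -[a * _ * _]mulrA aE subSS binS natrD; ring.
- rewrite hV' hU hV !(mulrCA _ 2) -mulrDr; congr (_ * _).
  rewrite big_nat_recl// !bin0 subn0 mul1r expr0 mulr1.
  rewrite [in RHS]big_nat_recl// !bin0 subn0 mul1r expr0 mulr1.
  rewrite mulrDr -exprS -addrA; congr (_ + _).
  rewrite [in RHS]big_nat_recr//= bin_small ?mul0r ?addr0; last by lia.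
  rewrite !mulr_sumr -big_split; apply: eq_bigr => k _ /=.
  by rewrite !doubleS subSS !mulrA -[a * _ * _]mulrA aE binS natrD exprS; ring.
Qed.

(** * Congruences modulo a prime and the law of apparition *)

Lemma dvdz_primeM (q : nat) (m n : int) :
  prime q -> (q %| m * n)%Z = (q %| m)%Z || (q %| n)%Z.
Proof. by move=> hq; rewrite !dvdzE abszM Euclid_dvdM. Qed.

Lemma dvdz_primeX (q : nat) (m : int) n :
  prime q -> (q %| m ^+ n)%Z = (q %| m)%Z && (0 < n)%N.
Proof. by move=> hq; rewrite !dvdzE abszX Euclid_dvdX. Qed.

Lemma prime_coprimez (q : nat) (m : int) :
  prime q -> coprimez q m = ~~ (q %| m)%Z.
Proof. by move=> hq; rewrite coprimezE prime_coprime. Qed.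

Lemma dvdz_Fp (q : nat) (m : int) :
  prime q -> (q %| m)%Z = (m%:~R == 0 :> 'F_q).
Proof. by move=> hq; rewrite (dvdz_pcharf (pchar_Fp hq)). Qed.

Lemma Fp_exp_char (q : nat) (t : 'F_q) : prime q -> t ^+ q = t.
Proof. by move=> hq; have := expf_card t; rewrite (card_Fp hq). Qed.

Lemma fermatz (q : nat) (m : int) : prime q -> (q %| m ^+ q - m)%Z.
Proof.
by move=> hq; rewrite dvdz_Fp// rmorphB rmorphXn/= Fp_exp_char ?subrr.
Qed.

Lemma fermatz_pred (q : nat) (m : int) :
  prime q -> ~~ (q %| m)%Z -> (q %| m ^+ q.-1 - 1)%Z.
Proof.
move=> hq hm; have := fermatz m hq.
have -> : m ^+ q - m = m * (m ^+ q.-1 - 1).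
  by rewrite mulrBr mulr1 -exprS prednK ?prime_gt0.
by rewrite dvdz_primeM// (negPf hm).
Qed.

(* The terms of index [k] with [0 < k < (r-1)/2] carry a factor [r] from the
   binomial coefficient and another from [D]. *)
Lemma lucU_prime_mod_sq (r : nat) (a M : int) (D := a ^+ 2 - 4 * M) :
  prime r -> (3 < r)%N -> (r %| D)%Z ->
  ((r ^ 2)%N %| 2 ^+ r.-1 * lucU a M r - r%:Z * a ^+ r.-1)%Z.
Proof.
move=> hr hr3 hD.
have r0 : (0 < r)%N by lia.
have [hU _] := lucUV_sum a M r.
have -> : 2 ^+ r.-1 * lucU a M r =
   \sum_(0 <= k < r) 'C(r, k.*2.+1)%:R * a ^+ (r - k.*2.+1) * D ^+ k.
  by apply: (@mulfI _ (2 : int)) => //; rewrite mulrA -exprS prednK.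
rewrite big_ltn// bin1 expr0 mulr1 subn1 natz addrAC subrr add0r.
rewrite big_seq; apply: rpred_sum => k; rewrite mem_index_iota => /andP[k1 _].
have [h|h] := ltnP r k.*2.+1; first by rewrite bin_small// !mul0r dvdz0.
(* The term with [2k + 1 = r] has binomial coefficient 1, but [k >= 2] because [r > 3], so [D ^ k]
   alone supplies [r ^ 2]. *)
rewrite expnS expn1 PoszM; move: h; rewrite leq_eqVlt => /predU1P[h|h].
  have -> : k = k.-2.+2 by lia.
  by rewrite !exprS; apply: dvdz_mull; rewrite mulrA; apply: dvdz_mulr; exact: dvdz_mul.
apply: dvdz_mul; last by apply: dvdz_exp.
apply: dvdz_mulr; rewrite natz; exact: prime_dvd_bin.
Qed.

(** In the binomial expansion only the coefficient ['C(q, q)] survives modulo [q], and the factor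
    [2 ^ (q - 1)] is 1 by Fermat. *)
Lemma lucU_prime_mod (q : nat) (a M : int) (D := a ^+ 2 - 4 * M) :
  prime q -> odd q -> (q %| lucU a M q - D ^+ q./2)%Z.
Proof.
move=> hq oq; have q0 := prime_gt0 hq.
have n2q : ~~ (q %| 2%:Z)%Z.
  by rewrite dvdzE/= dvdn_prime2//; apply: contraTneq oq => ->.
have [hU _] := lucUV_sum a M q.
have hU' : 2 ^+ q.-1 * lucU a M q =
   \sum_(0 <= k < q) 'C(q, k.*2.+1)%:R * a ^+ (q - k.*2.+1) * D ^+ k.
  by apply: (@mulfI _ (2 : int)) => //; rewrite mulrA -exprS prednK.
have h1 : (q %| 2 ^+ q.-1 * lucU a M q - D ^+ q./2)%Z.
  rewrite hU' (bigD1_seq q./2) ?iota_uniq//=; last by rewrite mem_index_iota; lia.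
  have -> : q./2.*2.+1 = q by lia.
  rewrite binn subnn expr0 !mul1r addrAC subrr add0r.
  apply: rpred_sum => k hk; apply: dvdz_mulr; apply: dvdz_mulr.
  have [h|h] := ltnP q k.*2.+1; first by rewrite bin_small// dvdz0.
  by rewrite natz; apply: prime_dvd_bin => //; lia.
have h2 := fermatz_pred hq n2q.
have -> : lucU a M q - D ^+ q./2 = (2 ^+ q.-1 * lucU a M q - D ^+ q./2) -
   (2 ^+ q.-1 - 1) * lucU a M q by ring.
by rewrite rpredB// dvdz_mulr.
Qed.

Lemma lucV_prime_mod (q : nat) (a M : int) :
  prime q -> odd q -> (q %| lucV a M q - a)%Z.
Proof.
move=> hq oq; have q0 := prime_gt0 hq.
have n2q : ~~ (q %| 2%:Z)%Z.
  by rewrite dvdzE/= dvdn_prime2//; apply: contraTneq oq => ->.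
set D := a ^+ 2 - 4 * M.
have [_ hV] := lucUV_sum a M q.
have hV' : 2 ^+ q.-1 * lucV a M q =
   \sum_(0 <= k < q.+1) 'C(q, k.*2)%:R * a ^+ (q - k.*2) * D ^+ k.
  by apply: (@mulfI _ (2 : int)) => //; rewrite mulrA -exprS prednK.
have h1 : (q %| 2 ^+ q.-1 * lucV a M q - a ^+ q)%Z.
  rewrite hV' big_ltn// bin0 subn0 expr0 mulr1 mul1r addrAC subrr add0r.
  rewrite big_seq; apply: rpred_sum => k; rewrite mem_index_iota => /andP[k1 _].
  apply: dvdz_mulr; apply: dvdz_mulr.
  have [h|h] := ltnP q k.*2; first by rewrite bin_small// dvdz0.
  by rewrite natz; apply: prime_dvd_bin => //; lia.
have h2 := fermatz_pred hq n2q; have h3 := fermatz a hq.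
have -> : lucV a M q - a = (2 ^+ q.-1 * lucV a M q - a ^+ q) -
   (2 ^+ q.-1 - 1) * lucV a M q + (a ^+ q - a) by ring.
by rewrite rpredD// rpredB// dvdz_mulr.
Qed.

Lemma euler_criterion (q : nat) (x : 'F_q) :
  prime q -> odd q -> x != 0 ->
  x ^+ q./2 = if [exists t : 'F_q, t ^+ 2 == x] then 1 else -1.
Proof.
move=> hq oq x0.
have q2 : q.-1 = (2 * q./2)%N by lia.
have Fq1 (t : 'F_q) : t != 0 -> t ^+ q.-1 = 1.
  move=> t0; apply: (mulfI t0); rewrite -exprS prednK ?prime_gt0// mulr1.
  exact: Fp_exp_char.
case: existsP => [[t /eqP tx]|nsq].
  rewrite -tx -exprM -q2 Fq1//; apply: contraNneq x0 => t0.
  by rewrite -tx t0 expr0n.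
have /eqP := Fq1 x x0; rewrite q2 mulnC exprM sqrf_eq1 => /orP[/eqP x1|/eqP//].
case: nsq.
have h0 : (0 < q./2)%N by have := prime_gt1 hq; lia.
(* The squares of [1, ..., q./2] are already [q./2] distinct roots of [X^(q./2) - 1]; a nonsquare
   root [x] would be one too many. *)
pose s : seq 'F_q := [seq i.+1%:R ^+ 2 | i <- iota 0 q./2].
have natE (m n : nat) : (m < q)%N -> (n < q)%N -> (m%:R == n%:R :> 'F_q) = (m == n).
  move=> mq nq; rewrite -(inj_eq val_inj) /= !val_Fp_nat//.
  by rewrite !modn_small.
have nat0 (m : nat) : (0 < m < q)%N -> (m%:R : 'F_q) != 0.
  by move=> hm; rewrite -[0]/(0%N%:R) natE; lia.
have us : uniq s.
  rewrite map_inj_in_uniq ?iota_uniq// => i j; rewrite !mem_iota => hi hj.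
  move/eqP; rewrite eqf_sqr => /orP[|]; first by rewrite natE; [move/eqP => []|lia|lia].
  rewrite -addr_eq0 -natrD => h.
  by move: (nat0 (i.+1 + j.+1)%N); rewrite h => /(_ _)/negP; case; lia.
have [/mapP[i _ ->]|xs] := boolP (x \in s); first by exists (i.+1%:R).
have := @max_poly_roots _ ('X^(q./2) - 1) (x :: s).
rewrite -size_poly_gt0 size_XnsubC// /= xs us /= size_map size_iota ltnn.
suff -> : root ('X^(q./2) - 1) x && all (root ('X^(q./2) - 1)) s by move=> /(_ isT isT isT).
rewrite rootE !hornerE x1 subrr eqxx/=.
apply/allP => _ /mapP[i hi ->]; rewrite rootE !hornerE -exprM -q2 Fq1 ?subrr//.
by apply: nat0; move: hi; rewrite mem_iota; lia.
Qed.

Lemma legendre_Fp (q : nat) (x : int) :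
  prime q -> odd q -> ~~ (q %| x)%Z ->
  legendre x q = if [exists t : 'F_q, t ^+ 2 == x%:~R] then 1 else -1.
Proof.
move=> hq oq qx; rewrite /legendre (negPf qx) orbF.
case: eqP => [q2|_]; first by rewrite q2 in oq.
congr (if _ then _ else _); apply/existsP/existsP => -[t ht].
  exists (t%:R); rewrite eqz_mod_dvd dvdz_Fp// in ht.
  by rewrite rmorphB rmorphXn /= subr_eq0 in ht.
have tq : (t < q)%N by have := ltn_ord t; rewrite {2}Fp_cast.
exists (Ordinal tq); rewrite eqz_mod_dvd dvdz_Fp//.
by rewrite rmorphB rmorphXn /= subr_eq0 -pmulrn natr_Zp.
Qed.

(* Law of apparition: the Frobenius acts on [(a + sqrt D) / 2] trivially or as
   conjugation, according to whether [D] is a square modulo [q]. *)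
Lemma lucU_apparition (q P : nat) (a w M : int) :
  prime q -> odd q -> ~~ (q %| P)%N -> ~~ (q %| M)%Z -> ~~ (q %| w)%Z ->
  a ^+ 2 + P%:Z * w ^+ 2 = 4 * M ->
  (q %| lucU a M `|(q%:Z - legendre (- P%:Z) q)%R|%N)%Z.
Proof.
move=> hq oq qP qM qw e.
have q1 := prime_gt1 hq.
have qP' : ~~ (q %| - P%:Z)%Z by rewrite dvdzE abszN.
have nw : (w%:~R : 'F_q) != 0 by rewrite -dvdz_Fp.
have nP : ((- P%:Z)%:~R : 'F_q) != 0 by rewrite -dvdz_Fp.
have q2 : ~~ (q %| 2%:Z)%Z.
  by rewrite dvdzE/= dvdn_prime2//; apply: contraTneq oq => ->.
have hD : a ^+ 2 - 4 * M = - P%:Z * w ^+ 2 by rewrite -e; ring.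
have hsq : [exists t : 'F_q, t ^+ 2 == (- P%:Z)%:~R] =
           [exists t : 'F_q, t ^+ 2 == (- P%:Z * w ^+ 2)%:~R].
  apply/existsP/existsP => -[t /eqP ht].
    by exists (t * w%:~R); rewrite exprMn ht rmorphM rmorphXn.
  exists (t / w%:~R); rewrite expr_div_n ht rmorphM rmorphXn /=.
  by rewrite mulfK// expf_neq0.
have hU := lucU_prime_mod a M hq oq; have hV := lucV_prime_mod a M hq oq.
have := @euler_criterion q (- P%:Z * w ^+ 2)%:~R hq oq.
rewrite {1}rmorphM rmorphXn /= mulf_neq0// ?expf_neq0// => /(_ isT).
rewrite -hsq -rmorphXn/= -hD legendre_Fp//; case: ifP => _ hE.
- have {}hE : (q %| (a ^+ 2 - 4 * M) ^+ q./2 - 1)%Z.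
    by rewrite dvdz_Fp// rmorphB/= hE subrr.
  have -> : `|(q%:Z - 1)%R|%N = q.-1 by clear -q1; lia.
  have := lucVS_lucU a M q.-1; rewrite prednK ?(ltnW q1)// => h.
  (* [V_q = a U_q - 2 M U_(q-1)], while [U_q = 1] and [V_q = a] modulo [q]. *)
  suff : (q %| 2 * (M * lucU a M q.-1))%Z.
    by rewrite dvdz_primeM// (negPf q2) dvdz_primeM// (negPf qM).
  have -> : 2 * (M * lucU a M q.-1) =
     a * ((lucU a M q - (a ^+ 2 - 4 * M) ^+ q./2) + ((a ^+ 2 - 4 * M) ^+ q./2 - 1)) -
     (lucV a M q - a) by rewrite h; ring.
  by rewrite rpredB// dvdz_mull// rpredD.
- have {}hE : (q %| (a ^+ 2 - 4 * M) ^+ q./2 + 1)%Z.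
    by rewrite dvdz_Fp// rmorphD/= hE addNr.
  have -> : `|(q%:Z - -1)%R|%N = q.+1 by clear; lia.
  have h := lucU_step a M q.
  suff : (q %| 2 * lucU a M q.+1)%Z by rewrite dvdz_primeM// (negPf q2).
  have -> : 2 * lucU a M q.+1 =
     a * ((lucU a M q - (a ^+ 2 - 4 * M) ^+ q./2) + ((a ^+ 2 - 4 * M) ^+ q./2 + 1)) +
     (lucV a M q - a) by rewrite h; ring.
  by rewrite rpredD// dvdz_mull// rpredD.
Qed.

(** Modulo [a] the roots are opposite, so [a] splits off from [V] of odd index and the cofactor [W]
    is known modulo [a ^ 2]. Hence a prime dividing [a] and [W] but not [M] divides the index. *)
Lemma lucV_odd_index a M k :
  exists2 W, lucV a M k.*2.+1 = a * W &
    (a ^+ 2 %| W - (-1) ^+ k * (k.*2.+1)%:Z * M ^+ k)%Z.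
Proof.
suff [W hW [/dvdzP[l /eqP hl] _]] : exists2 W, lucV a M k.*2.+1 = a * W &
    (a ^+ 2 %| W - (-1) ^+ k * (k.*2.+1)%:Z * M ^+ k)%Z /\
    (a ^+ 2 %| lucV a M k.*2 - 2 * (-1) ^+ k * M ^+ k)%Z.
  by exists W => //; apply/dvdzP; exists l; apply/eqP.
elim: k => [|k [W hW [/dvdzP[l /eqP hl] /dvdzP[m /eqP hm]]]].
  by exists 1; rewrite ?mulr1// !expr0 !mul1r mulr1 !subrr; split; exact: dvdz0.
move: hl hm; rewrite !subr_eq => /eqP hl /eqP hm.
have hV : lucV a M k.*2.+2 = a ^+ 2 * W - M * lucV a M k.*2.
  by rewrite lucVSS hW; ring.
exists (a ^+ 2 * W - M * lucV a M k.*2 - M * W).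
  by rewrite doubleS lucVSS hV hW; ring.
split; apply/dvdzP; last first.
  by exists (W - M * m); rewrite doubleS hV hm !exprS; ring.
exists (W - M * m - M * l).
have -> : (k.+1.*2.+1)%:Z = (k.*2.+1)%:Z + 2 by rewrite doubleS -PoszD addn2.
by rewrite hm {2}hl !exprS; ring.
Qed.

(** For trace 2 the discriminant is [- 4 B], whose powers of 4 cancel the powers of 2 in the general
    expansion. *)
Lemma lucU2_sum B n :
  lucU 2 (1 + B) n = \sum_(0 <= k < n) 'C(n, k.*2.+1)%:R * (- B) ^+ k.
Proof.
have [h _] := lucUV_sum 2 (1 + B) n.
apply: (@mulfI _ (2 ^+ n : int)); first by rewrite expf_neq0.
rewrite h !mulr_sumr; apply: eq_bigr => k _.
have [hk|hk] := leqP k.*2.+1 n; last by rewrite bin_small// !mul0r !mulr0.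
have -> : 2 ^+ 2 - 4 * (1 + B) = 2 ^+ 2 * (- B) by ring.
have -> : (2 : int) ^+ n = 2 * 2 ^+ (n - k.*2.+1) * 2 ^+ (2 * k).
  by rewrite -exprS -exprD; congr (_ ^+ _); lia.
by rewrite exprMn -exprM; ring.
Qed.

(** * Elements of prime power norm *)

Lemma even_mulz_succ (z : int) : exists m, z * (z + 1) = 2 * m.
Proof.
have [k [->|->]] : exists k, z = 2 * k \/ z = 2 * k + 1.
  by exists (z %/ 2)%Z; lia.
- by exists (k * (2 * k + 1)); ring.
- by exists ((2 * k + 1) * (k + 1)); ring.
Qed.

(* [(u, w)] stands for [(u + w sqrt (- P)) / 2], an element of norm [y ^ i] with
   trace prime to [y], lying in the order of conductor [f] attached to [w]. *)
Definition rep (P f y i : nat) (u w : int) : Prop :=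
  [/\ u ^+ 2 + P%:Z * w ^+ 2 = 4 * y%:Z ^+ i, (f %| w)%Z
    & (0 < i)%N -> coprimez u y].

Section Rep.

Variables P f y : nat.
Hypotheses (hy : prime y) (hP : coprime P y) (hf : coprime f y).

Lemma rep_opp i u w : rep P f y i u w -> rep P f y i u (- w).
Proof. by case=> e fw c; split; rewrite ?sqrrN// rpredN. Qed.

(** The square of [u - P w] is even, by the norm equation and the parity of [P (P - 1)]. This lets
    the coordinates of a product be halved. *)
Lemma rep_parity i u w : rep P f y i u w -> (2%:Z %| u - P%:Z * w)%Z.
Proof.
case=> e _ _.
have : (2%:Z %| (u - P%:Z * w) ^+ 2)%Z.
  have -> : (u - P%:Z * w) ^+ 2 =
    2 * (2 * y%:Z ^+ i - P%:Z * u * w) + P%:Z * (P%:Z - 1) * w ^+ 2.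
    transitivity (u ^+ 2 + P%:Z * w ^+ 2 - 2 * P%:Z * u * w +
      P%:Z * (P%:Z - 1) * w ^+ 2); first by ring.
    by rewrite e; ring.
  have [m hm] := even_mulz_succ (P%:Z - 1).
  apply: rpredD; first exact: dvdz_mulr.
  have -> : P%:Z * (P%:Z - 1) = 2 * m by rewrite -hm; ring.
  by rewrite -mulrA dvdz_mulr.
by rewrite dvdz_primeX// => /andP[].
Qed.

Lemma rep_mul_conj i j u w u' w' :
  rep P f y i u w -> rep P f y j u' w' ->
  exists T W : int, [/\ u * u' + P%:Z * w * w' = 2 * T,
    w * u' - u * w' = 2 * W & (f %| W)%Z].
Proof.
move=> r1 r2; have [_ fw _] := r1; have [_ fw' _] := r2.
move/rep_parity/dvdzP: r1 => [k /eqP]; rewrite subr_eq => /eqP ->.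
move/rep_parity/dvdzP: r2 => [l /eqP]; rewrite subr_eq => /eqP ->.
have [m hm] := even_mulz_succ P%:Z.
exists (2 * k * l + k * P%:Z * w' + l * P%:Z * w + m * w * w'), (w * l - w' * k).
split; [|by ring|by rewrite rpredB// dvdz_mulr].
transitivity (2 * (2 * k * l + k * P%:Z * w' + l * P%:Z * w) +
  (P%:Z * (P%:Z + 1)) * w * w'); [by ring | by rewrite hm; ring].
Qed.

Lemma yX_neq0 i : y%:Z ^+ i != 0.
Proof. by rewrite expf_neq0// -lt0n prime_gt0. Qed.

Lemma coprime_yP : coprimez y P. Proof. by rewrite coprimez_sym. Qed.
Lemma coprime_yf : coprimez y f. Proof. by rewrite coprimez_sym. Qed.

(** [T] and [T'] are the traces of [gamma] times the conjugate of [delta], and of [gamma delta].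
    Their product is divisible by [y ^ j], while their sum [u u'] is prime to [y], so one of them
    takes all of [y ^ j]. *)
Lemma rep_trace_dvd i j u w u' w' T T' :
  rep P f y i u w -> rep P f y j u' w' -> (0 < j <= i)%N ->
  u * u' + P%:Z * w * w' = 2 * T -> u * u' - P%:Z * w * w' = 2 * T' ->
  (y%:Z ^+ j %| T)%Z \/ (y%:Z ^+ j %| T')%Z.
Proof.
move=> [e _ c] [e' _ c'] /andP[j0 ji] hT hT'.
have {}c := c (leq_trans j0 ji); have {}c' := c' j0.
have hsum : T + T' = u * u'.
  by apply: (@mulfI _ (2 : int)) => //; rewrite mulrDr -hT -hT'; ring.
have hprod : T * T' = y%:Z ^+ j * (u ^+ 2 + y%:Z ^+ (i - j) * (u' ^+ 2 - 4 * y%:Z ^+ j)).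
  apply: (@mulfI _ (4 : int)) => //.
  transitivity ((2 * T) * (2 * T')); first by ring.
  rewrite -hT -hT'.
  transitivity ((u * u') ^+ 2 - (P%:Z * w ^+ 2) * (P%:Z * w' ^+ 2)); first by ring.
  have -> : P%:Z * w ^+ 2 = 4 * y%:Z ^+ (i - j) * y%:Z ^+ j - u ^+ 2.
    by rewrite -mulrA -exprD subnK// -e; ring.
  have -> : P%:Z * w' ^+ 2 = 4 * y%:Z ^+ j - u' ^+ 2 by rewrite -e'; ring.
  by ring.
have hd : (y%:Z ^+ j %| T * T')%Z by rewrite hprod dvdz_mulr.
have [yT|yT] := boolP (y %| T)%Z; last first.
  by right; move: hd; rewrite Gauss_dvdzr//; apply: coprimezXl; rewrite prime_coprimez.
left; move: hd; rewrite Gauss_dvdzl//; apply: coprimezXl; rewrite prime_coprimez//.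
apply/negP => yT'; have : (y %| u * u')%Z by rewrite -hsum rpredD.
apply/negP; rewrite -prime_coprimez// coprimezMr.
by rewrite coprimez_sym c coprimez_sym c'.
Qed.

(** The quotient of [gamma] by [delta] is [gamma] times the conjugate of [delta], over [y ^ j]. Once
    [y ^ j] divides the trace, the norm equation makes it divide the other coordinate, [P] being
    prime to [y]. *)
Lemma rep_div i j u w u' w' T :
  rep P f y i u w -> rep P f y j u' w' -> (0 < j <= i)%N ->
  u * u' + P%:Z * w * w' = 2 * T -> (y%:Z ^+ j %| T)%Z ->
  exists t v : int, [/\ rep P f y (i - j) t v,
    u * u' + P%:Z * w * w' = 2 * y%:Z ^+ j * t &
    w * u' - u * w' = 2 * y%:Z ^+ j * v].
Proof.
move=> r1 r2 /andP[j0 ji] hT /dvdzP[t tE].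
have [T1 [W [hT1 hW fW]]] := rep_mul_conj r1 r2.
have {hT1}TE : T1 = T by apply: (@mulfI _ (2 : int)) => //; rewrite -hT1 hT.
subst T1.
have [e _ c] := r1; have [e' _ c'] := r2.
have {}c := c (leq_trans j0 ji); have {}c' := c' j0.
have hN : T ^+ 2 + P%:Z * W ^+ 2 = 4 * y%:Z ^+ (i - j) * y%:Z ^+ j * y%:Z ^+ j.
  apply: (@mulfI _ (4 : int)) => //.
  transitivity ((2 * T) ^+ 2 + P%:Z * (2 * W) ^+ 2); first by ring.
  rewrite -hT -hW.
  transitivity ((u ^+ 2 + P%:Z * w ^+ 2) * (u' ^+ 2 + P%:Z * w' ^+ 2)); first by ring.
  by rewrite e e' -[4 * _ * y%:Z ^+ j]mulrA -exprD subnK//; ring.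
have : (y%:Z ^+ j %| W)%Z.
  rewrite -(@dvdz_pexp2r _ _ 2)// -(@Gauss_dvdzr _ P); last first.
    by do 2 apply: coprimezXl; exact: coprime_yP.
  have -> : P%:Z * W ^+ 2 = (4 * y%:Z ^+ (i - j) - t ^+ 2) * (y%:Z ^+ j) ^+ 2.
    by move: hN; rewrite tE => /eqP; rewrite -subr_eq0 => /eqP h; apply/eqP;
       rewrite -subr_eq0; apply/eqP; rewrite -[RHS]h; ring.
  exact: dvdz_mull.
case/dvdzP=> v vE; exists t, v; split; last 2 first.
- by rewrite hT tE; ring.
- by rewrite hW vE; ring.
have e2 : t ^+ 2 + P%:Z * v ^+ 2 = 4 * y%:Z ^+ (i - j).
  apply: (@mulfI _ (y%:Z ^+ j * y%:Z ^+ j)); first by rewrite mulf_neq0 ?yX_neq0.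
  transitivity ((t * y%:Z ^+ j) ^+ 2 + P%:Z * (v * y%:Z ^+ j) ^+ 2); first by ring.
  by rewrite -tE -vE hN; ring.
split=> //.
  by move: fW; rewrite vE Gauss_dvdzl//; apply: coprimezXr; rewrite coprimez_sym coprime_yf.
move=> ij; rewrite coprimez_sym prime_coprimez//; apply/negP => yt.
have [T' [_ [hT' _ _]]] := rep_mul_conj r1 (rep_opp r2).
(* The quotient has trace prime to [y] because [t T'] is [u ^ 2] modulo [y]. *)
have hprod : t * T' = u ^+ 2 + y%:Z ^+ (i - j) * (u' ^+ 2 - 4 * y%:Z ^+ j).
  apply: (@mulfI _ (4 * y%:Z ^+ j)); first by rewrite mulf_neq0 ?yX_neq0.
  transitivity ((2 * (t * y%:Z ^+ j)) * (2 * T')); first by ring.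
  rewrite -tE -hT -hT'.
  transitivity ((u * u') ^+ 2 - (P%:Z * w ^+ 2) * (P%:Z * w' ^+ 2)); first by ring.
  have -> : P%:Z * w ^+ 2 = 4 * y%:Z ^+ (i - j) * y%:Z ^+ j - u ^+ 2.
    by rewrite -mulrA -exprD subnK// -e; ring.
  have -> : P%:Z * w' ^+ 2 = 4 * y%:Z ^+ j - u' ^+ 2 by rewrite -e'; ring.
  by ring.
have : (y %| u ^+ 2)%Z.
  have -> : u ^+ 2 = t * T' - y%:Z ^+ (i - j) * (u' ^+ 2 - 4 * y%:Z ^+ j).
    by rewrite hprod; ring.
  by rewrite rpredB// dvdz_mulr// -(prednK ij) exprS dvdz_mulr.
by rewrite dvdz_primeX// andbT; apply/negP; rewrite -prime_coprimez// coprimez_sym.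
Qed.

Lemma rep_sub i j u w u' w' :
  rep P f y i u w -> rep P f y j u' w' -> (0 < j <= i)%N ->
  exists t v, rep P f y (i - j) t v.
Proof.
move=> r1 r2 hij.
have [T [_ [hT _ _]]] := rep_mul_conj r1 r2.
have [T' [_ [hT' _ _]]] := rep_mul_conj r1 (rep_opp r2).
have hT'' : u * u' - P%:Z * w * w' = 2 * T' by rewrite -hT'; ring.
case: (rep_trace_dvd r1 r2 hij hT hT'') => h.
  by have [t [v [? _ _]]] := rep_div r1 r2 hij hT h; exists t, v.
by have [t [v [? _ _]]] := rep_div r1 (rep_opp r2) hij hT' h; exists t, v.
Qed.

Lemma rep_sub_mul i j k u w u' w' :
  rep P f y i u w -> rep P f y j u' w' -> (0 < j)%N -> (k * j <= i)%N ->
  exists t v, rep P f y (i - k * j) t v.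
Proof.
move=> r1 r2 j0; elim: k => [|k IH] kj; first by exists u, w; rewrite mul0n subn0.
have kj' : (k * j <= i)%N by rewrite mulSn in kj; lia.
have [t [v r]] := IH kj'.
have -> : (i - k.+1 * j = (i - k * j) - j)%N by rewrite mulSn; lia.
by apply: rep_sub r r2 _; rewrite mulSn in kj; lia.
Qed.

Lemma rep_gcd i j u w u' w' :
  rep P f y i u w -> rep P f y j u' w' -> (0 < i)%N -> (0 < j)%N ->
  exists t v, rep P f y (gcdn i j) t v.
Proof.
have [n] := ubnP (i + j); elim: n i j u w u' w' => // n IH i j u w u' w' hn r1 r2 i0 j0.
have [ij|ij|<-] := ltngtP i j; last by exists u, w; rewrite gcdnn.
- have [t [v r]] : exists t v, rep P f y (j - i) t v.
    by apply: rep_sub r2 r1 _; rewrite i0 ltnW.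
  have -> : gcdn i j = gcdn i (j - i) by rewrite -{1}(subnKC (ltnW ij)) gcdnDl.
  by apply: IH r1 r _ _; lia.
- have [t [v r]] : exists t v, rep P f y (i - j) t v.
    by apply: rep_sub r1 r2 _; rewrite j0 ltnW.
  have -> : gcdn i j = gcdn (i - j) j.
    by rewrite gcdnC -{1}(subnKC (ltnW ij)) gcdnDl gcdnC.
  by apply: IH r r2 _ _; lia.
Qed.

Lemma rep_exp i k u w : (0 < i)%N -> rep P f y i u w ->
  rep P f y (i * k) (lucV u (y%:Z ^+ i) k) (w * lucU u (y%:Z ^+ i) k).
Proof.
move=> i0 [e fw c]; have {}c := c i0; split; last first.
- case: k => [|k]; first by rewrite muln0.
  move=> _; rewrite coprimez_sym prime_coprimez//; apply/negP => h.
  have : (y %| u ^+ k.+1)%Z.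
    have h2 := lucV_mod_norm u (y%:Z ^+ i) k.
    have -> : u ^+ k.+1 = lucV u (y%:Z ^+ i) k.+1 - (lucV u (y%:Z ^+ i) k.+1 - u ^+ k.+1).
      by ring.
    by rewrite rpredB//; apply: dvdz_trans h2; rewrite -(prednK i0) exprS dvdz_mulr.
  by rewrite dvdz_primeX// andbT; apply/negP; rewrite -prime_coprimez// coprimez_sym.
- by rewrite dvdz_mulr.
have h := lucUV_norm u (y%:Z ^+ i) k.
by rewrite exprM -h -e; ring.
Qed.

(** Divide by [delta] [r] times; what remains is a unit, hence 1 or -1 as [P f^2 > 4]. The last
    hypothesis selects [delta] rather than its conjugate. *)
Lemma rep_pow_aux r i x c a b :
  (4 < P * f ^ 2)%N -> (0 < i)%N -> rep P f y (r * i) x c -> rep P f y i a b ->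
  ((0 < r)%N -> exists2 T, x * a + P%:Z * c * b = 2 * T & (y%:Z ^+ i %| T)%Z) ->
  exists2 s : int, s ^+ 2 = 1 &
    x = s * lucV a (y%:Z ^+ i) r /\ c = s * b * lucU a (y%:Z ^+ i) r.
Proof.
move=> hPf i0; elim: r x c => [|r IH] x c rx ra hT.
  have [e /dvdzP[c' ec] _] := rx.
  move: e; rewrite mul0n expr0 mulr1 => e.
  have c0 : c' = 0.
    apply/eqP; apply: contraTT isT => c0.
    have : (P * f ^ 2)%N%:Z * c' ^+ 2 <= 4.
      rewrite -e ec PoszM -[(f ^ 2)%N]/((f * f)%N) PoszM; nia.
    by have := hPf; nia.
  move: ec; rewrite c0 mul0r => c00; move: e; rewrite c00 expr0n mulr0 addr0 => e.
  have /orP[/eqP xE|/eqP xE] : (x == 2) || (x == -2).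
  - by rewrite -eqf_sqr e.
  - by exists 1; rewrite ?xE ?expr1n// !lucV0 lucU0; split; ring.
  - by exists (-1); rewrite ?xE ?sqrrN ?expr1n// !lucV0 lucU0; split; ring.
have [T eT hdT] := hT isT.
have hir : (0 < i <= r.+1 * i)%N by rewrite i0 mulSn leq_addr.
have [t [v [rtv e1 e2]]] := rep_div rx ra hir eT hdT.
have := rtv; rewrite mulSn addKn => rtv'.
have [ea _ _] := ra; have y0 := yX_neq0 i.
have e3 : t * a - P%:Z * v * b = 2 * x.
  apply: (@mulfI _ (2 * y%:Z ^+ i)); first by rewrite mulf_neq0.
  transitivity ((2 * y%:Z ^+ i * t) * a - P%:Z * (2 * y%:Z ^+ i * v) * b); first by ring.
  rewrite -e1 -e2; transitivity (x * (a ^+ 2 + P%:Z * b ^+ 2)); first by ring.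
  by rewrite ea; ring.
have e4 : t * b + v * a = 2 * c.
  apply: (@mulfI _ (2 * y%:Z ^+ i)); first by rewrite mulf_neq0.
  transitivity ((2 * y%:Z ^+ i * t) * b + (2 * y%:Z ^+ i * v) * a); first by ring.
  rewrite -e1 -e2; transitivity (c * (a ^+ 2 + P%:Z * b ^+ 2)); first by ring.
  by rewrite ea; ring.
have [|s s1 [tE vE]] := IH t v rtv' ra.
  (* The same choice persists for the quotient: otherwise [y] would divide the trace [x] of the
     quotient times [delta]. *)
  move=> r0; have [T1 [_ [hT1 _ _]]] := rep_mul_conj rtv' ra.
  have ex : t * a - P%:Z * v * b = 2 * x by exact: e3.
  have hir' : (0 < i <= r * i)%N by rewrite i0 leq_pmull.
  exists T1 => //; case: (rep_trace_dvd rtv' ra hir' hT1 ex) => // yx.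
  have [_ _ cx] := rx; rewrite muln_gt0 i0 in cx; have {}cx := cx isT.
  have yx' : (y %| x)%Z by apply: dvdz_trans yx; rewrite -(prednK i0) exprS dvdz_mulr.
  by move: cx; rewrite coprimez_sym prime_coprimez// yx'.
exists s => //; split; apply: (@mulfI _ (2 : int)) => //.
  by rewrite -e3 [RHS]mulrCA lucV_step -ea tE vE; ring.
rewrite -e4; transitivity (s * b * (2 * lucU a (y%:Z ^+ i) r.+1)); last by ring.
by rewrite lucU_step tE vE; ring.
Qed.

(** The element is a power of [delta] or of its conjugate, up to sign, which is why only absolute
    values are kept. *)
Lemma rep_pow r i x c a b :
  (4 < P * f ^ 2)%N -> (0 < i)%N -> (0 < r)%N ->
  rep P f y (r * i) x c -> rep P f y i a b ->
  `|x|%N = `|lucV a (y%:Z ^+ i) r|%N /\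
  `|c|%N = (`|b| * `|lucU a (y%:Z ^+ i) r|)%N.
Proof.
move=> hPf i0 r0 rx ra.
have abs_sq1 (s : int) : s ^+ 2 = 1 -> `|s|%N = 1%N.
  by move/eqP; rewrite sqrf_eq1 => /orP[/eqP->|/eqP->].
have hir : (0 < i <= r * i)%N by rewrite i0 leq_pmull.
have [T [_ [hT _ _]]] := rep_mul_conj rx ra.
have [T' [_ [hT' _ _]]] := rep_mul_conj rx (rep_opp ra).
have hT'' : x * a - P%:Z * c * b = 2 * T' by rewrite -hT'; ring.
case: (rep_trace_dvd rx ra hir hT hT'') => h.
  have [|s /abs_sq1 s1 [-> ->]] := rep_pow_aux hPf i0 rx ra; first by exists T.
  by rewrite !abszM s1 !mul1n.
have [|s /abs_sq1 s1 [-> ->]] := rep_pow_aux hPf i0 rx (rep_opp ra); first by exists T'.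
by rewrite !abszM abszN s1 !mul1n.
Qed.

End Rep.

(** * Powers of [1 + sqrt (- B)] *)

Lemma dvdz_subP (d m n : int) : (d %| m - n)%Z -> exists k, m = k * d + n.
Proof. by case/dvdzP=> k h; exists k; rewrite -h subrK. Qed.

(* [lucU 2 (1 + B) n] and [lucH B n] are the coordinates of [(1 + sqrt (- B)) ^ n]. *)
Definition lucH (B : int) n : int := lucU 2 (1 + B) n.+1 - lucU 2 (1 + B) n.

Section TraceTwo.

Variable B : int.
Local Notation u := (lucU 2 (1 + B)).
Local Notation v := (lucH B).

Lemma lucU2S n : u n.+1 = u n + v n.
Proof. by rewrite /lucH; ring. Qed.

Lemma lucH0 : v 0 = 1. Proof. by []. Qed.

Lemma lucHS n : v n.+1 = v n - B * u n.
Proof. by rewrite /lucH lucUSS; ring. Qed.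

Lemma lucUH_add m n :
  u (m + n) = u m * v n + v m * u n /\ v (m + n) = v m * v n - B * u m * u n.
Proof.
elim: n => [|n [hU hV]].
  by rewrite addn0 lucU0 lucH0; split; ring.
by rewrite addnS !lucU2S !lucHS hU hV; split; ring.
Qed.

Lemma lucU2_mod n : (B %| u n - n%:Z)%Z /\ (B %| v n - 1)%Z.
Proof.
elim: n => [|n [/dvdz_subP[k hu] /dvdz_subP[l hv]]]; first by split; rewrite ?subrr.
split; apply/dvdzP.
  by exists (k + l); rewrite lucU2S hu hv -addn1 PoszD; ring.
by exists (l - u n); rewrite lucHS hv; ring.
Qed.

Hypothesis B_even : (2%:Z %| B)%Z.

Lemma lucH_odd n : ~~ (2%:Z %| v n)%Z.
Proof.
elim: n => // n; apply: contra; rewrite lucHS => h.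
by rewrite -[v n](subrK (B * u n)) rpredD// dvdz_mulr.
Qed.

(** The fourth power is the first that is [1 + 4 sqrt (- B)] modulo 8 for every even [B]; each
    squaring doubles the coefficient. This is why indices are later compared modulo 4. *)
Lemma lucU2_pow2 e :
  (2 ^+ e.+3 %| u (2 ^ e.+2) - 2 ^+ e.+2)%Z /\ (2 ^+ e.+3 %| v (2 ^ e.+2) - 1)%Z.
Proof.
case/dvdzP: B_even => b hb; elim: e => [|e [/dvdz_subP[k hu] /dvdz_subP[l hv]]].
  have [m hm] := even_mulz_succ (b - 1).
  split; apply/dvdzP.
    by exists (- b); rewrite !lucUSS /= hb; ring.
  exists (m - b); rewrite /lucH !lucUSS /= hb.
  by transitivity (4 * ((b - 1) * (b - 1 + 1)) - 8 * b); [ring | rewrite hm; ring].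
have -> : (2 ^ e.+3 = 2 ^ e.+2 + 2 ^ e.+2)%N by rewrite addnn -mul2n -expnS.
have [-> ->] := lucUH_add (2 ^ e.+2) (2 ^ e.+2).
rewrite hu hv hb !exprS; set x := 2 ^+ e; split; apply/dvdzP.
  by exists (8 * k * l * x + 4 * l * x + k); ring.
by exists (4 * l ^+ 2 * x + l - 2 * b * x * (2 * k + 1) ^+ 2); ring.
Qed.
Lemma lucU2_pow2_odd e j :
  (2 ^+ e.+3 %| u (2 ^ e.+2 * j.*2.+1) - 2 ^+ e.+2)%Z /\
  (2 ^+ e.+3 %| v (2 ^ e.+2 * j.*2.+1) - 1)%Z.
Proof.
elim: j => [|j [/dvdz_subP[k hu] /dvdz_subP[l hv]]].
  by rewrite muln1; exact: lucU2_pow2.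
have [/dvdz_subP[k' hu'] /dvdz_subP[l' hv']] := lucU2_pow2 e.+1.
have -> : (2 ^ e.+2 * j.+1.*2.+1 = 2 ^ e.+2 * j.*2.+1 + 2 ^ e.+3)%N.
  have -> : j.+1.*2.+1 = (j.*2.+1 + 2)%N by lia.
  by rewrite mulnDr [(2 ^ e.+3)%N]expnSr.
have [-> ->] := lucUH_add (2 ^ e.+2 * j.*2.+1) (2 ^ e.+3).
rewrite hu hv hu' hv' !exprS; set x := 2 ^+ e; split; apply/dvdzP.
  exists (k + (k * 8 * x + 4 * x) * l' * 2 + (l * 8 * x + 1) * (2 * k' + 1)).
  by ring.
exists (l + (l * 8 * x + 1) * l' * 2 - B * (k * 8 * x + 4 * x) * (2 * k' + 1)).
by ring.
Qed.

(* Lifting the exponent at 2: [(1 + sqrt (- B)) ^ w] is congruent to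
   [1 + 2 ^ e sqrt (- B)] modulo [2 ^ (e + 1)] when [2 ^ e] exactly divides [w]. *)
Lemma lucU2_inj_mod4 i j : (i = j %[mod 4])%N -> u i = u j -> i = j.
Proof.
wlog ij : i j / (i <= j)%N.
  move=> h h1 h2; have [/h->//|/ltnW/h] := leqP i j.
  by move=> /(_ (esym h1) (esym h2)).
move=> /eqP; rewrite eq_sym eqn_mod_dvd// => hd huij; apply/eqP; rewrite eqn_leq ij/=.
rewrite leqNgt; apply/negP => lt_ij; set w := (j - i)%N in hd.
have w0 : (0 < w)%N by rewrite subn_gt0.
have hj : j = (i + w)%N by rewrite subnKC.
have [e [k wE]] : exists e k, w = (2 ^ e.+2 * k.*2.+1)%N.
  have e2 : (2 <= logn 2 w)%N by rewrite -pfactor_dvdn.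
  have [m om wE] := pfactor_coprime (isT : prime 2) w0.
  exists (logn 2 w).-2, m./2; rewrite [LHS]wE mulnC; rewrite coprime2n in om.
  by congr (2 ^ _ * _)%N; lia.
have [/dvdz_subP[k' hu] /dvdz_subP[l hv]] := lucU2_pow2_odd e k.
(* As [u j = u i], the addition formula makes [v i * 2 ^ e.+2] divisible by [2 ^ e.+3], although
   [v i] is odd. *)
have [] := lucUH_add i w; rewrite -hj -huij wE hu hv => h _.
have /negP[] := lucH_odd i; apply/dvdzP.
exists (- (u i * l + v i * k')).
apply: (@mulfI _ (2 ^+ e.+2 : int)); first by rewrite expf_neq0.
move: h => /eqP; rewrite -subr_eq0 => /eqP h.
apply/eqP; rewrite -subr_eq0 -oppr_eq0 -[X in _ == X]h; apply/eqP.
by rewrite [2 ^+ e.+3]exprS; ring.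
Qed.

End TraceTwo.

Lemma lucU2_mod4_0 B n : (4%:Z %| B)%Z -> (4%:Z %| lucU 2 (1 + B) n - n%:Z)%Z.
Proof. by move=> h; have [h1 _] := lucU2_mod B n; apply: dvdz_trans h1. Qed.

(* Modulo 4 the sequence has period 0, 1, 2, 1. *)
Lemma lucU2_mod4_2 B n : (4%:Z %| B - 2)%Z -> odd n ->
  (4%:Z %| lucU 2 (1 + B) n - 1)%Z.
Proof.
move=> /dvdz_subP[b ->] on; rewrite -(odd_double_half n) on add1n.
suff [/dvdz_subP[k hk] _] : (4%:Z %| lucU 2 (1 + (b * 4 + 2)) n./2.*2.+1 - 1)%Z /\
    (2%:Z %| lucU 2 (1 + (b * 4 + 2)) n./2.*2)%Z by apply/dvdzP; exists k; rewrite hk; ring.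
elim: n./2 => [//|m [/dvdz_subP[k hk] /dvdzP[l hl]]].
rewrite doubleS [in X in X /\ _]lucUSS !lucUSS hk hl; split; apply/dvdzP.
  by exists (4 * k + 1 - (3 + 4 * b) * l - k * (3 + 4 * b) - 1 - b); ring.
by exists (4 * k + 1 - (3 + b * 4) * l); ring.
Qed.

(* All the terms but the first of [r - 1 = \sum_(k > 0) ...] have a larger
   [q]-adic valuation than [r - 1], because
   ['C(r, 2k+1) * (2k+1) * 2k = r * (r - 1) * 'C(r - 2, 2k - 1)]. *)
Lemma lucU2_neq1_val (q B r : nat) : prime q -> (0 < B)%N -> (1 < r)%N ->
  (forall k, (0 < k)%N -> (logn q (k.*2 * k.*2.+1) < k * logn q B)%N) ->
  lucU 2 (1 + B%:Z) r <> 1.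
Proof.
move=> hq B0 r1 hk; rewrite lucU2_sum => h.
have r0 : (0 < r)%N by lia.
suff : (q ^ (logn q r.-1).+1 %| r.-1)%N.
  by rewrite pfactor_dvdn; [rewrite ltnn | | lia].
rewrite -[X in (_ %| X)%N]/`|r.-1%:Z|%N -[X in (X %| _)%N]/`|(q ^ (logn q r.-1).+1)%:Z|%N.
rewrite -dvdzE.
have -> : r.-1%:Z = - \sum_(1 <= k < r) 'C(r, k.*2.+1)%:R * (- B%:Z) ^+ k.
  rewrite big_ltn// bin1 expr0 mulr1 in h; apply/eqP; rewrite eq_sym eqr_oppLR.
  apply/eqP; move: h; set S := \sum_(_ <= _ < _) _; rewrite natz => h.
  by clear -h r0; lia.
rewrite rpredN big_seq; apply: rpred_sum => k; rewrite mem_index_iota => /andP[k0 _].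
have [hr|hr] := ltnP r k.*2.+1; first by rewrite bin_small// mul0r dvdz0.
rewrite dvdzE /= abszM abszX abszN natz /= pfactor_dvdn//; last first.
  by rewrite muln_gt0 bin_gt0 hr expn_gt0 B0.
rewrite lognM ?bin_gt0 ?expn_gt0 ?B0// lognX.
have e : ('C(r, k.*2.+1) * (k.*2 * k.*2.+1) = r * r.-1 * 'C(r.-2, k.*2.-1))%N.
  have h1 := mul_bin_diag r k.*2; have h2 := mul_bin_diag r.-1 k.*2.-1.
  rewrite prednK in h2; last by lia.
  by rewrite -[RHS]mulnA h2 [RHS]mulnCA h1 mulnC -mulnA.
have Cp : (0 < 'C(r, k.*2.+1))%N by rewrite bin_gt0.
have kp : (0 < k.*2 * k.*2.+1)%N by rewrite muln_gt0; lia.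
have hl := lognM q Cp kp.
have hl' : (logn q r.-1 <= logn q ('C(r, k.*2.+1) * (k.*2 * k.*2.+1)))%N.
  rewrite e -pfactor_dvdn//; last by rewrite -e muln_gt0 Cp kp.
  by apply: dvdn_mulr; apply: dvdn_mull; rewrite pfactor_dvdnn.
by have := hk k k0; lia.
Qed.

Lemma logn_ltn_exp (q n m : nat) : prime q -> (0 < n)%N -> (n < q ^ m)%N -> (logn q n < m)%N.
Proof.
move=> hq n0 h; rewrite ltnNge; apply/negP => hm.
have : (q ^ m <= n)%N.
  by apply: dvdn_leq => //; apply: dvdn_trans (pfactor_dvdnn q n); rewrite dvdn_exp2l.
by rewrite leqNgt h.
Qed.

(** Compare [2k (2k + 1)] with [9 ^ k] for [q = 3], and with [5 ^ k] for [q >= 5] and [k > 1]; at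
    [k = 1] it is 6. The omitted case [q = 3], [g = 1] fails at [k = 1]. *)
Lemma logn_cons_prod (q g k : nat) : prime q -> (0 < g)%N -> (0 < k)%N ->
  ((4 < q) || (q == 3) && (1 < g))%N ->
  (logn q (k.*2 * k.*2.+1) < k * g)%N.
Proof.
move=> hq g0 k0 hqg.
have kk : (k.*2 * k.*2.+1 < 9 ^ k)%N.
  elim: k k0 => // -[|k] IH _ //; have := IH isT; rewrite (expnS _ k.+1).
  by move: (9 ^ k.+1)%N => x; rewrite -!mul2n; nia.
case/orP: hqg => [q5|/andP[/eqP q3 g1]]; last first.
  apply: logn_ltn_exp => //; first by rewrite muln_gt0; lia.
  rewrite q3; apply: leq_trans kk _; rewrite -[9%N]/(3 ^ 2)%N -expnM leq_exp2l//; nia.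
apply: (@leq_trans k); last by rewrite leq_pmulr.
have [->|k1] : k = 1%N \/ (1 < k)%N by lia.
  rewrite -[(_ * _)%N]/6%N; apply: (@leq_trans 1%N) => //; rewrite ltnS leqn0.
  rewrite -[6%N]/(2 * 3)%N lognM// !logn_prime//.
  by have /negPf-> : q != 2%N by [lia]; have /negPf-> : q != 3%N by lia.
apply: logn_ltn_exp => //; first by rewrite muln_gt0; lia.
apply: (@leq_trans (5 ^ k)); last by rewrite leq_exp2r.
have [l ->] : exists l, k = l.+2 by exists k.-2; lia.
elim: l => // l; rewrite (expnS _ l.+2).
by move: (5 ^ l.+2)%N => x; rewrite -!mul2n; nia.
Qed.

(** Index 1 already takes the value 1, so injectivity on residues forces [r = 3] modulo 4, and then
    [B = 2] modulo 4. The valuations allow no odd prime in [B] except one factor 3. *)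
Lemma lucU2_eq1 (B r : nat) : (0 < B)%N -> ~~ odd B -> odd r -> (1 < r)%N ->
  lucU 2 (1 + B%:Z) r = 1 -> B = 2%N /\ r = 3%N.
Proof.
move=> B0 eB or r1 h.
have B_even : (2%:Z %| B%:Z)%Z by rewrite dvdzE/= dvdn2.
have r3 : (r %% 4 = 3)%N.
  have [//|r1'] : (r %% 4 = 3)%N \/ (r %% 4 = 1)%N by lia.
  suff: r = 1%N by lia.
  by apply: (lucU2_inj_mod4 B_even).
have B2 : (B %% 4 = 2)%N.
  have [B4|//] : (B %% 4 = 0)%N \/ (B %% 4 = 2)%N by lia.
  have : (4%:Z %| lucU 2 (1 + B%:Z) r - r%:Z)%Z by apply: lucU2_mod4_0; lia.
  rewrite h; lia.
have val q : prime q -> (q %| B)%N -> odd q -> q = 3%N /\ ~~ (9 %| B)%N.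
  move=> hq qB oq; have q1 := prime_gt1 hq.
  have lq : (0 < logn q B)%N by rewrite logn_gt0 mem_primes hq B0.
  case: (boolP ((4 < q) || (q == 3) && (1 < logn q B))%N) => [hc|].
    have [] := lucU2_neq1_val hq B0 r1 _ h.
    by move=> k k0; exact: logn_cons_prod.
  rewrite negb_or negb_and => /andP[q4 hq3].
  have q3 : q = 3%N by lia.
  split=> //; move: hq3; rewrite q3 /= -leqNgt => l3.
  by rewrite -[9%N]/(3 ^ 2)%N pfactor_dvdn// -ltnNge.
have [m mE] : exists m, B = (2 * m)%N by exists (B./2); lia.
have om : odd m by lia.
have [m1|m3] : m = 1%N \/ m = 3%N.
  have [|m1] := leqP m 1; first by lia.
  have hp := pdiv_prime m1; have pm := pdiv_dvd m.
  have op : odd (pdiv m) by case/dvdnP: pm => z zE; move: om; rewrite {1}zE oddM => /andP[].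
  have [p3 B9] : pdiv m = 3%N /\ ~~ (9 %| B)%N.
    by apply: val => //; rewrite mE dvdn_mull.
  right; case/dvdnP: pm; rewrite p3 => m' m'E.
  have [|m1'] := leqP m' 1; first by lia.
  have hp' := pdiv_prime m1'; have pm' := pdiv_dvd m'.
  have om' : odd m' by move: om; rewrite m'E oddM => /andP[].
  have op' : odd (pdiv m') by case/dvdnP: pm' => z zE; move: om'; rewrite {1}zE oddM => /andP[].
  have [p3' _] : pdiv m' = 3%N /\ ~~ (9 %| B)%N.
    by apply: val => //; rewrite mE m'E dvdn_mull// dvdn_mulr.
  case/negP: B9; rewrite mE m'E dvdn_mull// -[9%N]/(3 * 3)%N dvdn_mul//.
  by rewrite -p3'.
- have BE : B = 2%N by lia.
  split=> //; subst B; apply: (lucU2_inj_mod4 B_even); first by rewrite r3.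
  by rewrite h !lucUSS lucU1 lucU0; lia.
- have BE : B = 6%N by lia.
  exfalso; move: h; rewrite BE; clear - r3 => h.
  (* Modulo 5 the sequence for [B = 6] repeats 0, 1, 2, 2. *)
  suff : (5%:Z %| lucU 2 (1 + 6%:Z) r - 2)%Z by rewrite h.
  have -> : r = (r %/ 4).*2.*2.+3 by lia.
  suff [] : (5%:Z %| lucU 2 (1 + 6%:Z) (r %/ 4).*2.*2.+3 - 2)%Z /\
     (5%:Z %| lucU 2 (1 + 6%:Z) (r %/ 4).*2.*2.+2 - 2)%Z by [].
  elim: (r %/ 4)%N => // k [/dvdz_subP[a ha] /dvdz_subP[b hb]].
  move: ha hb; rewrite !doubleS; set i := k.*2.*2 => ha hb.
  have e4 : lucU 2 (1 + 6%:Z) i.+4 = 2 * (a * 5 + 2) - 7 * (b * 5 + 2).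
    by rewrite lucUSS ha hb.
  have e5 : lucU 2 (1 + 6%:Z) i.+4.+1 = 2 * (2 * (a * 5 + 2) - 7 * (b * 5 + 2)) - 7 * (a * 5 + 2).
    by rewrite lucUSS e4 ha.
  by rewrite (lucUSS _ _ i.+4.+1) (lucUSS _ _ i.+4) e5 e4; split; lia.
Qed.

(** The state is a pair of consecutive residues modulo [l]; [l - N] stands for [- M], so that the
    computation stays in [nat]. *)
Definition luc_step (t l N : nat) (s : nat * nat) : nat * nat :=
  (s.2, (t * s.2 + (l - N) * s.1) %% l)%N.

Definition luc_table (t l N n : nat) : seq nat :=
  [seq s.1 | s <- traject (luc_step t l N) (0, 1)%N n].

Lemma luc_stepP (t l N : nat) (M : int) n : (1 < l)%N -> (N <= l)%N ->
  (l %| M - N%:Z)%Z ->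
  let s := iter n (luc_step t l N) (0, 1)%N in
  (l %| lucU t M n - s.1%:Z)%Z /\ (l %| lucU t M n.+1 - s.2%:Z)%Z.
Proof.
move=> l1 Nl /dvdz_subP[m ->]; elim: n => [|n]; first by split.
rewrite iterS; case: (iter n _ _) => a b.
rewrite /luc_step; cbv zeta; cbn [fst snd] => -[/dvdz_subP[i hi] /dvdz_subP[j hj]].
split; first by rewrite hj addrK dvdz_mull.
rewrite lucUSS hi hj.
set s := (_ %% l)%N; have := divn_eq (t * b + (l - N) * a) l; rewrite -/s => e.
have e' : t%:Z * b%:Z + (l%:Z - N%:Z) * a%:Z =
   (((t * b + (l - N) * a) %/ l)%N)%:Z * l%:Z + s%:Z.
  by rewrite -PoszM -PoszD -e PoszD !PoszM -subzn.
apply/dvdzP; exists (t%:Z * j - (m * l%:Z + N%:Z) * i - m * a%:Z - a%:Z +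
   ((t * b + (l - N) * a) %/ l)%N).
move: e'; move: (_ %/ l)%N => d /eqP; rewrite -subr_eq0 => /eqP e'.
by apply/eqP; rewrite -subr_eq0 -[X in _ == X]e'; apply/eqP; ring.
Qed.


(* The table has length 722 so that its last two entries decide whether 720 is a
   period; when it is not, the modulus imposes no condition. *)
Definition luc_filter (l e : nat) : seq bool :=
  let N := iter e (fun x => (5 * x) %% l)%N 1%N in
  let t := luc_table 2 l N 722 in
  let per := (nth 0 t 720 == 0)%N && (nth 0 t 721 == 1)%N in
  [seq per ==> (a == l.-1) | a <- t].

(** [e] is the exponent of 5 modulo 90, the lcm of the orders 6, 5, 9 of 5 modulo 7, 11, 19; the
    index is taken modulo 720, the lcm of [7^2 - 1], [11^2 - 1] and [19^2 - 1]. The value true means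
    that no index class survives. *)
Definition sieve (e : nat) : bool :=
  let t1 := luc_filter 7 e in let t2 := luc_filter 11 e in
  let t3 := luc_filter 19 e in
  all (fun r => ~~ [&& (r %% 8 == 3)%N, (r %% 20 == 11)%N, nth false t1 r,
                      nth false t2 r & nth false t3 r]) (iota 0 720).

Lemma sieve_odd : all sieve [seq i.*2.+1 | i <- iota 0 45].
Proof. by vm_compute. Qed.

Lemma iter_period (T : Type) (f : T -> T) (x : T) (R n : nat) :
  iter R f x = x -> iter n f x = iter (n %% R) f x.
Proof.
move=> hR; rewrite {1}(divn_eq n R) addnC iterD; congr (iter _ _ _).
by elim: (n %/ R)%N => // q IH; rewrite mulSn iterD IH.
Qed.

Lemma nth_luc_table t l N n i : (i < n)%N ->
  nth 0%N (luc_table t l N n) i = (iter i (luc_step t l N) (0, 1)%N).1.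
Proof.
move=> h; rewrite (nth_map (0, 1)%N) ?size_traject//.
by rewrite nth_traject.
Qed.

Lemma luc_filter_neg1 (l m r : nat) : (1 < l)%N ->
  iter 90 (fun x => (5 * x) %% l)%N 1%N = 1%N ->
  lucU 2 (5%:Z ^+ m) r = -1 ->
  nth false (luc_filter l (m %% 90)) (r %% 720).
Proof.
move=> l1 h90 hr; rewrite /luc_filter -(iter_period _ h90); set N := iter m _ _.
have Nl : (N < l)%N.
  by rewrite /N; case: m {hr N} => // m; rewrite iterS ltn_pmod// ltnW.
have hN : (l %| 5%:Z ^+ m - N%:Z)%Z.
  rewrite /N; elim: (m) => [|k]; first by rewrite expr0 subrr.
  move=> /dvdz_subP[i hi]; rewrite iterS exprS hi; set x := iter k _ _.
  apply/dvdzP; exists (5 * i + ((5 * x) %/ l)%N%:Z).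
  have e : 5 * x%:Z = ((5 * x) %/ l)%N%:Z * l%:Z + ((5 * x) %% l)%N%:Z.
    by rewrite -PoszM -PoszD -divn_eq PoszM.
  by rewrite mulrDr e; ring.
have hmod : (r %% 720 < 722)%N by rewrite (leq_trans (ltn_pmod _ _)).
rewrite (nth_map 0%N) ?size_map ?size_traject// !nth_luc_table//.
apply/implyP => /andP[/eqP p0 /eqP p1].
have p720 : iter 720 (luc_step 2 l N) (0, 1)%N = (0, 1)%N.
  move: p1; rewrite iterS; move: p0; case: (iter 720 _ _) => a b.
  by rewrite /luc_step; cbn [fst snd] => -> ->.
rewrite -(iter_period _ p720).
have [] := luc_stepP 2 r l1 (ltnW Nl) hN; rewrite hr.
set s := iter r _ _.
have sl : (s.1 < l)%N.
  rewrite /s; case: (r) => [|[|k]] /=; rewrite ?ltn_pmod//; lia.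
move=> hd _; apply/eqP; move: hd; rewrite -rpredN opprB opprK -PoszD addn1 dvdzE /=.
by move/dvdn_leq => /(_ isT); lia.
Qed.

Lemma lucU2_5_neq_neg1 (m r : nat) : odd m -> (r %% 8 = 3)%N -> (r %% 20 = 11)%N ->
  lucU 2 (5%:Z ^+ m) r <> -1.
Proof.
move=> om r8 r20 h.
have : sieve (m %% 90).
  have /allP := sieve_odd; apply; apply/mapP; exists ((m %% 90)./2); last by lia.
  by rewrite mem_iota; lia.
rewrite /sieve => /allP/(_ (r %% 720)%N); rewrite mem_iota /= add0n ltn_pmod//.
move=> /(_ isT)/negP; case.
have r8' : (r %% 720 %% 8 == 3)%N by rewrite modn_dvdm// r8.
have r20' : (r %% 720 %% 20 == 11)%N by rewrite modn_dvdm// r20.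
by rewrite r8' r20'/= !luc_filter_neg1.
Qed.

Lemma PoszX (a k : nat) : (a ^ k)%N%:Z = a%:Z ^+ k.
Proof. by rewrite -!natz natrX. Qed.

Lemma lucU2_eqN1 (B y m r : nat) : (0 < B)%N -> ~~ odd B -> odd r -> odd m ->
  prime y -> (B.+1 = y ^ m)%N ->
  lucU 2 (1 + B%:Z) r = -1 -> B = 4%N /\ r = 3%N.
Proof.
move=> B0 eB or om hy hB h.
have B_even : (2%:Z %| B%:Z)%Z by rewrite dvdzE/= dvdn2.
have B4 : (B %% 4 = 0)%N.
  have [//|B2] : (B %% 4 = 0)%N \/ (B %% 4 = 2)%N by lia.
  have : (4%:Z %| lucU 2 (1 + B%:Z) r - 1)%Z by apply: lucU2_mod4_2 => //; lia.
  by rewrite h.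
have r3 : (r %% 4 = 3)%N.
  have : (4%:Z %| lucU 2 (1 + B%:Z) r - r%:Z)%Z by apply: lucU2_mod4_0; lia.
  by rewrite h; lia.
have /dvdnP[b bE] : (B %| r.+1)%N.
  have [+ _] := lucU2_mod B%:Z r; rewrite h -rpredN opprB opprK.
  by rewrite -PoszD addn1 dvdzE.
have y1 := prime_gt1 hy.
have m0 : (0 < m)%N by lia.
have NE : 1 + B%:Z = y%:Z ^+ m by rewrite -PoszX -hB; lia.
have yU d : (d <= m)%N -> (y ^ d %| 2 ^ r.-1 + 1)%N.
  move=> hdm; have := lucU_mod_norm 2 (1 + B%:Z) r.-1; rewrite prednK; last by lia.
  rewrite h NE -rpredN opprB opprK => hd.
  have : (y%:Z ^+ d %| 2 ^+ r.-1 + 1)%Z by apply: dvdz_trans hd; rewrite dvdz_exp2l.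
  by rewrite -PoszX -[2]/(2%:Z) -PoszX -PoszD dvdzE.
have y5 : y = 5%N.
  have ny2 : ~~ (y %| 2%:Z)%Z.
    rewrite dvdzE /= dvdn_prime2//; apply/eqP => y2.
    have := yU 1%N m0; rewrite y2 expn1 dvdn2.
    by case: r r3 {or h bE yU} => // -[] // k; rewrite oddD oddX.
  have hf : (y.-1 %| r.+1)%N.
    rewrite bE; apply: dvdn_mull; have -> : B = (y ^ m).-1 by lia.
    by apply: dvdn_pred_predX.
  have exp_pred k : ((2 ^ k).-1)%N%:Z = 2 ^+ k - 1.
    rewrite -[2]/(2%:Z) -PoszX; have : (0 < 2 ^ k)%N by rewrite expn_gt0.
    by move: (2 ^ k)%N => z; clear; lia.
  have h1 : (y %| (2 ^ r.+1).-1)%N.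
    have := fermatz_pred hy ny2; rewrite -exp_pred dvdzE /= => /dvdn_trans; apply.
    by case/dvdnP: hf => j ->; rewrite mulnC expnM dvdn_pred_predX.
  have := yU 1%N m0; rewrite expn1 => h2.
  have : (y %| 4 * (2 ^ r.-1 + 1) - (2 ^ r.+1).-1)%N.
    by rewrite dvdn_sub// dvdn_mull.
  have -> : (4 * (2 ^ r.-1 + 1) - (2 ^ r.+1).-1 = 5)%N.
    have -> : r.+1 = r.-1.+2 by clear -or; case: (r) or.
    rewrite !expnS; have : (0 < 2 ^ r.-1)%N by rewrite expn_gt0.
    by move: (2 ^ r.-1)%N => z; clear; lia.
  by rewrite dvdn_prime2// => /eqP.
subst y; have [m1|m1] : m = 1%N \/ (1 < m)%N by lia.
  have BE : B = 4%N by move: hB; rewrite m1; lia.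
  split=> //; apply: (lucU2_inj_mod4 B_even); first by rewrite r3.
  by rewrite h BE !lucUSS lucU1 lucU0; lia.
exfalso; have := h; rewrite NE; apply: lucU2_5_neq_neg1 => //.
(* [5 ^ m] is 5 modulo 8 because [m] is odd, and the sequence then has period 8. *)
- have N8 : (8%:Z %| 5%:Z ^+ m - 5%:Z)%Z.
    rewrite -PoszX; have := modnXm m./2 8 25.
    rewrite -[(25 %% 8)%N]/1%N exp1n -[25%N]/(5 ^ 2)%N -expnM => h5.
    have -> : m = (2 * m./2).+1 by lia.
    by rewrite expnS; move: h5; move: (5 ^ _)%N => z; lia.
  have [+ _] := luc_stepP 2 r (isT : 1 < 8)%N (isT : 5 <= 8)%N N8.
  rewrite -NE h (@iter_period _ _ _ 8)//.
  have : (r %% 8 < 8)%N by rewrite ltn_mod.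
  have : odd (r %% 8) by lia.
  by move: (r %% 8)%N => -[|[|[|[|[|[|[|[|]]]]]]]].
(* Since [m > 1], [2 ^ (r - 1) = -1] holds modulo 25, where 2 has order 20; this gives [r = 11]
   modulo 20. *)
- have pow2 k : (2 ^ k %% 25 = iter k (fun x => (2 * x) %% 25) 1)%N.
    by elim: k => // k IH; rewrite iterS -IH expnS modnMmr.
  have := yU 2%N m1; rewrite /dvdn -modnDml pow2 (@iter_period _ _ _ 20)//.
  have -> : r.-1 = (r %/ 20 * 20 + (r %% 20).-1)%N by lia.
  rewrite modnMDl.
  have chk : all (fun s => odd s ==>
      ((iter (s.-1 %% 20) (fun x => (2 * x) %% 25) 1 + 1) %% 5 ^ 2 == 0)%N ==> (s == 11)%N)
      (iota 0 20) by vm_compute.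
  have := allP chk (r %% 20)%N; rewrite mem_iota ltn_mod => /(_ isT).
  have -> : odd (r %% 20) by lia.
  by rewrite implyTb => /implyP h20 /h20/eqP.
Qed.

Lemma lucU2_prime_eq (B r : nat) : (0 < B)%N -> prime r -> (3 < r)%N ->
  `|lucU 2 (1 + B%:Z) r|%N = r -> r = 5%N /\ B = 10%N.
Proof.
move=> B0 hr r3 hu.
have or : odd r by apply: contraLR r3 => /(prime_oddPn hr) ->.
have nr2 : ~~ (r %| 2%:Z)%Z by rewrite dvdzE /= dvdn_prime2//; lia.
have hD : 2 ^+ 2 - 4 * (1 + B%:Z) = - (2 * 2 * B%:Z) by ring.
have rB : (r %| B%:Z)%Z.
  have := lucU_prime_mod 2 (1 + B%:Z) hr or; rewrite hD.
  have ru : (r %| lucU 2 (1 + B%:Z) r)%Z by rewrite dvdzE /= hu.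
  rewrite rpredBl// dvdz_primeX// rpredN => /andP[+ _].
  by rewrite !dvdz_primeM// (negPf nr2).
have rD : (r %| (2 : int) ^+ 2 - 4 * (1 + B%:Z))%Z by rewrite hD rpredN dvdz_mull.
(* The congruence modulo [r ^ 2] decides the sign. *)
have ur : lucU 2 (1 + B%:Z) r = r.
  have := lucU_prime_mod_sq hr r3 rD; rewrite mulrC -mulrBl Gauss_dvdzl; last first.
    apply: coprimezXr; rewrite -[(r ^ 2)%N]/(r * r)%N PoszM coprimezMl.
    by rewrite prime_coprimez// nr2.
  have [->//|->] : lucU 2 (1 + B%:Z) r = r \/ lucU 2 (1 + B%:Z) r = - r%:Z.
    by move: hu; clear; lia.
  rewrite dvdzE -opprD abszN -PoszD /= => /dvdn_leq.
  by rewrite addn_gt0 prime_gt0// => /(_ isT); rewrite -mulnn; nia.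
have [r5|r7] : r = 5%N \/ (6 < r)%N.
  have : r != 6%N by apply/eqP => r6; rewrite r6 in or.
  have : r != 4%N by apply/eqP => r6; rewrite r6 in or.
  by clear -r3; lia.
  split=> //; move: ur; rewrite r5 !lucUSS lucU1 lucU0; clear -B0; nia.
(* After cancelling [r] and one [B] in the expansion of [U = r], the coefficient ['C(r, 3)] is a sum
   of multiples of [r ^ 2]: one factor comes from the binomial and one from [B], or both from [B] in
   the last term, where [r >= 7] is used. *)
exfalso; have : ((r ^ 2)%N %| 'C(r, 3)%:Z)%Z.
  have B0' : B%:Z != 0 by move: B0; clear; lia.
  have -> : 'C(r, 3)%:Z = \sum_(2 <= k < r) 'C(r, k.*2.+1)%:Z * (- B%:Z) ^+ k.-1 * -1.
    apply: (mulIf B0'); move: ur; rewrite lucU2_sum.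
    have r0 : (0 < r)%N by exact: prime_gt0.
    have r1 : (1 < r)%N by exact: prime_gt1.
    rewrite (@big_ltn _ _ _ 0 r)// (@big_ltn _ _ _ 1 r)//.
    rewrite bin1 expr0 mulr1 expr1 natz -[X in _ = X]addr0 => /addrI/eqP.
    rewrite addr_eq0 mulrN => /eqP/oppr_inj; rewrite natz => ->.
    rewrite mulr_suml big_seq [RHS]big_seq; apply: eq_bigr => k.
    rewrite mem_index_iota natz => /andP[k2 _].
    have -> : (- B%:Z) ^+ k = - B%:Z * (- B%:Z) ^+ k.-1 by rewrite -exprS prednK// ltnW.
    by ring.
  rewrite big_seq; apply: rpred_sum => k; rewrite mem_index_iota => /andP[k2 _].
  apply: dvdz_mulr; rewrite -[(r ^ 2)%N]/(r * r)%N PoszM.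
  have [h|h] := ltnP r k.*2.+1; first by rewrite bin_small// mul0r dvdz0.
  have rk : (r %| (- B%:Z) ^+ k.-1)%Z by apply: dvdz_exp; [clear -k2; lia|rewrite rpredN].
  move: h; rewrite leq_eqVlt => /predU1P[h|h]; last first.
    by apply: dvdz_mul => //; rewrite dvdzE /= prime_dvd_bin.
  have -> : k.-1 = k.-1.-2.+2 by move: h r7; clear; lia.
  by rewrite !exprS; apply: dvdz_mull; rewrite mulrA; apply/dvdz_mulr/dvdz_mul; rewrite rpredN.
rewrite dvdzE /= => h.
have h6 : ('C(r, 3) * 6 = r * (r.-1 * r.-2))%N.
  by rewrite -[6%N]/(3`!) bin_ffact !ffactnS ffactn0 muln1.
have : (r * r %| r * (r.-1 * r.-2))%N by rewrite -h6 mulnn dvdn_mulr.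
rewrite dvdn_pmul2l ?prime_gt0// Euclid_dvdM// => /orP[] /dvdn_leq.
  by clear -r7; lia.
by clear -r7; lia.
Qed.

(** * Powers of [(1 + sqrt (- B)) / 2] *)

Lemma PoszS n : n.+1%:Z = n%:Z + 1.
Proof. by rewrite -PoszD addn1. Qed.

Lemma lucUV_add a M m n :
  2 * lucU a M (m + n) = lucU a M m * lucV a M n + lucV a M m * lucU a M n /\
  2 * lucV a M (m + n) =
    lucV a M m * lucV a M n + (a ^+ 2 - 4 * M) * lucU a M m * lucU a M n.
Proof.
elim: n => [|n [hU hV]]; first by rewrite addn0 lucU0 lucV0; split; ring.
have eU := lucU_step a M n; have eV := lucV_step a M n.
rewrite addnS; split; apply: (@mulfI _ (2 : int)) => //.
  rewrite lucU_step mulrDr mulrCA hU hV.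
  transitivity (lucU a M m * (2 * lucV a M n.+1) + lucV a M m * (2 * lucU a M n.+1)).
    by rewrite eU eV; ring.
  by ring.
rewrite lucV_step mulrDr mulrCA hV (mulrCA 2 (_ - _)) hU.
transitivity (lucV a M m * (2 * lucV a M n.+1) +
  (a ^+ 2 - 4 * M) * lucU a M m * (2 * lucU a M n.+1)); last by ring.
by rewrite eU eV; ring.
Qed.

(** First-order expansion in [M]; it determines the index modulo [M] from the value of [U]. *)
Lemma lucU1_mod_sq M n : (M ^+ 2 %| lucU 1 M n.+2 - (1 - n%:Z * M))%Z.
Proof.
elim: n => [|n /dvdz_subP[k hk]].
  by rewrite lucUSS lucU1 lucU0; apply/dvdzP; exists 0; ring.
have := lucU_mod_norm 1 M n; rewrite expr1n => /dvdz_subP[l hl].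
apply/dvdzP; exists (k - l); by rewrite lucUSS hk hl PoszS; ring.
Qed.

(** Modulo the discriminant both roots are [a / 2], so [U_n] becomes [n (a / 2) ^ (n - 1)] and [V_n]
    becomes [2 (a / 2) ^ n]. *)
Lemma lucU_mod_disc a M n :
  (a ^+ 2 - 4 * M %| 2 ^+ n * lucU a M n.+1 - n.+1%:Z * a ^+ n)%Z /\
  (a ^+ 2 - 4 * M %| 2 ^+ n * lucV a M n.+1 - a ^+ n.+1)%Z.
Proof.
elim: n => [|n [/dvdz_subP[k hk] /dvdz_subP[l hl]]].
  by rewrite !mul1r lucU1 lucV1 expr1 !subrr dvdz0.
have eU : 2 ^+ n.+1 * lucU a M n.+2 = a * (2 ^+ n * lucU a M n.+1) + 2 ^+ n * lucV a M n.+1.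
  by rewrite exprSr -mulrA lucU_step; ring.
have eV : 2 ^+ n.+1 * lucV a M n.+2 =
   a * (2 ^+ n * lucV a M n.+1) + (a ^+ 2 - 4 * M) * (2 ^+ n * lucU a M n.+1).
  by rewrite exprSr -mulrA lucV_step; ring.
split; apply/dvdzP; rewrite ?eU ?eV hk hl.
  by exists (a * k + l); rewrite (PoszS n.+1) !exprS; ring.
by exists (a * l + k * (a ^+ 2 - 4 * M) + n.+1%:Z * a ^+ n); rewrite !exprS; ring.
Qed.

(** * The Ramanujan-Nagell equation by lifting at 7 *)

Section RamanujanNagell.

Local Notation u := (lucU 1 2).
Local Notation v := (lucV 1 2).

Lemma dvdz_7X_double e x : (7%:Z ^+ e %| 2 * x)%Z -> (7%:Z ^+ e %| x)%Z.
Proof. by rewrite Gauss_dvdzr//; apply: coprimezXl. Qed.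

Lemma lucV12_n7 n : ~~ (7%:Z %| v n)%Z.
Proof.
case: n => // n; apply/negP => h.
have [_] := lucU_mod_disc 1 2 n; rewrite expr1n => /dvdz_subP[k hk].
have : (7%:Z %| 2 ^+ n * v n.+1)%Z by apply: dvdz_mull.
by rewrite hk; lia.
Qed.

(** Here [alpha ^ w] is 1 plus a 7-adically small error, and the [m]-th power multiplies this error
    by [m] up to higher order. *)
Lemma lucUV12_mul e w m :
  (7%:Z ^+ e.+2 %| v w - 2)%Z -> (7%:Z ^+ e.+1 %| u w)%Z ->
  (7%:Z ^+ e.+3 %| v (w * m) - 2 - m%:Z * (v w - 2))%Z /\
  (7%:Z ^+ e.+3 %| u (w * m) - m%:Z * u w)%Z.
Proof.
move=> /dvdzP[t ht] /dvdzP[c hc].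
have vE : v w = t * 7%:Z ^+ e.+2 + 2 by rewrite -ht; ring.
elim: m => [|m [/dvdz_subP[k hk0] /dvdz_subP[l hl]]].
  by rewrite muln0 lucU0 lucV0 !mul0r !subr0 subrr dvdz0.
rewrite ht in hk0; have hk : v (w * m) = k * 7%:Z ^+ e.+3 + m%:Z * (t * 7%:Z ^+ e.+2) + 2.
  by rewrite -[LHS](subrK 2) -[X in X + 2](subrK (m%:Z * (t * 7%:Z ^+ e.+2))) hk0; ring.
have [hU hV] := lucUV_add 1 2 (w * m) w; rewrite mulnSr.
rewrite PoszS; split; apply: dvdz_7X_double.
  have -> : 2 * (v (w * m + w) - 2 - (m%:Z + 1) * (v w - 2)) =
    2 * v (w * m + w) - 4 - 2 * (m%:Z + 1) * (v w - 2) by ring.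
  rewrite hV vE hk hl hc !exprS; set x := 7%:Z ^+ e; apply/dvdzP.
  by exists (7 * m%:Z * t ^+ 2 * x + k * (2 + 49 * t * x) - (49 * l + m%:Z * c) * c * x); ring.
have -> : 2 * (u (w * m + w) - (m%:Z + 1) * u w) =
    2 * u (w * m + w) - 2 * (m%:Z + 1) * u w by ring.
rewrite hU vE hk hl hc !exprS; set x := 7%:Z ^+ e; apply/dvdzP.
by exists (l * (2 + t * 49 * x) + 2 * m%:Z * t * c * x + 7 * c * k * x); ring.
Qed.

Lemma lucUV12_pow e :
  [/\ (7%:Z ^+ e.+2 %| v (42 * 7 ^ e) - 2)%Z, (7%:Z ^+ e.+1 %| u (42 * 7 ^ e))%Z
    & ~~ (7%:Z ^+ e.+2 %| u (42 * 7 ^ e))%Z].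
Proof.
elim: e => [|e [h1 h2 h3]].
  have [] := @luc_stepP 1 49 2 2 42 isT isT; first by rewrite subrr.
  (* Modulo 49, [u 42] is 35, divisible by 7 just once, and [v 42 = 2 * 43 - 35 = 51] is 2. *)
  have -> : iter 42 (luc_step 1 49 2) (0, 1)%N = (35, 43)%N by vm_compute.
  rewrite muln1 lucV_lucU !exprS expr0; cbn [fst snd].
  move: (u 42) (u 43) => a b ha hb; split; lia.
rewrite expnSr mulnA.
have [/dvdz_subP[k hk] /dvdz_subP[l hl]] := lucUV12_mul 7 h1 h2.
split.
- case/dvdzP: h1 => t ht; rewrite hk ht; apply/dvdzP.
  by exists (k + t); rewrite [7 ^+ e.+3]exprS; ring.
- case/dvdzP: h2 => t ht; rewrite hl ht; apply/dvdzP.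
  by exists (l * 7 + t); rewrite [7 ^+ e.+3]exprS [7 ^+ e.+2]exprS; ring.
- apply: contra h3 => /dvdzP[t]; rewrite hl => ht.
  apply/dvdzP; exists (t - l); apply: (@mulfI _ (7 : int)) => //.
  transitivity (t * 7%:Z ^+ e.+3 - l * 7%:Z ^+ e.+3); first by rewrite -ht; ring.
  by rewrite [7 ^+ e.+3]exprS; ring.
Qed.

(* Lifting the exponent at 7, in the form [alpha ^ w = 1 + c 7 ^ e sqrt (- 7)]
   modulo [7 ^ (e + 1)]. *)
Lemma lucU12_inj_mod42 i j : (i = j %[mod 42])%N -> u i = u j -> i = j.
Proof.
wlog ij : i j / (i <= j)%N.
  move=> h h1 h2; have [/h->//|/ltnW/h] := leqP i j.
  by move=> /(_ (esym h1) (esym h2)).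
move=> /eqP; rewrite eq_sym eqn_mod_dvd// => hd huij; apply/eqP; rewrite eqn_leq ij/=.
rewrite leqNgt; apply/negP => lt_ij; set w := (j - i)%N in hd.
have w0 : (0 < w)%N by rewrite subn_gt0.
have hj : j = (i + w)%N by rewrite subnKC.
have [e [m [m7 wE]]] : exists e m, ~~ (7 %| m)%N /\ w = (42 * 7 ^ e * m)%N.
  case/dvdnP: hd => z zE; have z0 : (0 < z)%N by lia.
  have [m om zE'] := pfactor_coprime (isT : prime 7) z0.
  exists (logn 7 z), m; rewrite -prime_coprime//; split=> //.
  by rewrite zE {1}zE'; ring.
have [h1 h2 h3] := lucUV12_pow e.
have [/dvdz_subP[k hk] /dvdz_subP[l hl]] := lucUV12_mul m h1 h2.
have [hU _] := lucUV_add 1 2 i w; rewrite -hj -huij in hU.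
case/dvdzP: h1 => t ht.
have : (7%:Z ^+ e.+2 %| v i * (m%:Z * u (42 * 7 ^ e)))%Z.
  apply/dvdzP; exists (- (u i * (7 * k + m%:Z * t) + v i * (7 * l))).
  move: hU; rewrite wE; rewrite ht in hk.
  have -> : v (42 * 7 ^ e * m) = k * 7%:Z ^+ e.+3 + m%:Z * (t * 7%:Z ^+ e.+2) + 2.
    by rewrite -hk; ring.
  rewrite hl [7 ^+ e.+3]exprS => /eqP; rewrite -subr_eq0 => /eqP h.
  by apply/eqP; rewrite -subr_eq0 -oppr_eq0 -[X in _ == X]h; apply/eqP; ring.
rewrite Gauss_dvdzr; last by apply: coprimezXl; rewrite prime_coprimez// lucV12_n7.
rewrite Gauss_dvdzr; last by apply: coprimezXl; rewrite prime_coprimez.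
by rewrite (negPf h3).
Qed.

(** Modulo 7 the value -1 at an odd index leaves only the classes of 3, 5, 13 modulo 42; each
    contains one solution by injectivity. *)
Lemma lucU12_eqN1 r : odd r -> u r = -1 -> r \in [:: 3; 5; 13]%N.
Proof.
move=> or h.
have u3 : u 3 = -1 by rewrite !lucUSS lucU1 lucU0; ring.
have u5 : u 5 = -1 by rewrite !lucUSS lucU1 lucU0; ring.
have u13 : u 13 = -1 by rewrite !lucUSS lucU1 lucU0; ring.
suff : (r %% 42 \in [:: 3; 5; 13])%N.
  rewrite !inE => /or3P[] /eqP hr.
  - by rewrite (@lucU12_inj_mod42 r 3)// h u3.
  - by rewrite (@lucU12_inj_mod42 r 5)// h u5.
  - by rewrite (@lucU12_inj_mod42 r 13)// h u13.
have [] := @luc_stepP 1 7 2 2 r isT isT; first by rewrite subrr.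
rewrite h => h7 _; rewrite (@iter_period _ _ _ 42) in h7; last by vm_compute.
have chk : all (fun s => odd s ==>
    ((iter s (luc_step 1 7 2) (0, 1)).1.+1 %% 7 == 0)%N ==> (s \in [:: 3; 5; 13])%N)
    (iota 0 42) by vm_compute.
have := allP chk (r %% 42)%N; rewrite mem_iota ltn_mod => /(_ isT).
have -> : odd (r %% 42) by lia.
rewrite implyTb => /implyP; apply.
by move: h7; rewrite -rpredN opprB opprK -PoszD addn1 dvdzE.
Qed.

End RamanujanNagell.

(** * The values 1, -1 and [r] of [U] for trace 1 *)

Lemma lucU1_neq1 (M : int) r : (0 < M) -> (2%:Z %| M)%Z -> odd r -> (1 < r)%N ->
  lucU 1 M r <> 1.
Proof.
move=> M0 M2 or r1 h.
have := lucU1_mod_sq M r.-2; have -> : r.-2.+2 = r by lia.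
rewrite h opprB addrC subrK exprS expr1 dvdz_mul2r ?gt_eqF// => h2.
by have := dvdz_trans M2 h2; move: or r1; clear; lia.
Qed.

Lemma lucU1_eqN1 (M : int) r : (0 < M) -> (2%:Z %| M)%Z -> (0 < r)%N ->
  lucU 1 M r = -1 -> M = 2.
Proof.
move=> M0 M2 r0 h; have := lucU_mod_norm 1 M r.-1.
rewrite prednK// h expr1n -opprD rpredN dvdzE /= => /dvdn_leq => /(_ isT).
by move: M0 M2; clear; lia.
Qed.

Lemma lucU1_prime_eq (j r : nat) : (0 < j)%N -> prime r -> (3 < r)%N ->
  `|lucU 1 (2 ^ j)%N r|%N = r -> (r, j) \in [:: (7, 1); (5, 2)]%N.
Proof.
move=> j0 hr r3 hu.
have or : odd r by apply: contraLR r3 => /(prime_oddPn hr) ->.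
have r1 := prime_gt1 hr.
set M := (2 ^ j)%N in hu *.
have M2 : (1 < M)%N by rewrite -[1%N]/(2 ^ 0)%N ltn_exp2l.
have eM : ~~ odd M by rewrite oddX negb_or -lt0n j0.
have nr2 : ~~ (r %| 2%:Z)%Z by rewrite dvdzE /= dvdn_prime2//; lia.
have rD : (r %| (1 : int) ^+ 2 - 4 * M%:Z)%Z.
  have := lucU_prime_mod 1 M%:Z hr or.
  have ru : (r %| lucU 1 M%:Z r)%Z by rewrite dvdzE /= hu.
  by rewrite rpredBl// dvdz_primeX// => /andP[].
have ur : lucU 1 M%:Z r = r.
  have := lucU_prime_mod_sq hr r3 rD; rewrite expr1n mulr1.
  have [->//|->] : lucU 1 M%:Z r = r \/ lucU 1 M%:Z r = - r%:Z.
    by move: hu; clear; lia.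
  have -> : 2 ^+ r.-1 * - r%:Z - r%:Z = - ((2 ^+ r.-1 + 1) * r%:Z) by ring.
  rewrite rpredN -[(r ^ 2)%N]/(r * r)%N PoszM dvdz_mul2r; last by move: r1; clear; lia.
  have := fermatz_pred hr nr2 => h1 h2.
  have : (r %| (2 ^+ r.-1 + 1) - (2 ^+ r.-1 - 1))%Z by apply: rpredB.
  by rewrite opprB addrC addrA subrK; rewrite (negPf nr2).
have [MM|M4] : M = 2%N \/ (4 <= M)%N.
  by move: M2 eM; clear; lia.
  have j1 : j = 1%N by apply/eqP; rewrite -(@eqn_exp2l 2)//; apply/eqP.
  have : (r %| 7)%N by move: rD; rewrite MM dvdzE.
  by rewrite dvdn_prime2// j1 => /eqP ->.
(* [r = 1 - (r - 2) M] modulo [M ^ 2] gives [r = 1 + w M] with [w = 1] modulo [M]. As [r] divides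
   [4 M - 1], [w < 4], hence [w = 1], and [r = M + 1] divides [4 (M + 1) - (4 M - 1) = 5]. *)
have := lucU1_mod_sq M%:Z r.-2; have -> : r.-2.+2 = r by move: r1; clear; lia.
rewrite ur => h.
have /dvdzP[w hw] : (M %| r%:Z - 1)%Z.
  have : (M %| r%:Z - (1 - r.-2%:Z * M%:Z))%Z.
    by apply: dvdz_trans h; rewrite exprS dvdz_mulr.
  have -> : r%:Z - (1 - r.-2%:Z * M%:Z) = r%:Z - 1 + r.-2%:Z * M%:Z by ring.
  by rewrite rpredDr// dvdz_mull.
have h2 : (M %| w - 1)%Z.
  have e : r%:Z - (1 - r.-2%:Z * M%:Z) = (w + r.-2%:Z) * M%:Z by rewrite mulrDl -hw; ring.
  move: h; rewrite e exprS expr1 dvdz_mul2r; last by move: M2; clear; lia.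
  have -> : r.-2%:Z = w * M%:Z - 1 by rewrite -hw; move: r1; clear; lia.
  by rewrite addrCA -[w * _ + _]addrC rpredDr// dvdz_mull.
have rle : (r <= 4 * M - 1)%N.
  apply: dvdn_leq; first by move: M4; clear; lia.
  move: rD; rewrite dvdzE.
  have -> : `|((1 : int) ^+ 2 - 4 * M%:Z)%R|%N = (4 * M - 1)%N by move: M4; clear; lia.
  by [].
have w0 : 0 < w by move: hw r1 M4; clear; nia.
have w3 : w < 4 by move: hw r1 M4 rle; clear; nia.
have w1 : w = 1.
  apply/eqP; apply: contraT => wn1; move: h2; rewrite dvdzE => /dvdn_leq.
  by move: w0 w3 M4 wn1; clear; lia.
have rM : r = M.+1 by move: hw; rewrite w1; move: r1; clear; lia.
have : (r %| 5)%N.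
  have : (r %| 4 * (M%:Z + 1) + ((1 : int) ^+ 2 - 4 * M%:Z))%Z.
    by rewrite rpredD// dvdz_mull// rM PoszS.
  have -> : 4 * (M%:Z + 1) + ((1 : int) ^+ 2 - 4 * M%:Z) = 5 by ring.
  by rewrite dvdzE.
rewrite dvdn_prime2// => /eqP r5; have MM : M = 4%N by move: rM; rewrite r5; clear; lia.
have -> : j = 2%N by apply/eqP; rewrite -(@eqn_exp2l 2)//; apply/eqP.
by rewrite r5.
Qed.

(** * Prime powers with a prime power real part *)

Lemma primes_le1_eq (x p q : nat) : (size (primes x) <= 1)%N -> (0 < x)%N ->
  prime p -> prime q -> (p %| x)%N -> (q %| x)%N -> p = q.
Proof.
move=> hx x0 hp hq px qx.
have pin : p \in primes x by rewrite mem_primes hp x0.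
have qin : q \in primes x by rewrite mem_primes hq x0.
case: (primes x) hx pin qin => [//|z [|//]] _.
by rewrite !inE => /eqP-> /eqP->.
Qed.

Lemma eq1_or_prime (n r : nat) : prime r -> (0 < n)%N ->
  (forall q, prime q -> (q %| n)%N -> q = r) -> ~~ (r ^ 2 %| n)%N ->
  n = 1%N \/ n = r.
Proof.
move=> hr n0 hq r2; have [|n1] := leqP n 1; first by left; lia.
right; have := pdiv_dvd n; rewrite (hq _ (pdiv_prime n1) (pdiv_dvd n)) => /dvdnP[m mE].
have [|m1] := leqP m 1; first by move: n0; rewrite mE; case: m {mE} => [|[|m]] //; rewrite mul1n.
have pE : pdiv m = r by apply: hq; rewrite ?pdiv_prime// mE dvdn_mulr// pdiv_dvd.
by case/negP: r2; rewrite mE -mulnn dvdn_mul// -pE pdiv_dvd.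
Qed.

(* [2 ^ (r - 1) lucU a M r = r a ^ (r - 1)] modulo the discriminant. *)
Lemma lucU_prime_divisor (r q : nat) (a M : int) : prime r -> prime q -> odd q ->
  (q %| lucU a M r)%Z -> (q %| a ^+ 2 - 4 * M)%Z -> ~~ (q %| M)%Z -> q = r.
Proof.
move=> hr hq oq qU qD qM; have [+ _] := lucU_mod_disc a M r.-1.
rewrite prednK ?prime_gt0// => h.
have nq2 : ~~ (q %| 2%:Z)%Z.
  by rewrite dvdzE /= dvdn_prime2//; apply: contraTneq oq => ->.
have nqa : ~~ (q %| a)%Z.
  apply/negP => qa; have : (q %| 2 * 2 * M)%Z.
    have -> : 2 * 2 * M = a * a - (a ^+ 2 - 4 * M) by ring.
    by rewrite rpredB// dvdz_mulr.
  by rewrite !dvdz_primeM// (negPf nq2) (negPf qM).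
have := dvdz_trans qD h.
rewrite rpredBl; last by rewrite dvdz_mull.
rewrite dvdz_primeM// dvdz_primeX// (negPf nqa) /= orbF dvdzE /= dvdn_prime2//.
by move/eqP.
Qed.

(** In the application [k] is 2 for odd [y] and 1 for [y = 2]. The bound [3 <= M] feeds the final
    size comparison, through [r ^ 2 < 3 ^ (r - 1)]. *)
Lemma lucas_core (r k a' x : nat) (a b P M : int) :
  prime r -> (3 < r)%N -> 0 < M -> 0 <= P -> a ^+ 2 + P * b ^+ 2 = 4 * M ->
  `|a|%N = (k * a')%N -> `|lucV a M r|%N = (k * x)%N -> (0 < k)%N ->
  (0 < x)%N -> (size (primes x) <= 1)%N ->
  (forall q : nat, prime q -> (q %| x)%N -> ~~ (q %| M)%Z) ->
  (forall q : nat, prime q -> (q %| lucU a M r)%Z ->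
     [/\ odd q, (q %| P * b ^+ 2)%Z & ~~ (q %| M)%Z]) ->
  ((1 < a')%N -> 3 <= M) ->
  a' = 1%N /\ (`|lucU a M r|%N = 1%N \/ `|lucU a M r|%N = r).
Proof.
move=> hr r3 M0 P0 e ea eV k0 x0 hx xM hU hM.
have or : odd r by apply: contraLR r3 => /(prime_oddPn hr) ->.
have hD : a ^+ 2 - 4 * M = - (P * b ^+ 2) by rewrite -e; ring.
have U0 : (0 < `|lucU a M r|)%N.
  rewrite absz_gt0; apply/eqP => U0.
  (* The hypothesis on prime factors of [U], applied to 2, excludes zero. *)
  have U2 : (2%:Z %| lucU a M r)%Z by rewrite U0 dvdz0.
  by case: (hU 2%N isT U2).
have UE : `|lucU a M r|%N = 1%N \/ `|lucU a M r|%N = r.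
  apply: eq1_or_prime => //.
    move=> q hq qU; have [oq qD qM] := hU q hq qU.
    by apply: (lucU_prime_divisor hr hq oq qU) => //; rewrite hD rpredN.
  apply/negP => rU; have rU' : (r %| lucU a M r)%Z.
    by rewrite dvdzE; apply: dvdn_trans rU; rewrite -mulnn dvdn_mulr.
  have [_ rD rM] := hU r hr rU'; have rD' : (r %| a ^+ 2 - 4 * M)%Z by rewrite hD rpredN.
  (* Since [2 ^ (r - 1) U = r a ^ (r - 1)] modulo [r ^ 2], a factor [r ^ 2] of [U] would make [r]
     divide [a], hence [M]. *)
  have := lucU_prime_mod_sq hr r3 rD'; rewrite rpredBl; last by rewrite dvdz_mull.
  rewrite -[(r ^ 2)%N]/(r * r)%N PoszM dvdz_mul2l; last by move: r3; clear; lia.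
  rewrite dvdz_primeX// => /andP[ra _]; case/negP: rM.
  have : (r %| 2 * 2 * M)%Z.
    have -> : 2 * 2 * M = a * a - (a ^+ 2 - 4 * M) by ring.
    by rewrite rpredB// dvdz_mulr.
  have nr2 : ~~ (r %| 2%:Z)%Z by rewrite dvdzE /= dvdn_prime2//; lia.
  by rewrite !dvdz_primeM// (negPf nr2).
split=> //; have [W VW hW] := lucV_odd_index a M r./2.
have rE : r./2.*2.+1 = r by have := odd_double_half r; rewrite or.
rewrite rE in VW hW.
have xE : x = (a' * `|W|)%N.
  by apply/eqP; rewrite -(eqn_pmul2l k0) -eV VW abszM ea mulnA.
have a0 : (0 < a')%N by move: x0; rewrite xE muln_gt0 => /andP[].
have W0 : (0 < `|W|)%N by move: x0; rewrite xE muln_gt0 => /andP[].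
have [|a1] := leqP a' 1; first by move: a0; clear; lia.
exfalso; have pa := pdiv_prime a1.
have px : (pdiv a' %| x)%N by rewrite xE dvdn_mulr// pdiv_dvd.
have pa' : (pdiv a' %| a)%Z by rewrite dvdzE ea dvdn_mull// pdiv_dvd.
(* A prime factor of [W] divides [x], whose only prime already divides [a]; the congruence for [W]
   modulo [a ^ 2] leaves only [r], and only once. *)
have WE : `|W|%N = 1%N \/ `|W|%N = r.
  have Wr q : prime q -> (q %| `|W|)%N -> q = r.
    move=> hq qW; have qx : (q %| x)%N by rewrite xE dvdn_mull.
    have qp : q = pdiv a' by apply: (@primes_le1_eq x).
    have := xM q hq qx => qM.
    have qa : (q %| a ^+ 2)%Z by rewrite dvdz_primeX// qp pa'.
    have := dvdz_trans qa hW; rewrite rpredBl ?dvdzE//.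
    rewrite -dvdzE -mulrA -signr_odd mulr_sign; case: ifP => _;
      rewrite ?rpredN dvdz_primeM// dvdz_primeX// (negPf qM) orbF dvdzE /= dvdn_prime2//; exact: eqP.
  apply: eq1_or_prime => //; apply/negP => rW.
  have rW' : (r %| `|W|)%N by apply: dvdn_trans rW; rewrite -mulnn dvdn_mulr.
  have rx : (r %| x)%N by rewrite xE dvdn_mull.
  have rp : r = pdiv a' by apply: (@primes_le1_eq x).
  have rM := xM r hr rx.
  have ra : ((r ^ 2)%N %| a ^+ 2)%Z by rewrite PoszX dvdz_exp2r// rp.
  have nr : ~~ ((r ^ 2)%N %| r%:Z * M ^+ r./2)%Z.
    rewrite -[(r ^ 2)%N]/(r * r)%N PoszM dvdz_mul2l; last by move: r3; clear; lia.
    by rewrite dvdz_primeX// negb_and rM.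
  have := dvdz_trans ra hW; rewrite rpredBl; last by rewrite dvdzE.
  by rewrite -mulrA -signr_odd mulr_sign; case: ifP => _; rewrite ?rpredN (negPf nr).
have hN := lucUV_norm a M r.
have hr1 : (r <= `|r%:Z|)%N by [].
have U2 : lucU a M r ^+ 2 <= r%:Z ^+ 2.
  by move: UE r3; clear; nia.
have W2 : W ^+ 2 <= r%:Z ^+ 2 by move: WE r3; clear; nia.
(* With [U] and [W] at most [r] in absolute value, the norm [4 M ^ r] is at most
   [r ^ 2 (a ^ 2 + P b ^ 2)]. *)
have big : 4 * M ^+ r <= r%:Z ^+ 2 * (4 * M).
  rewrite -hN VW hD -e mulrDr exprMn mulNr opprK.
  apply: lerD; first by rewrite mulrC; apply: ler_wpM2r => //; exact: sqr_ge0.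
  by rewrite [leRHS]mulrC; apply: ler_wpM2l => //; rewrite mulr_ge0 ?sqr_ge0.
have {}big : M ^+ r.-1 <= r%:Z ^+ 2.
  rewrite -(ler_pM2r (_ : 0 < 4 * M)); last by rewrite mulr_gt0.
  by apply: le_trans big; rewrite mulrCA -exprSr prednK ?prime_gt0.
have M3 := hM a1.
have : (r ^ 2 < 3 ^ r.-1)%N.
  have [l ->] : exists l, r = l.+4 by exists (r - 4)%N; move: r3; clear; lia.
  rewrite -pred_Sn; elim: l => // l IH; rewrite [(3 ^ _)%N]expnS.
  by move: IH; move: (3 ^ _)%N => z; clear; nia.
rewrite -ltz_nat !PoszX => lt3.
have h3 : 3%:Z ^+ r.-1 <= M ^+ r.-1.
  by apply: lerXn2r => //; rewrite nnegrE; move: M3; clear; lia.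
by have := lt_le_trans lt3 (le_trans h3 big); rewrite ltxx.
Qed.

(** * The class group exponent *)

(** The square of the denominator of [q] divides [P]. *)
Lemma squarefree_rat_int (P : nat) (q : rat) (N : int) : squarefree P ->
  P%:R * q ^+ 2 = N%:~R -> exists m : int, q = m%:~R.
Proof.
move=> sP; have qE := divq_num_den q; have d0 := denq_neq0 q.
have den0 : (denq q)%:~R ^+ 2 != 0 :> rat by rewrite expf_neq0// intr_eq0.
rewrite -{1}qE expr_div_n mulrA => /(canRL (divfK den0)) h.
have {}h : P%:Z * numq q ^+ 2 = N * denq q ^+ 2.
  apply: (@intr_inj rat).
  by rewrite [LHS]rmorphM [RHS]rmorphM !rmorphXn /= -pmulrn.
have d1 : `|denq q|%N = 1%N.
  apply: sP; rewrite -(@Gauss_dvdl _ _ (`|numq q| ^ 2)).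
    by have := congr1 absz h; rewrite (abszM P%:Z) (abszM N) !abszX => ->; rewrite dvdn_mull.
  by rewrite coprime_pexpl// coprime_pexpr// coprime_sym coprime_num_den.
exists (numq q); rewrite -{1}qE.
have -> : denq q = 1 by have := denq_gt0 q; move: d1; clear; lia.
by rewrite divr1.
Qed.

Section QuadraticIntegers.

Variable P : nat.
Hypotheses (P_gt0 : (0 < P)%N) (sP : squarefree P).

Local Notation s := (sqrtC (- P%:R) : algC).
Local Notation O := (ring_of_integers P).
Local Notation halfs u w := ((u%:~R + w%:~R * s) / 2 : algC).

Lemma sqrtN_sq : s ^+ 2 = - P%:R. Proof. exact: sqrtCK. Qed.

Lemma sqrtN_conj : s^* = - s.
Proof.
have : s^* ^+ 2 == s ^+ 2.
  by rewrite -rmorphXn /= sqrtN_sq rmorphN /= conjC_nat.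
rewrite eqf_sqr => /orP[/eqP/CrealP sR|/eqP//].
have : 0 <= s ^+ 2 by rewrite real_exprn_even_ge0.
by rewrite sqrtN_sq oppr_ge0 lern0 eqn0Ngt P_gt0.
Qed.

Lemma ring_of_integers_conj z : O z -> O z^*.
Proof.
case=> -[a [b [aQ bQ ->]]] zA; split; last by rewrite Aint_aut.
exists a, (- b); split; rewrite ?rpredN//.
by rewrite rmorphD rmorphM /= sqrtN_conj !conj_Crat// mulrN mulNr.
Qed.

Lemma ring_of_integers_int (m : int) : O m%:~R.
Proof.
split; last exact: Aint_int.
by exists m%:~R, 0; rewrite rpred0 mul0r addr0; split=> //; rewrite rpred_int.
Qed.

Lemma ring_of_integersD z t : O z -> O t -> O (z + t).
Proof.
move=> [[a [b [aQ bQ zE]]] zA] [[c [d [cQ dQ tE]]] tA].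
split; last by rewrite rpredD.
by exists (a + c), (b + d); split; rewrite ?rpredD// zE tE; ring.
Qed.

Lemma ring_of_integersM z t : O z -> O t -> O (z * t).
Proof.
move=> [[a [b [aQ bQ zE]]] zA] [[c [d [cQ dQ tE]]] tA].
split; last by rewrite rpredM.
exists (a * c - P%:R * b * d), (a * d + b * c); split.
- by rewrite rpredB ?rpredM ?rpred_nat.
- by rewrite rpredD ?rpredM.
rewrite zE tE; transitivity (a * c + b * d * s ^+ 2 + (a * d + b * c) * s); first by ring.
by rewrite sqrtN_sq; ring.
Qed.

Lemma ring_of_integersX z n : O z -> O (z ^+ n).
Proof.
move=> Oz; elim: n => [|n IH]; first exact: (ring_of_integers_int 1).
by rewrite exprS; apply: ring_of_integersM.
Qed.

Lemma ring_of_integers_trace z : O z -> exists m : int, z + z^* = m%:~R.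
Proof.
move=> Oz; have [[a [b [aQ bQ zE]]] zA] := Oz.
apply/intrP/Cint_rat_Aint; last by rewrite rpredD ?Aint_aut.
suff -> : z + z^* = a + a by rewrite rpredD.
by rewrite zE rmorphD rmorphM /= sqrtN_conj !conj_Crat//; ring.
Qed.

Lemma intr_normE (u w : int) :
  (u ^+ 2 + P%:Z * w ^+ 2)%:~R = u%:~R ^+ 2 + P%:R * w%:~R ^+ 2 :> algC.
Proof. by rewrite rmorphD rmorphXn [X in _ + X]rmorphM rmorphXn /= -pmulrn. Qed.

Lemma halfs_norm (u w m : int) : u ^+ 2 + P%:Z * w ^+ 2 = 4 * m ->
  halfs u w * (halfs u w)^* = m%:~R /\ halfs u w + (halfs u w)^* = u%:~R.
Proof.
move=> e.
have -> : (halfs u w)^* = halfs u (- w).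
  rewrite fmorph_div rmorphD rmorphM /= sqrtN_conj conjC_nat.
  by rewrite (conj_intr (intr_int _ u)) (conj_intr (intr_int _ w)) rmorphN mulrN mulNr.
split; last by rewrite rmorphN /=; field.
rewrite rmorphN /=; have h := intr_normE u w; rewrite e rmorphM /= in h.
transitivity ((u%:~R ^+ 2 - s ^+ 2 * w%:~R ^+ 2) / 4 : algC); first by field.
by rewrite sqrtN_sq mulNr opprK -h; field.
Qed.

Lemma ring_of_integers_halfs (u w m : int) :
  u ^+ 2 + P%:Z * w ^+ 2 = 4 * m -> O (halfs u w).
Proof.
move=> e; have [hN hT] := halfs_norm e; set z := (_ / _) in hN hT *.
split.
  exists (u%:~R / 2), (w%:~R / 2).
  by rewrite !rpred_div ?rpred_int ?rpred_nat//; split=> //; rewrite /z; ring.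
pose p : {poly algC} := 'X ^+ 2 - u%:~R *: 'X + m%:~R%:P.
have pE : p = 'X ^+ 2 - u%:~R%:P * 'X + m%:~R%:P by rewrite /p mul_polyC.
have sz : (size (- (u%:~R%:P * 'X) + m%:~R%:P : {poly algC})%R < size ('X^2 : {poly algC})%R)%N.
  rewrite size_polyXn; apply: leq_ltn_trans (size_polyD _ _) _.
  rewrite gtn_max size_polyN; apply/andP; split.
    by apply: leq_ltn_trans (size_polyMleq _ _) _; rewrite size_polyX size_polyC; case: (_ != _).
  by apply: leq_ltn_trans (size_polyC_leq1 _) _.
apply: (@root_monic_Aint p).
- rewrite pE rootE hornerD hornerD hornerN hornerXn hornerM hornerX !hornerC.
  by rewrite -hN -hT; apply/eqP; ring.
- by rewrite pE -addrA monicE lead_coefDl// lead_coefXn.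
- apply/polyOverP => i; rewrite pE coefD coefB coefXn coefCM coefX coefC.
  by rewrite rpredD ?rpredB ?rpredM ?rpred_nat ?intr_int//; case: ifP; rewrite ?intr_int ?rpred0.
Qed.

(** Trace and norm are rational algebraic integers, hence integers; then [P (2 b) ^ 2 = 4 m - u ^ 2]
    is an integer, and so is [2 b] because [P] is squarefree. *)
Lemma ring_of_integersP z : O z ->
  exists u w m : int, z = halfs u w /\ u ^+ 2 + P%:Z * w ^+ 2 = 4 * m.
Proof.
move=> Oz; have [[a [b [/CratP[qa aE] /CratP[qb bE] zE]]] zA] := Oz.
have [u hu] := ring_of_integers_trace Oz.
have cj (q : rat) : (ratr q : algC)^* = ratr q by rewrite conj_Crat ?Crat_rat.
have zcE : z^* = a - b * s.
  by rewrite zE rmorphD rmorphM /= sqrtN_conj aE bE !cj mulrN.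
have aE2 : 2 * a = u%:~R by rewrite -hu zE -zE zcE zE; ring.
have nE : z * z^* = a ^+ 2 + P%:R * b ^+ 2.
  rewrite zcE zE; transitivity (a ^+ 2 - s ^+ 2 * b ^+ 2); first by ring.
  by rewrite sqrtN_sq; ring.
have [m hm] : exists m : int, z * z^* = m%:~R.
  apply/intrP/Cint_rat_Aint; last by rewrite rpredM ?Aint_aut.
  have aQ : a \in Crat by rewrite aE Crat_rat.
  have bQ : b \in Crat by rewrite bE Crat_rat.
  by rewrite nE; apply: rpredD; [exact: rpredX|apply: rpredM; [exact: rpred_nat|exact: rpredX]].
have [w hw] : exists w : int, 2 * qb = w%:~R.
  apply: (@squarefree_rat_int P _ (4 * m - u ^+ 2)) => //.
  apply: (fmorph_inj (ratr : {rmorphism rat -> algC})).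
  rewrite /= rmorphM rmorphXn rmorphM /= !ratr_nat ratr_int -bE.
  rewrite rmorphB rmorphM rmorphXn /= -aE2 -hm nE; ring.
have bE2 : 2 * b = w%:~R.
  by rewrite bE -ratr_int -hw rmorphM /= ratr_nat.
exists u, w, m; split.
  by rewrite -aE2 -bE2 zE; field.
apply: (@intr_inj algC); rewrite intr_normE rmorphM /=.
by rewrite -hm -aE2 -bE2 nE; ring.
Qed.

End QuadraticIntegers.

(* If [g] generates [I ^ h] for the prime ideal [I = (y, theta)] then
   [g g^* = y ^ h]: it is a multiple of [y ^ h] because [I I^* <= (y)], and it
   divides both [y ^ (2 h)] and [y ^ h (theta ^ h + theta^* ^ h)]. *)
Lemma class_exponent_norm (P h y i : nat) (X Y : int) :
  (0 < P)%N -> squarefree P -> prime y -> (0 < i)%N -> (0 < h)%N ->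
  kills_class_group P h ->
  X ^+ 2 + P%:Z * Y ^+ 2 = 4 * y%:Z ^+ i -> coprimez X y ->
  exists u w : int, u ^+ 2 + P%:Z * w ^+ 2 = 4 * y%:Z ^+ h /\ coprimez u y.
Proof.
move=> P0 sP hy i0 h0 kill eXY cXy.
set s := sqrtC (- P%:R) : algC; set O := ring_of_integers P in kill.
have [[[Oc Oi] Oa] Om] := (ring_of_integers_conj P0, ring_of_integers_int P,
  @ring_of_integersD P, @ring_of_integersM P).
have OX := @ring_of_integersX P.
have tr := ring_of_integers_trace P0.
set th : algC := (X%:~R + Y%:~R * s) / 2.
have Oth : O th := ring_of_integers_halfs P0 eXY.
have [Nth Tth] := halfs_norm P0 eXY; rewrite -/s -/th in Nth Tth.
clearbody th.
pose yC : algC := y%:~R; have Oy : O yC by exact: Oi.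
have yc : yC^* = yC by rewrite conj_intr ?intr_int.
have y0 : yC != 0 by rewrite intr_eq0 -lt0n prime_gt0.
have Nth' : th * th^* = yC ^+ i by rewrite Nth rmorphXn.
pose I (z : algC) := exists a b : algC, [/\ O a, O b & z = a * yC + b * th].
have O0 : O 0 := Oi 0; have O1 : O 1 := Oi 1.
have idI : is_ideal O I.
  split.
  - by move=> _ [a [b [Oa' Ob ->]]]; apply: (Oa); apply: (Om).
  - by exists 0, 0; split=> //; rewrite !mul0r addr0.
  - move=> _ _ [a [b [Oa1 Ob1 ->]]] [c [d [Oc1 Od1 ->]]].
    by exists (a + c), (b + d); split; [exact: Oa|exact: Oa|ring].
  - move=> c _ Oc1 [a [b [Oa1 Ob1 ->]]].
    by exists (c * a), (c * b); split; [exact: Om|exact: Om|ring].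
have expI z k : I z -> ideal_exp O I k (z ^+ k).
  move=> Iz; elim: k => [//|k IH].
  exists [:: (z, z ^+ k)]; last by rewrite big_seq1 exprS.
  by move=> u; rewrite inE => /eqP ->.
have Iy : I yC by exists 1, 0; split=> //; rewrite mul1r mul0r addr0.
have Ith : I th by exists 0, 1; split=> //; rewrite mul1r mul0r add0r.
(* The product of [I] with its conjugate lies in [(y)], because [th] has norm [y ^ i] with
   [i > 0]. *)
have II z t : I z -> I t -> exists2 o, O o & z * t^* = yC * o.
  move=> [a [b [Oa1 Ob1 ->]]] [c [d [Oc1 Od1 ->]]].
  exists (a * c^* * yC + a * d^* * th^* + b * c^* * th + b * d^* * yC ^+ i.-1).
    have Occ := Oc _ Oc1; have Odc := Oc _ Od1; have Ot := Oc _ Oth.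
    have M3 p q r : O p -> O q -> O r -> O (p * q * r).
      by move=> Op Oq Or; apply: (Om) => //; exact: Om.
    apply: (Oa); last by apply: M3 => //; exact: OX.
    by apply: (Oa); [apply: (Oa)|]; exact: M3.
  rewrite rmorphD !rmorphM /= yc.
  transitivity (yC * (a * c^* * yC + a * d^* * th^* + b * c^* * th) + b * d^* * (th * th^*)).
    by ring.
  by rewrite Nth' -[in LHS](prednK i0) exprS; ring.
have EE k z t : ideal_exp O I k z -> ideal_exp O I k t ->
    exists2 o, O o & z * t^* = yC ^+ k * o.
  elim: k z t => [|k IH] z t.
    by move=> Oz Ot; exists (z * t^*); [apply: (Om) => //; exact: Oc | rewrite expr0 mul1r].
  move=> [l hl ->] [m hm ->].
  pose Q (w : algC) := exists2 o, O o & w = yC ^+ k.+1 * o.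
  have Q0 : Q 0 by exists 0 => //; rewrite mulr0.
  have QD a b : Q a -> Q b -> Q (a + b).
    by move=> [o Oo ->] [o' Oo' ->]; exists (o + o'); [exact: Oa | ring].
  rewrite -/(Q _) mulr_suml big_seq; apply: big_ind => // u hu.
  rewrite rmorph_sum mulr_sumr big_seq; apply: big_ind => // v hv.
  have [u1 u2] := hl u hu; have [v1 v2] := hm v hv.
  have [o Oo oE] := II _ _ u1 v1; have [o' Oo' oE'] := IH _ _ u2 v2.
  exists (o * o'); first exact: Om.
  rewrite rmorphM /= exprS.
  transitivity ((u.1 * v.1^*) * (u.2 * v.2^*)); first by ring.
  by rewrite oE oE'; ring.
have [g Og gE] := kill I idI.
have [u [w [m [gE' eg]]]] := ring_of_integersP P0 sP Og.
have [Ng Tg] := halfs_norm P0 eg; rewrite -gE' in Ng Tg.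
have Ig : ideal_exp O I h g by apply/gE; exists 1; rewrite ?mul1r.
have [a Oa1 ya] : exists2 a, O a & yC ^+ h = a * g by apply/gE/expI.
have [b Ob1 thb] : exists2 b, O b & th ^+ h = b * g by apply/gE/expI.
have luc n : th ^+ n + th^* ^+ n = (lucV X (y%:Z ^+ i) n)%:~R.
  elim/ltn_ind: n => -[|[|n]] IH; first by rewrite !expr0 lucV0.
    by rewrite !expr1 Tth.
  rewrite lucVSS intrB (@intrM _ X) (@intrM _ (y%:Z ^+ i)) -(IH n)// -(IH n.+1)// -Tth -Nth !exprS.
  by ring.
have intO (k : int) (z : algC) : O z -> (y%:Z ^+ h)%:~R * z = k%:~R ->
    exists l : int, z = l%:~R.
  move=> [_ Az] e; apply/intrP/Cint_rat_Aint => //.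
  have -> : z = k%:~R / (y%:Z ^+ h)%:~R.
    by rewrite -e mulrC mulKf// intr_eq0 expf_neq0// -lt0n prime_gt0.
  by rewrite rpred_div ?rpred_int.
have [o Oo oE] := EE h g g Ig Ig.
have [k kE] : exists k : int, o = k%:~R.
  by apply: (intO m) => //; rewrite -Ng oE rmorphXn.
(* [k] is the excess of the norm of [g] over [y ^ h]. It is shown below to divide both [y ^ h] and
   the trace of [th ^ h]; the latter is prime to [y], so [k = 1]. *)
have mE : m = y%:Z ^+ h * k.
  by apply: (@intr_inj algC); rewrite -Ng oE kE rmorphM rmorphXn.
have m_ge0 : 0 <= m.
  have : 0 <= 4 * m.
    by rewrite -eg; apply: addr_ge0; [exact: sqr_ge0|apply: mulr_ge0 => //; exact: sqr_ge0].
  by clear; lia.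
have yh0 : 0 < y%:Z ^+ h by rewrite exprn_gt0// ltz_nat prime_gt0.
have [a' a'E] : exists l : int, a * a^* = l%:~R.
  have [u1 [w1 [m1 [aE ea]]]] := ring_of_integersP P0 sP Oa1.
  by have [+ _] := halfs_norm P0 ea; rewrite -aE => ->; exists m1.
have yk : y%:Z ^+ h = a' * k.
  apply: (@intr_inj algC).
  apply: (@mulfI _ (yC ^+ h)); first by rewrite expf_neq0.
  have e1 : yC ^+ h * (yC ^+ h)^* = a * a^* * (g * g^*).
    by rewrite ya rmorphM /=; ring.
  rewrite rmorphXn /= -/yC rmorphM /= -kE -a'E.
  transitivity (yC ^+ h * (yC ^+ h)^*); first by rewrite rmorphXn /= yc.
  by rewrite e1 oE; ring.
have [t tE] := tr (a * b^*) (Om _ _ Oa1 (Oc _ Ob1)).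
have Vk : lucV X (y%:Z ^+ i) h = t * k.
  apply: (@intr_inj algC); rewrite -luc.
  apply: (@mulfI _ (yC ^+ h)); first by rewrite expf_neq0.
  have ec : (yC ^+ h)^* = yC ^+ h by rewrite rmorphXn /= yc.
  have e1 : yC ^+ h * th^* ^+ h = a * b^* * (g * g^*).
    have -> : th^* ^+ h = (b * g)^* by rewrite -thb rmorphXn.
    by rewrite ya rmorphM /=; ring.
  have e2 : yC ^+ h * th ^+ h = (a * b^*)^* * (g * g^*).
    by rewrite -{1}ec thb ya !rmorphM /= conjCK; ring.
  by rewrite mulrDr e1 e2 (@intrM _ t) -tE -kE oE; ring.
have nyV n : (0 < n)%N -> ~~ (y %| lucV X (y%:Z ^+ i) n)%Z.
  move=> n0; apply/negP => yV.
  have := lucV_mod_norm X (y%:Z ^+ i) n.-1; rewrite prednK// => hV.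
  have : (y %| y%:Z ^+ i)%Z by rewrite dvdz_exp.
  move=> /dvdz_trans/(_ hV); rewrite rpredBl// dvdz_primeX// => /andP[yX _].
  by move: cXy; rewrite coprimez_sym prime_coprimez// yX.
have k1 : k = 1.
  have kp : 0 < k.
    rewrite lt_def -(pmulr_rge0 _ yh0) -mE m_ge0 andbT.
    by apply: contraTneq yh0 => k0; rewrite yk k0 mulr0.
  have ck : coprimez k (y%:Z ^+ h).
    apply: coprimezXr; rewrite coprimez_sym prime_coprimez//; apply: contra (nyV h h0).
    by rewrite Vk => ?; rewrite dvdz_mull.
  have : (k %| y%:Z ^+ h * 1)%Z by rewrite yk mulr1 dvdz_mull.
  rewrite Gauss_dvdzr// dvdzE dvdn1 => /eqP.
  by move: kp; clear; lia.
rewrite k1 mulr1 in mE; exists u, w; rewrite -mE; split=> //.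
rewrite coprimez_sym prime_coprimez//; apply/negP => /dvdzP[u' uE].
(* If [y] divided the trace of [g], it would divide [g ^ 2], hence [th ^ (2 h)] and the trace of the
   latter, which is prime to [y]. *)
have g2 : g ^+ 2 = yC * (u'%:~R * g - yC ^+ h.-1).
  have -> : g ^+ 2 = (g + g^*) * g - g * g^* by ring.
  by rewrite Tg Ng uE mE rmorphM rmorphXn /= -/yC -[in LHS](prednK h0) exprS; ring.
have hh : (0 < h * 2)%N by rewrite muln_gt0 h0.
case/negP: (nyV _ hh).
set be := b ^+ 2 * (u'%:~R * g - yC ^+ h.-1).
have Obe : O be.
  apply: (Om); first exact: OX.
  apply: (Oa); first by apply: (Om) => //; exact: Oi.
  by rewrite -mulN1r; apply: (Om); [exact: (Oi (-1)) | exact: OX].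
have [l lE] := tr be Obe.
apply/dvdzP; exists l; apply: (@intr_inj algC); rewrite -luc rmorphM /= -/yC -lE.
have thE : th ^+ (h * 2) = yC * be.
  by rewrite exprM thb exprMn g2 /be; ring.
have thcE : th^* ^+ (h * 2) = yC * be^*.
  have -> : th^* ^+ (h * 2) = (yC * be)^* by rewrite -thE rmorphXn.
  by rewrite rmorphM /= yc.
by rewrite thE thcE; ring.
Qed.

(** * Squarefree numbers and entering the order of given conductor *)

Lemma squarefree_gt0 n : squarefree n -> (0 < n)%N.
Proof. by case: n => // /(_ 2%N (dvdn0 _)). Qed.

Lemma squarefree_dvdl m n : squarefree n -> (m %| n)%N -> squarefree m.
Proof. by move=> sn mn d dm; apply: sn; apply: dvdn_trans mn. Qed.

Lemma squarefree_coprime m n : squarefree (m * n) -> coprime m n.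
Proof.
move=> smn; have mn0 := squarefree_gt0 smn; apply/eqP/smn.
by rewrite -mulnn dvdn_mul ?dvdn_gcdl ?dvdn_gcdr.
Qed.

Lemma squarefree_dvd m n : squarefree m ->
  (forall q, prime q -> (q %| m)%N -> (q %| n)%N) -> (m %| n)%N.
Proof.
move=> sm h; have m0 := squarefree_gt0 sm.
apply/dvdn_partP => // q; rewrite mem_primes => /and3P[hq _ qm].
rewrite p_part; apply: dvdn_trans (h q hq qm).
suff : (logn q m <= 1)%N by move=> l1; rewrite -[X in (_ %| X)%N]expn1 dvdn_exp2l.
rewrite leqNgt; apply/negP => l2.
have : (q ^ 2 %| m)%N by rewrite pfactor_dvdn.
by move/sm => q1; rewrite q1 in hq.
Qed.

Definition apparition_lcm (P Q : nat) : int :=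
  \big[lcmz/1]_(q <- primes Q) (q%:Z - legendre (- P%:Z) q).

Lemma legendre_abs a q : (`|legendre a q| <= 1)%N.
Proof. by rewrite /legendre; case: ifP => // _; case: ifP. Qed.

Lemma apparition_lcm_gt0 P Q : 0 < apparition_lcm P Q.
Proof.
rewrite /apparition_lcm big_seq; apply: (big_ind (fun z : int => 0 < z)) => [//|m n m0 n0|q].
  by rewrite /lcmz ltz_nat lcmn_gt0 !absz_gt0 !gt_eqF.
rewrite mem_primes => /and3P[/prime_gt1 q1 _ _].
by have := legendre_abs (- P%:Z) q; move: q1; clear; lia.
Qed.

Lemma dvdz_apparition_lcm P Q q : q \in primes Q ->
  (q%:Z - legendre (- P%:Z) q %| apparition_lcm P Q)%Z.
Proof.
rewrite /apparition_lcm; elim: (primes Q) => // p l IH.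
rewrite inE big_cons => /predU1P[->|/IH ql]; first exact: dvdz_lcml.
by apply: (dvdz_trans ql); apply: dvdz_lcmr.
Qed.

Lemma dvdz_lucU_trans a M k m : (k %| m)%N -> (lucU a M k %| lucU a M m)%Z.
Proof. by case/dvdnP=> j ->; rewrite mulnC dvdz_lucU. Qed.

(** As [Q] is squarefree, its primes can be treated one at a time: either [q] already divides the
    coefficient, or the law of apparition applies to [U]. *)
Lemma rep_apparition (P Q y f i : nat) (u w : int) :
  prime y -> coprime P y -> coprime f y -> (0 < i)%N ->
  squarefree Q -> coprime P Q -> coprime Q y ->
  (f = 2%N \/ f = 1%N /\ odd Q) -> rep P f y i u w ->
  exists u' w', rep P (f * Q) y (i * `|apparition_lcm P Q|) u' w'.
Proof.
move=> hy cPy cfy i0 sQ cPQ cQy hf r.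
set m := `|_|%N; set M := y%:Z ^+ i.
exists (lucV u M m), (w * lucU u M m).
have [e + c] := rep_exp hy m i0 r; rewrite -/M => _.
have [eu /dvdzP[w1 w1E] cu] := r.
split=> //; rewrite w1E -mulrA mulrCA PoszM dvdz_mul//.
rewrite dvdzE; apply: squarefree_dvd => // q hq qQ.
rewrite abszM Euclid_dvdM//; apply/orP.
have [qw|nqw] := boolP (q %| `|w1|)%N; [by left|right].
have q1 := prime_gt1 hq.
have qin : q \in primes Q by rewrite mem_primes hq squarefree_gt0.
have hqm := dvdz_apparition_lcm P qin.
have qP : ~~ (q %| P)%N.
  apply: contraTN cPQ => qP; rewrite /coprime; apply/eqP => g1.
  by have := dvdn_gcd q P Q; rewrite g1 qP qQ Euclid_dvd1.
have qy : ~~ (q %| y)%N.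
  apply: contraTN cQy => qy; rewrite /coprime; apply/eqP => g1.
  by have := dvdn_gcd q Q y; rewrite g1 qy qQ Euclid_dvd1.
have [oq|] := boolP (odd q); last first.
  (* The convention [(a / 2) = 0] makes the lcm even, and [U] of index 2 is [u], which is even
     because [f = 2]. *)
  move=> /(prime_oddPn hq) q2; subst q.
  have f2 : f = 2%N by case: hf => // -[_]; move: qQ; rewrite dvdn2 => /negPf ->.
  have u2 : (2%:Z %| u)%Z.
    by have := rep_parity r; rewrite rpredBr// w1E f2 mulrA dvdz_mull.
  have m2 : (2 %| m)%N by move: hqm; rewrite /legendre eqxx subr0 dvdzE.
  suff : (2%:Z %| lucU u M m)%Z by rewrite dvdzE.
  apply: dvdz_trans (dvdz_lucU_trans u M m2).
  by rewrite lucUSS lucU1 lucU0 mulr1 mulr0 subr0.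
suff : (q %| lucU u M m)%Z by rewrite dvdzE.
apply: dvdz_trans (dvdz_lucU_trans u M hqm).
apply: (@lucU_apparition q P u w M) => //.
  by rewrite /M dvdz_primeX// negb_and dvdzE qy.
rewrite w1E dvdz_primeM// !dvdzE (negPf nqw) /=.
case: hf => [->|[-> _]]; last by rewrite dvdn1; case: (q) q1 => [|[]].
by rewrite dvdn_prime2//; apply: contraTneq oq => ->.
Qed.

(** If [w] is odd then so is [u], since 4 does not divide [P]. The norm equation then gives [P = 3]
    modulo 8, and [U_3 = u ^ 2 - M] is even, so cubing suffices when [P > 3]. *)
Lemma rep_conductor2 (P y h : nat) (u w : int) :
  prime y -> odd y -> squarefree P -> coprime P y -> (0 < h)%N ->
  rep P 1 y h u w -> exists u' w', rep P 2 y (h * 3 ^ ell P) u' w'.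
Proof.
move=> hy oy sP cPy h0 r; have [e _ cu] := r; have {}cu := cu h0.
set M := y%:Z ^+ h in e.
have oM : ~~ (2%:Z %| M)%Z.
  by rewrite dvdz_primeX// negb_and dvdzE /= dvdn2 oy.
have wpow (k : nat) : (2%:Z %| w * lucU u M k)%Z -> rep P 2 y (h * k) (lucV u M k) (w * lucU u M k).
  by move=> h2; have [? _ ?] := rep_exp hy k h0 r; split.
have wpow0 : (2%:Z %| w)%Z -> exists u' w', rep P 2 y (h * 3 ^ ell P) u' w'.
  by move=> w2; do 2 eexists; apply: wpow; rewrite dvdz_mulr.
have [/wpow0//|w2] := boolP (2%:Z %| w)%Z.
have [w1 wE] : exists w1, w = 2 * w1 + 1.
  by exists (w %/ 2)%Z; move: w2; clear; lia.
have [z zE] := even_mulz_succ w1.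
have u2 : ~~ (2%:Z %| u)%Z.
  apply/negP => /dvdzP[u1 uE].
  have : (4%:Z %| P%:Z)%Z.
    apply/dvdzP; exists (M - u1 ^+ 2 - P%:Z * 2 * z).
    transitivity ((u ^+ 2 + P%:Z * w ^+ 2) - u ^+ 2 - 4 * P%:Z * (w1 * (w1 + 1))).
      by rewrite wE; ring.
    by rewrite e zE uE; ring.
  by rewrite dvdzE /= -[4%N]/(2 ^ 2)%N => /sP.
have [u1 uE] : exists u1, u = 2 * u1 + 1.
  by exists (u %/ 2)%Z; move: u2; clear; lia.
have [t tE] := even_mulz_succ u1.
have P8 : (P %% 8 = 3)%N.
  have [M1 ME] : exists M1, M = 2 * M1 + 1.
    by exists (M %/ 2)%Z; move: oM; clear; lia.
  have : 1 + P%:Z = 4 + 8 * (M1 - t - P%:Z * z).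
    transitivity ((u ^+ 2 + P%:Z * w ^+ 2) - 4 * (u1 * (u1 + 1)) - 4 * P%:Z * (w1 * (w1 + 1))).
      by rewrite wE uE; ring.
    by rewrite e tE zE ME; ring.
  by move: (M1 - _ - _) => k; clear; lia.
have [P3|P3] := leqP P 3; last first.
  do 2 eexists; apply: wpow; apply: dvdz_mull.
  rewrite /ell P3 P8 eqxx expn1 !lucUSS lucU1 lucU0.
  apply/dvdzP; have [M1 ME] : exists M1, M = 2 * M1 + 1.
    by exists (M %/ 2)%Z; move: oM; clear; lia.
  by exists (2 * u1 ^+ 2 + 2 * u1 - M1); rewrite ME uE; ring.
(* P = 3: multiply by a sixth root of unity *)
have {}P3 : P = 3%N by move: P3 P8; clear; lia.
have [w' [e4 ew]] : exists w', (4%:Z %| u + w')%Z /\ (w' = w \/ w' = - w).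
  have : (4%:Z %| u + w)%Z || (4%:Z %| u - w)%Z by move: uE wE; clear; lia.
  by case/orP => h4; [exists w | exists (- w)]; split=> //; [left|right].
have e' : u ^+ 2 + 3 * w' ^+ 2 = 4 * M by move: e; rewrite P3; case: ew => ->; rewrite ?sqrrN.
(* These are the coordinates of the product with [(1 + sqrt (- 3)) / 2]; the sign of [w'] was chosen
   to make them even. *)
case/dvdzP: e4 => v vE; exists (2 * v - 2 * w'), (2 * v).
have -> : ell P = 0%N by rewrite P3.
have uE' : u = 4 * v - w' by rewrite (mulrC 4) -vE; ring.
have cN : (2 * v - 2 * w') ^+ 2 + 3 * (2 * v) ^+ 2 = 4 * M.
  by rewrite -e' uE'; ring.
rewrite expn0 muln1; split; [by rewrite P3|exact: dvdz_mulr|move=> _].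
rewrite coprimez_sym prime_coprimez//; apply/negP => yd.
have ny3 : ~~ (y %| 3%:Z)%Z.
  by rewrite dvdzE /= -prime_coprime// coprime_sym -P3.
have ny2 : ~~ (y %| 2%:Z)%Z.
  by rewrite dvdzE /= dvdn_prime2//; apply: contraTneq oy => ->.
have yM : (y %| M)%Z by rewrite dvdz_exp.
have : (y %| 3 * (2 * v) ^+ 2)%Z.
  have -> : 3 * (2 * v) ^+ 2 = 4 * M - (2 * v - 2 * w') ^+ 2 by rewrite -cN; ring.
  by rewrite rpredB ?dvdz_mull// dvdz_exp.
rewrite dvdz_primeM// (negPf ny3) dvdz_primeX// andbT => yv.
have : (y %| 2 * u)%Z.
  have -> : 2 * u = (2 * v - 2 * w') + 3 * (2 * v) by rewrite uE'; ring.
  by rewrite rpredD// dvdz_mull.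
rewrite dvdz_primeM// (negPf ny2) /=; apply/negP.
by rewrite -prime_coprimez// coprimez_sym.
Qed.

(** * The equation [3 ^ i + 4 = y ^ n] *)

Lemma sqrt_floor n : exists s, (s ^ 2 <= n < s.+1 ^ 2)%N.
Proof.
elim: n => [|n [s /andP[h1 h2]]]; first by exists 0%N.
have [h|h] := ltnP n.+1 (s.+1 ^ 2).
  by exists s; rewrite h (leq_trans h1).
by exists s.+1; rewrite h; move: h2 h; rewrite -!mulnn; clear; nia.
Qed.

(** Pigeonhole on the [(s + 1) ^ 2 > y] pairs with entries up to the integer square root [s]; the
    bounds are strict because a prime is not a square. *)
Lemma thue (y : nat) (X Y : int) : prime y ->
  exists a b : int, [/\ ~ (a = 0 /\ b = 0), a ^+ 2 < y%:Z, b ^+ 2 < y%:Z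
    & (y %| Y * a - X * b)%Z].
Proof.
move=> hy; have y1 := prime_gt1 hy.
have y0 : y%:Z != 0 by move: y1; clear; lia.
have [s /andP[s1 s2]] := sqrt_floor y.
have sy : (s ^ 2 < y)%N.
  rewrite ltn_neqAle s1 andbT; apply/eqP => sE; move: hy; rewrite -sE -mulnn => hy.
  have s0 : (1 < s)%N by move: y1; rewrite -sE; clear; case: s => [|[]].
  by move: hy => /primeP[_ /(_ s (dvdn_mulr _ (dvdnn s)))] /orP[] /eqP; nia.
pose f (ij : 'I_s.+1 * 'I_s.+1) : 'I_y :=
  Ordinal (ltn_pmod `|((Y * ij.1%:Z + X * ij.2%:Z) %% y)%Z|%N (ltnW y1)).
have fE ij : (f ij)%:Z = ((Y * ij.1%:Z + X * ij.2%:Z) %% y)%Z.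
  have := modz_ge0 (Y * ij.1%:Z + X * ij.2%:Z) y0.
  have : ((Y * ij.1%:Z + X * ij.2%:Z) %% y)%Z < y by rewrite ltz_pmod// ltz_nat ltnW.
  by rewrite /f /=; move: (_ %% _)%Z => z h1 h2; rewrite modn_small; move: h1 h2; clear; lia.
have /injectivePn[[i j] [[i' j'] ne eqf]] : ~~ injectiveb f.
  apply/negP => /injectiveP/leq_card; rewrite card_prod !card_ord leqNgt mulnn s2//.
exists (i%:Z - i'%:Z), (j'%:Z - j%:Z).
have bnd (k l : 'I_s.+1) : (k%:Z - l%:Z) ^+ 2 < y%:Z.
  apply: (@le_lt_trans _ _ (s%:Z ^+ 2)); last by rewrite -PoszX ltz_nat.
  by have := ltn_ord k; have := ltn_ord l; clear; move: (k : nat) (l : nat) => a b; nia.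
split=> //.
- case=> hi hj; case/eqP: ne; congr (_, _); apply/val_inj => /=.
    by move: hi; clear; lia.
  by move: hj; clear; lia.
- have : (f (i, j))%:Z = (f (i', j'))%:Z by rewrite eqf.
  rewrite !fE /= => /eqP; rewrite eqz_mod_dvd.
  by congr (_ %| _)%Z; ring.
Qed.

(** For [P = 1] and [P = 3] this small multiple of [y] leads to an element of norm [y] without
    recourse to the class group. *)
Lemma thue_form (y P : nat) (X Y : int) : prime y -> ~~ (y %| Y)%Z ->
  (y %| X ^+ 2 + P%:Z * Y ^+ 2)%Z ->
  exists a b : int, [/\ ~ (a = 0 /\ b = 0), a ^+ 2 < y%:Z, b ^+ 2 < y%:Z
    & (y %| a ^+ 2 + P%:Z * b ^+ 2)%Z].
Proof.
move=> hy yY hXY; have [a [b [h1 h2 h3 h4]]] := thue X Y hy; exists a, b; split=> //.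
suff : (y %| Y ^+ 2 * (a ^+ 2 + P%:Z * b ^+ 2))%Z.
  by rewrite dvdz_primeM// dvdz_primeX// andbT (negPf yY).
have -> : Y ^+ 2 * (a ^+ 2 + P%:Z * b ^+ 2) =
  (Y * a - X * b) * (Y * a + X * b) + (X ^+ 2 + P%:Z * Y ^+ 2) * b ^+ 2 by ring.
by rewrite rpredD// dvdz_mulr.
Qed.

(** One of the two squares is even. Taking its root as the coefficient gives conductor 4, which
    excludes the units other than 1 and -1. *)
Lemma rep_sum_two_squares (y : nat) (X Y : int) : prime y -> odd y -> ~~ (y %| Y)%Z ->
  (y %| X ^+ 2 + 1%:Z * Y ^+ 2)%Z -> exists u w, rep 1 4 y 1 u w.
Proof.
move=> hy oy yY hXY; have [a [b [h1 h2 h3 /dvdzP[k hk]]]] := thue_form hy yY hXY.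
have y1 := prime_gt1 hy.
have e : a ^+ 2 + b ^+ 2 = y.
  have k1 : k = 1.
    have : 0 < a ^+ 2 + b ^+ 2.
      rewrite lt_def addr_ge0 ?sqr_ge0// andbT paddr_eq0 ?sqr_ge0// !sqrf_eq0.
      by apply/andP => -[/eqP a0 /eqP b0]; apply: h1.
    by move: hk h2 h3 y1; rewrite mul1r; move: (a ^+ 2) (b ^+ 2); clear; nia.
  by move: hk; rewrite k1 !mul1r.
have main (c d : int) : c ^+ 2 + d ^+ 2 = y -> d ^+ 2 < y%:Z -> (2%:Z %| d)%Z ->
    exists u w, rep 1 4 y 1 u w.
  move=> ecd dy /dvdzP[d' d'E]; exists (2 * c), (2 * d); split.
  - by rewrite expr1 -ecd; ring.
  - by rewrite d'E; apply/dvdzP; exists d'; ring.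
  - move=> _; rewrite coprimez_sym prime_coprimez// dvdz_primeM// negb_or; apply/andP; split.
      by rewrite dvdzE /= dvdn_prime2//; apply: contraTneq oy => ->.
    apply/negP => yc; have : (y %| d ^+ 2)%Z.
      have -> : d ^+ 2 = y%:Z - c ^+ 2 by rewrite -ecd; ring.
      by rewrite rpredB// dvdz_exp.
    have c0 : 0 < c ^+ 2 by move: dy; rewrite -ecd; clear; lia.
    rewrite dvdzE => /dvdn_leq; rewrite abszX.
    have cy : (y %| c ^+ 2)%Z by rewrite dvdz_exp.
    case/dvdzP: cy => z zE; move=> hle.
    have z1 : 1 <= z by move: c0 y1; rewrite zE; clear; nia.
    have d0 : d = 0.
      apply/eqP; rewrite -sqrf_eq0; apply/eqP; have := sqr_ge0 d.
      by move: ecd z1 y1; rewrite zE; clear; nia.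
    move: ecd; rewrite d0 expr0n addr0 => ecd.
    have : (y ^ 2 %| y)%N.
      have : ((y ^ 2)%N%:Z %| c ^+ 2)%Z by rewrite PoszX dvdz_exp2r.
      by rewrite ecd dvdzE.
    by move/dvdn_leq; rewrite -mulnn; move: y1; clear; nia.
have [b2|b2] := boolP (2%:Z %| b)%Z; first exact: main e h3 b2.
apply: (main b a) => //; first by rewrite addrC.
have : (2%:Z %| a ^+ 2)%Z.
  have [b' bE] : exists b', b = 2 * b' + 1 by exists (b %/ 2)%Z; move: b2; clear; lia.
  have [y' yE] : exists y', y = (2 * y' + 1)%N by exists (y./2); move: oy; clear; lia.
  apply/dvdzP; exists (y'%:Z - 2 * b' ^+ 2 - 2 * b').
  have -> : a ^+ 2 = y%:Z - b ^+ 2 by rewrite -e; ring.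
  by rewrite yE PoszD PoszM bE; ring.
by rewrite dvdz_primeX// => /andP[].
Qed.

(** The form takes a value [k y] with [0 < k < 4]. Here [k = 2] fails modulo 4, and [k = 3] gives
    [a = 3 c], so that [b ^ 2 + 3 c ^ 2 = y]. *)
Lemma rep_square_add_three_squares (y : nat) (X Y : int) :
  prime y -> odd y -> y != 3%N -> ~~ (y %| Y)%Z ->
  (y %| X ^+ 2 + 3%:Z * Y ^+ 2)%Z -> exists u w, rep 3 2 y 1 u w.
Proof.
move=> hy oy y3 yY hXY; have [a [b [h1 h2 h3 /dvdzP[k hk]]]] := thue_form hy yY hXY.
have y1 := prime_gt1 hy.
have {}hk : a ^+ 2 + 3 * b ^+ 2 = k * y by exact: hk.
have main (c d : int) : c ^+ 2 + 3 * d ^+ 2 = y -> exists u w, rep 3 2 y 1 u w.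
  move=> ecd; exists (2 * c), (2 * d); split.
  - by rewrite expr1 -ecd; ring.
  - by rewrite dvdz_mulr.
  - move=> _; rewrite coprimez_sym prime_coprimez// dvdz_primeM// negb_or; apply/andP; split.
      by rewrite dvdzE /= dvdn_prime2//; apply: contraTneq oy => ->.
    apply/negP => yc; have : (y %| 3 * d ^+ 2)%Z.
      have -> : 3 * d ^+ 2 = y%:Z - c ^+ 2 by rewrite -ecd; ring.
      by rewrite rpredB// dvdz_exp.
    rewrite dvdz_primeM// dvdz_primeX// andbT dvdzE /= dvdn_prime2// (negPf y3) /= => yd.
    have : (y ^ 2 %| y)%N.
      have : ((y ^ 2)%N%:Z %| c ^+ 2 + 3 * d ^+ 2)%Z.
        by rewrite PoszX; apply: rpredD; [|apply: dvdz_mull]; exact: dvdz_exp2r.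
      by rewrite ecd dvdzE.
    by move/dvdn_leq; rewrite -mulnn; move: y1; clear; nia.
have kb : 0 < k < 4.
  have : 0 < a ^+ 2 + 3 * b ^+ 2.
    have ha := sqr_ge0 a; have hb := sqr_ge0 b.
    have hb3 : 0 <= 3 * b ^+ 2 by exact: mulr_ge0.
    rewrite lt_def addr_ge0// andbT paddr_eq0// (@mulf_eq0 _ 3) /= !sqrf_eq0.
    by apply/andP => -[/eqP a0 /eqP b0]; apply: h1.
  by move: hk h2 h3 y1; move: (a ^+ 2) (b ^+ 2); clear; nia.
have [k1|[k2|k3]] : k = 1 \/ k = 2 \/ k = 3 by move: kb; clear; lia.
- by apply: (main a b); rewrite hk k1 mul1r.
- have [y' yE] : exists y', y = (2 * y' + 1)%N by exists (y./2); move: oy; clear; lia.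
  have par (z : int) : exists t, z ^+ 2 = 4 * t \/ z ^+ 2 = 4 * t + 1.
    have [t [->|->]] : exists t, z = 2 * t \/ z = 2 * t + 1.
      by exists (z %/ 2)%Z; clear; lia.
      by exists (t ^+ 2); left; ring.
    by exists (t ^+ 2 + t); right; ring.
  have [t1 ht1] := par a; have [t2 ht2] := par b.
  exfalso; move: hk; rewrite k2 yE; move: ht1 ht2; move: (a ^+ 2) (b ^+ 2); clear; lia.
- have : (3%:Z %| a ^+ 2)%Z.
    apply/dvdzP; exists (y%:Z - b ^+ 2); rewrite -[3%:Z]/(3 : int).
    by transitivity (a ^+ 2 + 3 * b ^+ 2 - 3 * b ^+ 2); [ring | rewrite hk k3; ring].
  rewrite (dvdz_primeX _ _ (isT : prime 3)) andbT => /dvdzP[c cE].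
  apply: (main b c); apply: (@mulfI _ (3 : int)) => //.
  transitivity (a ^+ 2 + 3 * b ^+ 2); last by rewrite hk k3.
  by have -> : a = c * 3 by [exact: cE]; ring.
Qed.

Lemma cube_mod9 (z : nat) : (z ^ 3 %% 9 \in [:: 0; 1; 8])%N.
Proof.
rewrite -modnXm; have : (z %% 9 < 9)%N by rewrite ltn_mod.
by move: (z %% 9)%N; do 9 (case; [by []|]).
Qed.

Lemma pow3_diff4 (a b : nat) : (3 ^ a + 4)%N <> (3 ^ b)%N.
Proof.
case: a => [|a]; first by case: b => [|[|b]] //; rewrite !expnS; move: (3 ^ b)%N; clear; lia.
by case: b => [|b]; rewrite !expnS; [lia | move: (3 ^ a)%N (3 ^ b)%N; clear; lia].
Qed.

Lemma lucW_coprime (q r : nat) (a M W : int) : prime q -> prime r -> q <> r ->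
  (q %| a)%Z -> ~~ (q %| M)%Z ->
  (a ^+ 2 %| W - (-1) ^+ r./2 * r%:Z * M ^+ r./2)%Z -> ~~ (q %| W)%Z.
Proof.
move=> hq hr qr qa qM hW; apply/negP => qW.
have qa2 : (q %| a ^+ 2)%Z by rewrite dvdz_exp.
have := dvdz_trans qa2 hW; rewrite rpredBl//.
rewrite -mulrA -signr_odd mulr_sign; case: ifP => _; rewrite ?rpredN;
by rewrite dvdz_primeM// dvdz_primeX// (negPf qM) orbF dvdzE /= dvdn_prime2//; move/eqP.
Qed.

Lemma lucUV_size (r : nat) (a M P b : int) : (1 < r)%N -> 1 < M ->
  a ^+ 2 + P * b ^+ 2 = 4 * M ->
  lucV a M r ^+ 2 = a ^+ 2 -> lucU a M r ^+ 2 = 1 -> False.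
Proof.
move=> r1 M1 e eV eU; have := lucUV_norm a M r; rewrite eV eU mulr1.
have -> : a ^+ 2 - (a ^+ 2 - 4 * M) = 4 * M by ring.
move/(mulfI (isT : 4 != 0 :> int)) => h.
have : M ^+ 1 < M ^+ r by rewrite ltr_eXn2l.
by rewrite expr1 -h ltxx.
Qed.

(** The left side is the norm of [2 + 3 ^ m sqrt (- 3)] or of [3 ^ m + 2 sqrt (- 1)], according to
    the parity of [i], and that element is a [p]-th power up to sign. As its coordinates involve
    only the primes 2 and 3, [U] and [V / a] are 1 or -1, which the norm forbids; the one
    alternative is [y ^ n = 5] with trace 2, settled by the results on [U = 1] and [U = -1]. *)
Lemma pow3_add4_odd_exp (y n p i : nat) : prime y -> (0 < n)%N -> prime p ->
  (3 < p)%N -> (0 < i)%N -> (3 ^ i + 4 = y ^ (p * n))%N -> False.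
Proof.
move=> hy n0 hp p3 i0 e; have y1 := prime_gt1 hy; have p0 := prime_gt0 hp.
have y3 : y != 3%N.
  apply/eqP => y3; have : (3 %| 3 ^ i + 4)%N by rewrite e y3 dvdn_exp// muln_gt0 p0.
  by rewrite dvdn_addr// dvdn_exp.
have oy : odd y.
  have : odd (y ^ (p * n)) by rewrite -e oddD oddX orbT.
  by rewrite oddX muln_eq0 !gtn_eqF.
have ny2 : ~~ (y %| 2%:Z)%Z.
  by rewrite dvdzE /= dvdn_prime2//; apply: contraTneq oy => ->.
have ny3 : ~~ (y %| 3%:Z)%Z by rewrite dvdzE /= dvdn_prime2.
have e' : 3%:Z ^+ i + 4 = y%:Z ^+ (p * n) by rewrite -!PoszX -PoszD e.
have yd : (y %| 3%:Z ^+ i + 4)%Z by rewrite e' dvdz_exp// muln_gt0 p0.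
have yn1 : 1 < y%:Z ^+ n by rewrite -PoszX ltz_nat -[1%N](exp1n n) ltn_exp2r.
have yM (q : nat) : prime q -> q != y -> ~~ (q %| y%:Z ^+ n)%Z.
  by move=> hq qy; rewrite dvdz_primeX// n0 andbT dvdzE /= dvdn_prime2.
have aW (a : int) := lucV_odd_index a (y%:Z ^+ n) p./2.
have op : odd p by apply: contraLR p3 => /(prime_oddPn hp) ->.
have pE : p./2.*2.+1 = p by have := odd_double_half p; rewrite op.
have sq1 (z : int) : `|z|%N = 1%N -> z ^+ 2 = 1.
  by clear; move=> h; have [->|->] : z = 1 \/ z = -1 by lia; rewrite ?sqrrN expr1n.
have sqabs (z t : int) : `|z|%N = `|t|%N -> z ^+ 2 = t ^+ 2.
  by move=> h; rewrite -(real_normK (num_real z)) -(real_normK (num_real t)) -!abszE h.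
have [oi|ei] := boolP (odd i).
- set m := i./2; have iE : i = (2 * m).+1 by rewrite mul2n; have := odd_double_half i; rewrite oi.
  have yY : ~~ (y %| 3%:Z ^+ m)%Z by rewrite dvdz_primeX// negb_and ny3.
  have e3 : 3%:Z ^+ i = 3 * (3%:Z ^+ m) ^+ 2 by rewrite iE exprS exprM exprAC.
  have hXY : (y %| 2%:Z ^+ 2 + 3%:Z * (3%:Z ^+ m) ^+ 2)%Z.
    by move: yd; rewrite e3 addrC.
  have [u [w r1]] := rep_square_add_three_squares hy oy y3 yY hXY.
  have c3y : coprime 3 y by rewrite coprime_sym prime_coprime.
  have c2y : coprime 2 y by rewrite coprime_sym prime_coprime.
  have rn := rep_exp hy n (ltn0Sn 0) r1; rewrite mul1n in rn.
  have rt : rep 3 2 y (p * n) 4 (2 * 3%:Z ^+ m).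
    split; [|exact: dvdz_mulr|].
      rewrite -e' e3 -[3%:Z]/(3 : int); ring.
    by move=> _; rewrite coprimez_sym prime_coprimez// -[4]/(2%:Z * 2%:Z) dvdz_primeM// (negPf ny2).
  have [eV eU] := rep_pow hy c3y c2y (isT : 4 < 3 * 2 ^ 2)%N n0 p0 rt rn.
  move: rn eV eU; set a := lucV _ _ _; set b := (w * _) => rn eV eU.
  have [ea /dvdzP[b' bE] ca] := rn.
  have a2 : (2%:Z %| a)%Z.
    have := rep_parity rn; rewrite rpredBr// bE mulrA dvdz_mull//.
  have [W VW hW] := aW a; rewrite pE in VW hW.
  have W2 : ~~ (2%N %| W)%Z.
    apply: (lucW_coprime (isT : prime 2) hp _ a2 _ hW); first by move=> p2; rewrite -p2 in p3.
    by apply: yM => //; apply: contraTneq oy => <-.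
  have U3 : ~~ (3%N %| lucU a (y%:Z ^+ n) p)%Z.
    apply/negP => U3; have p3' : 3%N = p.
      apply: (lucU_prime_divisor hp _ _ U3) => //.
        have -> : a ^+ 2 - 4 * y%:Z ^+ n = - (3%:Z * b ^+ 2) by rewrite -ea; ring.
        by rewrite rpredN dvdz_mulr.
      by apply: yM => //; rewrite eq_sym.
    by rewrite -p3' in p3.
  have U1 : `|lucU a (y%:Z ^+ n) p|%N = 1%N.
    have : (`|lucU a (y%:Z ^+ n) p| %| 3 ^ m)%N.
      move: eU; rewrite bE !abszM abszX /= mulnAC [(2 * _)%N]mulnC => /eqP.
      by rewrite eqn_pmul2r// => /eqP ->; rewrite dvdn_mull.
    case/(dvdn_pfactor _ _ (isT : prime 3)) => -[|j] _ hj; first by rewrite hj.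
    by move: U3; rewrite dvdzE hj expnS dvdn_mulr.
  have W1 : `|W|%N = 1%N.
    have : (`|W| %| 2 ^ 2)%N by rewrite -[(2 ^ 2)%N]/`|4 : int|%N eV VW abszM dvdn_mull.
    case/(dvdn_pfactor _ _ (isT : prime 2)) => -[|j] _ hj; first by rewrite hj.
    by move: W2; rewrite dvdzE hj expnS dvdn_mulr.
  apply: (@lucUV_size p a (y%:Z ^+ n) 3 b (prime_gt1 hp) yn1 ea); last exact: sq1.
  by rewrite VW exprMn (sq1 _ W1) mulr1.
- set m := i./2; have iE : i = (2 * m)%N.
    by rewrite mul2n; have := odd_double_half i; rewrite (negPf ei).
  have e3 : 3%:Z ^+ i = (3%:Z ^+ m) ^+ 2 by rewrite iE exprM exprAC.
  have hXY : (y %| (3%:Z ^+ m) ^+ 2 + 1%:Z * 2%:Z ^+ 2)%Z by move: yd; rewrite e3.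
  have [u [w r1]] := rep_sum_two_squares hy oy ny2 hXY.
  have c1y : coprime 1 y by exact: coprime1n.
  have c4y : coprime 4 y.
    rewrite coprime_sym prime_coprime//; move: ny2.
    by rewrite dvdzE -[4%N]/(2 ^ 2)%N Euclid_dvdX// andbT.
  have rn := rep_exp hy n (ltn0Sn 0) r1; rewrite mul1n in rn.
  have rt : rep 1 4 y (p * n) (2 * 3%:Z ^+ m) 4.
    split; [by rewrite -e' e3; ring | by [] | move=> _].
    rewrite coprimez_sym prime_coprimez// dvdz_primeM// dvdz_primeX// negb_or negb_and ny3.
    by rewrite (negPf ny2).
  have [eV eU] := rep_pow hy c1y c4y (isT : 4 < 1 * 4 ^ 2)%N n0 p0 rt rn.
  move: rn eV eU; set a := lucV _ _ _; set b := (w * _) => rn eV eU.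
  have [ea /dvdzP[b' bE] ca] := rn.
  have [U1 b1] : `|lucU a (y%:Z ^+ n) p|%N = 1%N /\ `|b'|%N = 1%N.
    have : (4 = `|b'| * 4 * `|lucU a (y%:Z ^+ n) p|)%N.
      by rewrite -[LHS]/`|4 : int|%N eU bE abszM.
    move: `|b'|%N `|lucU _ _ _|%N => z t; clear => zt.
    have /eqP : (z * t = 1)%N by lia.
    by rewrite muln_eq1 => /andP[/eqP-> /eqP->].
  have b16 : b ^+ 2 = 16 by rewrite bE exprMn (sq1 _ b1).
  have a2 : (2%:Z %| a)%Z.
    have := rep_parity rn; rewrite rpredBr// bE mulrA dvdz_mull//.
  case/dvdzP: a2 => a' aE.
  have [W VW hW] := aW a; rewrite pE in VW hW.
  have eW : (3 ^ m = `|a'| * `|W|)%N.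
    have : (2 * 3 ^ m = `|a'| * 2 * `|W|)%N.
      by move: eV; rewrite VW aE !abszM abszX.
    by move: (3 ^ m)%N `|a'|%N `|W|%N; clear; nia.
  have [a3|a3] := boolP (3%N %| a')%Z.
    have W3 : ~~ (3%N %| W)%Z.
      apply: (lucW_coprime (isT : prime 3) hp _ _ _ hW); first by move=> p3'; rewrite -p3' in p3.
        by rewrite aE dvdz_mulr.
      by apply: yM => //; rewrite eq_sym.
    have W1 : `|W|%N = 1%N.
      have : (`|W| %| 3 ^ m)%N by rewrite eW dvdn_mull.
      case/(dvdn_pfactor _ _ (isT : prime 3)) => -[|j] _ hj; first by rewrite hj.
      by move: W3; rewrite dvdzE hj expnS dvdn_mulr.
    apply: (@lucUV_size p a (y%:Z ^+ n) 1 b (prime_gt1 hp) yn1 ea); last exact: sq1.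
    by rewrite VW exprMn (sq1 _ W1) mulr1.
  have a1 : `|a'|%N = 1%N.
    have : (`|a'| %| 3 ^ m)%N by rewrite eW dvdn_mulr.
    case/(dvdn_pfactor _ _ (isT : prime 3)) => -[|j] _ hj; first by rewrite hj.
    by move: a3; rewrite dvdzE hj expnS dvdn_mulr.
  have M5 : y%:Z ^+ n = 5.
    have := ea; rewrite aE exprMn (sq1 _ a1) b16; move: (y%:Z ^+ n); clear; lia.
  have y5 : (4.+1 = 5 ^ 1)%N by [].
  have aE2 : a = 2 \/ a = - 2 by move: aE a1; clear; lia.
  have U1' : `|lucU 2 (1 + 4%:Z) p|%N = 1%N.
    have -> : 1 + 4%:Z = 5 by [].
    move: U1; rewrite M5; case: aE2 => -> //.
    by rewrite lucU_opp abszM abszX exp1n mul1n.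
  have [] : lucU 2 (1 + 4%:Z) p = 1 \/ lucU 2 (1 + 4%:Z) p = -1.
    by move: U1'; clear; lia.
    by move/(@lucU2_eq1 4 p isT isT op (prime_gt1 hp)) => [].
  by move/(@lucU2_eqN1 4 5 1 p isT isT op isT (isT : prime 5) y5) => [_ p3']; rewrite p3' in p3.
Qed.

(** A square would give two powers of 3 that differ by 4. A cube is impossible modulo 9 for [i > 1],
    and 7 is no cube. *)
Lemma pow3_add4 (y n i : nat) : prime y -> (0 < i)%N ->
  (3 ^ i + 4 = y ^ n)%N -> n = 1%N.
Proof.
move=> hy i0 e.
have [|n1] := leqP n 1.
  case: n e => [|[|//]] //; rewrite expn0; move: (3 ^ i)%N; clear; lia.
exfalso; have hp := pdiv_prime n1; have pn := pdiv_dvd n.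
set p := pdiv n in hp pn; case/dvdnP: pn => k kE.
have k0 : (0 < k)%N by move: n1; rewrite kE; case: k {kE}.
have [p3|p3] := ltnP 3 p.
  by apply: (@pow3_add4_odd_exp y k p i) => //; rewrite e kE mulnC.
have [p2|p3'] : p = 2%N \/ p = 3%N by have := prime_gt1 hp; move: p3; clear; lia.
- move: e; rewrite kE p2 expnM; set z := (y ^ k)%N => e.
  have zE : ((z - 2) * (z + 2) = 3 ^ i)%N by move: e; rewrite -mulnn; clear; nia.
  have : (z - 2 %| 3 ^ i)%N by rewrite -zE dvdn_mulr.
  have : (z + 2 %| 3 ^ i)%N by rewrite -zE dvdn_mull.
  case/(dvdn_pfactor _ _ (isT : prime 3)) => a _ aE.
  case/(dvdn_pfactor _ _ (isT : prime 3)) => b _ bE.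
  apply: (@pow3_diff4 b a); rewrite -aE -bE.
  have z3 : (2 < z)%N.
    rewrite ltnNge; apply/negP => z2; have : (0 < 3 ^ i)%N by rewrite expn_gt0.
    by rewrite -zE; move: z2; clear; nia.
  by move: z3; clear; lia.
- move: e; rewrite kE p3' expnM; have := cube_mod9 (y ^ k); move: (y ^ k)%N => z.
  case: i i0 => // -[_|i _] hz e.
    by move: e; case: z {hz} => [|[|z]] //; rewrite !expnS expn0; clear; nia.
  move: hz; rewrite -e !inE !expnS; move: (3 ^ i)%N => t; clear; lia.
Qed.

(** * Roots of [x + c sqrt (- P)] *)

Lemma lucU_odd_index_odd (a M : int) k : (2%:Z %| a)%Z -> ~~ (2%:Z %| M)%Z ->
  ~~ (2%:Z %| lucU a M k.*2.+1)%Z.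
Proof.
move=> a2 M2; elim: k => // k; apply: contra.
rewrite doubleS lucUSS rpredBl; last exact: dvdz_mulr.
by rewrite dvdz_primeM// (negPf M2).
Qed.

Lemma lucU3 a M : lucU a M 3 = a ^+ 2 - M.
Proof. by rewrite !lucUSS lucU1 lucU0; ring. Qed.

Lemma lucV3 a M : lucV a M 3 = a * (a ^+ 2 - 3 * M).
Proof. by rewrite !lucVSS lucV1 lucV0; ring. Qed.

Lemma lucU4 a M : lucU a M 4 = a * (a ^+ 2 - 2 * M).
Proof. by rewrite !lucUSS lucU1 lucU0; ring. Qed.

Lemma lucU_abs (a M : int) r (t : nat) : odd r -> `|a|%N = t ->
  lucU a M r = lucU t M r.
Proof.
move=> or <-; have [->//|aE] : a = `|a|%N \/ a = - (`|a|%N)%:Z by clear; lia.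
by rewrite {1}aE lucU_opp -signr_odd /= or mul1r.
Qed.

Lemma lucV_abs (a M : int) r (t : nat) : `|a|%N = t ->
  `|lucV a M r|%N = `|lucV t M r|%N.
Proof.
move=> <-; have [->//|aE] : a = `|a|%N \/ a = - (`|a|%N)%:Z by clear; lia.
by rewrite {1}aE lucV_opp abszM abszX exp1n mul1n.
Qed.

Lemma pow3_mod8 i : (3 ^ i %% 8 = if odd i then 3 else 1)%N.
Proof. by elim: i => // i IH; rewrite expnS -modnMmr IH /=; case: (odd i). Qed.

Lemma prime_power_of (n p : nat) : prime p -> (0 < n)%N ->
  (forall q, prime q -> (q %| n)%N -> q = p) -> exists i, n = (p ^ i)%N.
Proof.
move=> hp n0 hq; exists (logn p n); rewrite -p_part part_pnat_id// /pnat n0.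
by apply/allP => q; rewrite mem_primes => /and3P[hq' _ qn]; rewrite inE /= (hq q).
Qed.

Section Roots.

(** [k] turns [x + c sqrt (- P)] into a pair for [rep]: doubled coordinates for odd [y], and for
    [y = 2] the element [(x + c sqrt (- P)) / 2], of norm [2 ^ (n - 2)]. *)
Variables P Q x y c k : nat.
Hypotheses (hy : prime y) (hk : k = 2%N /\ odd y \/ k = 1%N /\ y = 2%N).
Hypotheses (P_gt0 : (0 < P)%N) (x_gt0 : (0 < x)%N) (c_gt0 : (0 < c)%N).
Hypotheses (hx : (size (primes x) <= 1)%N) (cxy : coprime x y).
Hypotheses (cPy : coprime P y) (ccy : coprime c y) (cQy : coprime (k * Q) y).
Hypothesis hPQ : (4 < P * (k * Q) ^ 2)%N.
Hypothesis hrad : forall q, prime q -> (q %| c)%N -> (q %| P * Q)%N.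

Section Power.

Variables (r m : nat) (a b : int).
Hypotheses (m_gt0 : (0 < m)%N) (r_gt0 : (0 < r)%N).
Hypothesis rx : rep P (k * Q) y (r * m) (k * x)%N%:Z (k * c)%N%:Z.
Hypothesis ra : rep P (k * Q) y m a b.

Let M := y%:Z ^+ m.

Lemma root_k_gt0 : (0 < k)%N. Proof. by case: hk => -[-> _]. Qed.

Lemma root_norm : a ^+ 2 + P%:Z * b ^+ 2 = 4 * M. Proof. by case: ra. Qed.

Lemma root_norm_gt1 : 1 < M.
Proof. by rewrite /M -PoszX ltz_nat -[1%N](exp1n m) ltn_exp2r// prime_gt1. Qed.

Lemma prime_ndvd_norm q : prime q -> q != y -> ~~ (q %| M)%Z.
Proof.
by move=> hq qy; rewrite /M dvdz_primeX// m_gt0 andbT dvdzE /= dvdn_prime2.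
Qed.

Lemma root_b : exists2 b' : nat, `|b|%N = (k * b')%N & (Q %| b')%N.
Proof.
have [_ + _] := ra; rewrite dvdzE /= => /dvdnP[d ->]; exists (d * Q)%N.
  by rewrite mulnCA.
exact: dvdn_mull.
Qed.

Lemma root_a : exists a' : nat, `|a|%N = (k * a')%N.
Proof.
case: hk => -[kE _]; last by exists `|a|%N; rewrite kE mul1n.
have [_ + _] := ra; have := rep_parity ra; rewrite kE PoszM.
move=> h /dvdzP[d dE]; move: h; rewrite rpredBr; last first.
  by rewrite dE; apply: dvdz_mull; apply: dvdz_mull; exact: dvdz_mulr.
by rewrite dvdzE /= => /dvdnP[a' ->]; exists a'; rewrite mulnC.
Qed.

Lemma root_pow : `|lucV a M r|%N = (k * x)%N /\ (k * c = `|b| * `|lucU a M r|)%N.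
Proof. by have [<- <-] := rep_pow hy cPy cQy hPQ m_gt0 r_gt0 rx ra. Qed.

Lemma root_c b' : `|b|%N = (k * b')%N -> c = (b' * `|lucU a M r|)%N.
Proof.
move=> bE; have [_ /eqP] := root_pow.
by rewrite bE -mulnA eqn_pmul2l ?root_k_gt0// => /eqP.
Qed.

(** This is where the conductor is used: a prime factor of [c] divides [P Q], and [Q] divides
    [b]. *)
Lemma prime_dvd_c q : prime q -> (q %| c)%N ->
  [/\ (q %| P%:Z * b ^+ 2)%Z, ~~ (q %| M)%Z & q != y].
Proof.
move=> hq qc; have qy : q != y.
  by apply: contraTneq ccy => <-; rewrite coprime_sym prime_coprime// qc.
split=> //; last exact: prime_ndvd_norm.
have [b' bE Qb] := root_b; rewrite dvdzE abszM abszX bE /=.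
have := hrad hq qc; rewrite Euclid_dvdM// => /orP[qP|qQ]; first exact: dvdn_mulr.
by apply: dvdn_mull; rewrite Euclid_dvdX// andbT; apply: dvdn_mull; apply: dvdn_trans Qb.
Qed.

Lemma prime_dvd_lucU q : prime q -> (q %| lucU a M r)%Z -> (q %| c)%N.
Proof.
by move=> hq qU; have [b' bE _] := root_b; rewrite (root_c bE) dvdn_mull.
Qed.

(** For [y = 2] the prime 2 is excluded as [y] itself; for odd [y], [a] is even and [M] odd, so [U]
    of odd index is odd. *)
Lemma prime_dvd_lucU_odd q : odd r -> prime q -> (q %| lucU a M r)%Z -> odd q.
Proof.
move=> or hq qU; apply: contraT => /(prime_oddPn hq) q2; subst q.
have [_ M2 ny2] := prime_dvd_c hq (prime_dvd_lucU hq qU).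
case: hk => -[kE yE]; last by rewrite yE in ny2.
have a2 : (2%:Z %| a)%Z by have [a' aE] := root_a; rewrite dvdzE aE kE dvdn_mulr.
have := lucU_odd_index_odd r./2 a2 M2.
by have -> : r./2.*2.+1 = r by [have := odd_double_half r; rewrite or]; rewrite qU.
Qed.

Lemma root_core : prime r -> (3 < r)%N ->
  `|a|%N = k /\ (`|lucU a M r|%N = 1%N \/ `|lucU a M r|%N = r).
Proof.
move=> hr r3; have or : odd r by apply: contraLR r3 => /(prime_oddPn hr) ->.
have [a' aE] := root_a; have [eV _] := root_pow.
suff [a1 hU] : a' = 1%N /\ (`|lucU a M r|%N = 1%N \/ `|lucU a M r|%N = r).
  by rewrite aE a1 muln1.
apply: (@lucas_core r k a' x a b P%:Z M) => //.
- exact: lt_trans root_norm_gt1.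
- exact: root_norm.
- exact: root_k_gt0.
- move=> q hq qx; apply: prime_ndvd_norm => //.
  by apply: contraTneq cxy => <-; rewrite coprime_sym prime_coprime// qx.
- move=> q hq qU; have [h1 h2 _] := prime_dvd_c hq (prime_dvd_lucU hq qU).
  by split=> //; exact: (prime_dvd_lucU_odd or).
- move=> a1; case: hk => -[kE yE].
    have y3 : (2 < y)%N by have := prime_gt1 hy; move: yE; case: (y) => [|[|[|]]].
    have : y%:Z ^+ 1 <= M.
      by rewrite /M -!PoszX lez_nat leq_exp2l// prime_gt1.
    by rewrite expr1; apply: le_trans; rewrite lez_nat.
  (* For [y = 2] the trace is odd, hence at least 3, and [4 M >= 9]. *)
  have a3 : (2 < a')%N.
    have [_ _] := ra; move=> /(_ m_gt0); rewrite yE coprimez_sym prime_coprimez//.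
    by rewrite dvdzE aE kE mul1n /= dvdn2 negbK; move: a1; clear; lia.
  have := root_norm; have : 9 <= a ^+ 2.
    by move: aE a3; rewrite kE mul1n; clear; nia.
  have : 0 <= P%:Z * b ^+ 2 by rewrite mulr_ge0// sqr_ge0.
  by move: (a ^+ 2) (_ * _); clear; lia.
Qed.

Lemma root_sq_b b' : `|b|%N = (k * b')%N -> b ^+ 2 = k%:Z ^+ 2 * b'%:Z ^+ 2.
Proof.
by move=> bE; rewrite -(real_normK (num_real b)) -abszE bE PoszM exprMn.
Qed.

Lemma root_odd_ge5 : odd y -> prime r -> (3 < r)%N ->
  (x, y, r * m)%N = (401, 11, 5)%N.
Proof.
move=> oy hr r3; have or : odd r by apply: contraLR r3 => /(prime_oddPn hr) ->.
have kE : k = 2%N by case: hk => -[-> // y2]; rewrite y2 in oy.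
have [aE UE] := root_core hr r3; have [eV _] := root_pow.
have [b' bE _] := root_b; have cE := root_c bE.
have r1 := prime_gt1 hr; have y1 := prime_gt1 hy.
have b0 : (0 < b')%N by move: c_gt0; rewrite cE muln_gt0 => /andP[].
set B := (P * b' ^ 2)%N.
have B0 : (0 < B)%N by rewrite muln_gt0 P_gt0 expn_gt0 b0.
have a4 : a ^+ 2 = 4 by rewrite -(real_normK (num_real a)) -abszE aE kE.
have MB : M = 1 + B%:Z.
  apply: (@mulfI _ (4 : int)) => //; rewrite -root_norm (root_sq_b bE) kE.
  rewrite a4 /B PoszM PoszX -[2%:Z]/(2 : int); ring.
have MBn : (B.+1 = y ^ m)%N by apply/eqP; rewrite -eqz_nat PoszX -/M MB; apply/eqP; clear; lia.
have eB : ~~ odd B by have : odd (y ^ m) by [rewrite oddX oy orbT]; rewrite -MBn.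
have UE' : `|lucU 2 (1 + B%:Z) r|%N = `|lucU a M r|%N by rewrite (lucU_abs M or aE) kE MB.
have VE' : `|lucV 2 (1 + B%:Z) r|%N = (2 * x)%N by rewrite -{2}kE -eV (lucV_abs M r aE) kE MB.
case: UE => U1; last first.
  have [r5 B10] := lucU2_prime_eq B0 hr r3 (etrans UE' U1).
  have ey : (y ^ m = 11)%N by rewrite -MBn B10.
  have y11 : y = 11%N.
    have : (y %| 11)%N by rewrite -ey dvdn_exp.
    by rewrite dvdn_prime2// => /eqP.
  have m1 : m = 1%N by move: ey; rewrite y11 -[X in _ = X](expn1 11) => /expnI; apply.
  rewrite r5 m1 y11; congr (_, _, _).
  move: VE'; rewrite r5 B10 !lucVSS lucV1 lucV0.
  by clear; lia.
(* For even [m], [y ^ m = z ^ 2] and [x ^ 2 + z ^ 2 - 1 = z ^ (2 r)]; but a square below [z ^ (2 r)]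
   differs from it by at least [2 z ^ r - 1]. *)
have om : odd m.
  apply: contraT => em; exfalso.
  pose z := (y ^ m./2)%N.
  have zE : (z ^ 2 = y ^ m)%N.
    rewrite -expnM muln2; congr (_ ^ _)%N.
    by have := odd_double_half m; rewrite (negPf em).
  have z1 : (1 < z)%N by rewrite -[1%N](exp1n m./2) ltn_exp2r//; move: em m_gt0; clear; lia.
  have xE : (x ^ 2 + B = (z ^ r) ^ 2)%N.
    apply/eqP; rewrite -eqz_nat PoszD; apply/eqP.
    have := lucUV_norm 2 (1 + B%:Z) r.
    have -> : lucV 2 (1 + B%:Z) r ^+ 2 = 4 * (x ^ 2)%N%:Z.
      by rewrite -(real_normK (num_real _)) -abszE VE' PoszM PoszX; ring.
    have -> : lucU 2 (1 + B%:Z) r ^+ 2 = 1.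
      by rewrite -(real_normK (num_real _)) -abszE UE' U1.
    have -> : (1 + B%:Z) ^+ r = ((z ^ r) ^ 2)%N%:Z.
      by rewrite -MB /M -PoszX -zE -PoszX expnAC.
    by move=> h; apply: (@mulfI _ (4 : int)) => //; rewrite -h; ring.
  have zB : (B.+1 = z ^ 2)%N by rewrite zE.
  have zr : (z ^ 2 <= z ^ r)%N by rewrite leq_exp2l.
  have xz : (x < z ^ r)%N by rewrite -ltn_sqr -xE; move: B0; clear; lia.
  by move: xE zB zr xz; rewrite -!mulnn; move: (z ^ r)%N (z * z)%N; clear; nia.
have [] : lucU 2 (1 + B%:Z) r = 1 \/ lucU 2 (1 + B%:Z) r = -1.
  by move: UE'; rewrite U1; clear; lia.
  by move/(lucU2_eq1 B0 eB or r1) => [_ r3']; rewrite r3' in r3.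
by move/(lucU2_eqN1 B0 eB or om hy MBn) => [_ r3']; rewrite r3' in r3.
Qed.

Lemma root_U_power : odd r -> prime r -> exists i, `|lucU a M r|%N = (r ^ i)%N.
Proof.
move=> or hr; apply: prime_power_of => //.
  have [b' bE _] := root_b; move: c_gt0.
  by rewrite (root_c bE) muln_gt0 => /andP[].
move=> q hq qU; have [h1 h2 _] := prime_dvd_c hq (prime_dvd_lucU hq qU).
apply: (lucU_prime_divisor hr hq (prime_dvd_lucU_odd or hq qU) qU) => //.
by have -> : a ^+ 2 - 4 * M = - (P%:Z * b ^+ 2) by [rewrite -root_norm; ring]; rewrite rpredN.
Qed.

(** Up to sign [3 a'^2 - B] is a power of 3, and [x] is [a' (a'^2 - 3 B)]. If [a' = 1] then [B] is
    2, 4 or [3 ^ i + 3]; if [a' > 1], the single prime of [x] leaves only 1 or 3 for the cofactor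
    [W], up to sign, and both are impossible. *)
Lemma root_odd_3 : odd y -> r = 3%N -> m = 1%N.
Proof.
move=> oy r3; have kE : k = 2%N by case: hk => -[-> // y2]; rewrite y2 in oy.
have y1 := prime_gt1 hy.
have or : odd r by rewrite r3. have hr : prime r by rewrite r3.
have [a' aE] := root_a; have [b' bE _] := root_b.
have [eV _] := root_pow; have cE := root_c bE.
have [i UE] := root_U_power or hr.
have b0 : (0 < b')%N by move: c_gt0; rewrite cE muln_gt0 => /andP[].
set B := (P * b' ^ 2)%N.
have B0 : (0 < B)%N by rewrite muln_gt0 P_gt0 expn_gt0 b0.
have a4 : a ^+ 2 = 4 * a'%:Z ^+ 2.
  by rewrite -(real_normK (num_real a)) -abszE aE PoszM exprMn kE.
have MB : M = a'%:Z ^+ 2 + B%:Z.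
  apply: (@mulfI _ (4 : int)) => //; rewrite -root_norm (root_sq_b bE) kE.
  by rewrite a4 /B PoszM PoszX -[2%:Z]/(2 : int); ring.
have MBn : (a' ^ 2 + B = y ^ m)%N.
  by apply/eqP; rewrite -eqz_nat PoszD !PoszX -/M MB.
move: UE eV; rewrite r3 lucU3 lucV3 a4 MB => UE eV.
have {}UE : `|(3 * a'%:Z ^+ 2 - B%:Z)%R|%N = (3 ^ i)%N by rewrite -UE; congr `|_|%N; ring.
pose W := a'%:Z ^+ 2 - 3 * B%:Z.
have xE : x = (a' * `|W|)%N.
  apply/eqP; rewrite -(eqn_pmul2l root_k_gt0) -eV abszM aE mulnA; apply/eqP.
  by congr (_ * `|_|)%N; rewrite /W; ring.
have a0 : (0 < a')%N by move: x_gt0; rewrite xE muln_gt0 => /andP[].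
have W0 : (0 < `|W|)%N by move: x_gt0; rewrite xE muln_gt0 => /andP[].
have pB : odd (a' ^ 2 + B) by rewrite MBn oddX oy orbT.
have prime_m : prime (y ^ m) -> m = 1%N.
  move=> hp; have : (y %| y ^ m)%N by rewrite dvdn_exp.
  by rewrite dvdn_prime2// => /eqP; rewrite -{1}(expn1 y) => /expnI h; rewrite -h.
have [a1|a1] : a' = 1%N \/ (1 < a')%N by move: a0; clear; lia.
  move: UE MBn; rewrite a1 => UE MBn; apply: prime_m.
  have [B2|[B4|[i0 BE]]] : B = 2%N \/ B = 4%N \/ (0 < i)%N /\ (B = 3 ^ i + 3)%N.
    have : B = 2%N \/ (B = 3 ^ i + 3)%N.
      have : (0 < 3 ^ i)%N by rewrite expn_gt0.
      move: UE pB; rewrite a1 !exp1n expr1n.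
      by move: (3 ^ i)%N; clear -B0; lia.
    case=> [->|BE]; first by left.
    by right; case: (posnP i) => [i0|i0]; [left; rewrite BE i0 | right].
  - by rewrite -MBn B2.
  - by rewrite -MBn B4.
  - suff -> : m = 1%N by rewrite expn1.
    apply: (pow3_add4 hy i0); rewrite -MBn BE; lia.
exfalso; have hp := pdiv_prime a1; set p := pdiv a' in hp.
have pa : (p %| a')%N by exact: pdiv_dvd.
have px : (p %| x)%N by rewrite xE dvdn_mulr.
have ap q : prime q -> (q %| a')%N -> q = p.
  by move=> hq qa; apply: (@primes_le1_eq x) => //; rewrite xE dvdn_mulr.
have Wp q : prime q -> (q %| `|W|)%N -> q = p.
  by move=> hq qa; apply: (@primes_le1_eq x) => //; rewrite xE dvdn_mull.
have W13 : `|W|%N = 1%N \/ `|W|%N = 3%N /\ (3 %| a')%N.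
  have [W1|W1] := leqP `|W|%N 1; first by left; move: W0 W1; clear; lia.
  right; have pW : (p %| W)%Z.
    by rewrite dvdzE -(Wp _ (pdiv_prime W1) (pdiv_dvd _)) pdiv_dvd.
  have pM : ~~ (p %| M)%Z.
    apply: prime_ndvd_norm => //.
    by apply: contraTneq cxy => <-; rewrite coprime_sym prime_coprime// px.
  have pa2 : (p %| a'%:Z ^+ 2)%Z by rewrite dvdz_exp// dvdzE.
  have nB : ~~ (p %| B%:Z)%Z by apply: contra pM => pB'; rewrite MB rpredD.
  have p3 : p = 3%N.
    have : (p %| 3%:Z * B%:Z)%Z.
      have -> : 3%:Z * B%:Z = a'%:Z ^+ 2 - W by rewrite /W; ring.
      by rewrite rpredB.
    by rewrite dvdz_primeM// (negPf nB) orbF dvdzE /= dvdn_prime2// => /eqP.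
  have h3a : (3 %| a')%N by rewrite -p3.
  have [W1'|->//] : `|W|%N = 1%N \/ `|W|%N = 3%N.
    apply: eq1_or_prime => //; first by move=> q hq /(Wp q hq) ->.
    apply/negP => W9; case/negP: nB; rewrite p3.
    have : ((3 * 3)%N %| 3%:Z * B%:Z)%Z.
      have -> : 3%:Z * B%:Z = a'%:Z ^+ 2 - W by rewrite /W; ring.
      by rewrite rpredB//; rewrite expr2 PoszM dvdz_mul.
    by rewrite PoszM dvdz_mul2l// dvdzE.
  by rewrite W1' in W1.
case: W13 => [W1|[W3 a3]].
(* With [3 ^ i = 8 B + 3] this becomes [(3 ^ j - 1) (3 ^ j + 1) = 8 a'^2], where [a'] is a prime
   power; the two factors share no odd prime and at most one factor 2 beyond the first, so
   [j <= 2]. *)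
- have aB : (a' ^ 2 = 3 * B + 1)%N.
    have hW : a'%:Z ^+ 2 = 3 * B%:Z + 1 \/ a'%:Z ^+ 2 = 3 * B%:Z - 1.
      by move: W1; rewrite /W; clear; lia.
    have par : exists t, a'%:Z ^+ 2 = 3 * t \/ a'%:Z ^+ 2 = 3 * t + 1.
      have [t [e|[e|e]]] : exists t, a'%:Z = 3 * t \/ a'%:Z = 3 * t + 1 \/ a'%:Z = 3 * t + 2.
        by exists (a'%:Z %/ 3)%Z; clear; lia.
      + by exists (3 * t ^+ 2); left; rewrite e; ring.
      + by exists (3 * t ^+ 2 + 2 * t); right; rewrite e; ring.
      + by exists (3 * t ^+ 2 + 4 * t + 1); right; rewrite e; ring.
    apply/eqP; rewrite -eqz_nat PoszX; apply/eqP; case: par => t ht.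
    by move: hW ht; move: (a'%:Z ^+ 2); clear; lia.
  have U8 : (3 ^ i = 8 * B + 3)%N.
    by rewrite -UE -PoszX aB; clear; lia.
  have a8 : (8 * a' ^ 2 = 3 ^ i.+1 - 1)%N by rewrite aB expnS U8; clear; lia.
  have [j jE] : exists j, i.+1 = (2 * j)%N.
    exists (i.+1./2); have [oi|ei] := boolP (odd i).
      by rewrite mul2n; have := odd_double_half i.+1; rewrite /= oi.
    exfalso; have := pow3_mod8 i.+1; rewrite [odd _]/= ei => u8; move: a8 u8.
    have : (0 < 3 ^ i.+1)%N by rewrite expn_gt0.
    by move: (3 ^ i.+1)%N (a' ^ 2)%N; clear; lia.
  have j0 : (0 < j)%N by move: jE; case: (j) => //; rewrite muln0.
  have a8' : ((3 ^ j - 1) * (3 ^ j + 1) = 8 * a' ^ 2)%N.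
    have := subn_sqr (3 ^ j) 1; rewrite exp1n => <-.
    by rewrite a8 jE -expnM [(j * 2)%N]mulnC.
  have [e aE'] : exists e, a' = (p ^ e)%N by apply: prime_power_of.
  have j2 : (j <= 2)%N.
    rewrite leqNgt; apply/negP => j3.
    have big : (27 <= 3 ^ j)%N by rewrite -[27%N]/(3 ^ 3)%N leq_exp2l.
    have [op|/(prime_oddPn hp) p2] := boolP (odd p); last first.
      have pow2 d : (d %| 8 * a' ^ 2)%N -> (25 < d)%N -> (4 %| d)%N.
        have -> : (8 * a' ^ 2 = 2 ^ (3 + e * 2))%N by rewrite aE' p2 -expnM expnD.
        case/(dvdn_pfactor _ _ (isT : prime 2)) => -[|[|d'']] _ -> // _.
        by rewrite !expnS mulnA dvdn_mulr.
      have h1 : (4 %| 3 ^ j - 1)%N.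
        by apply: pow2; [rewrite -a8' dvdn_mulr | move: big; clear; lia].
      have h2 : (4 %| 3 ^ j + 1)%N.
        by apply: pow2; [rewrite -a8' dvdn_mull | move: big; clear; lia].
      by move: h1 h2 big; move: (3 ^ j)%N; clear; lia.
    have [pm|pm] := boolP (p %| 3 ^ j - 1)%N.
      have np : ~~ (p %| 3 ^ j + 1)%N.
        apply/negP => pp; have : (p %| (3 ^ j + 1) - (3 ^ j - 1))%N by rewrite dvdn_sub.
        have -> : ((3 ^ j + 1) - (3 ^ j - 1) = 2)%N by move: big; clear; lia.
        by rewrite dvdn_prime2//; apply/negP; apply: contraTneq op => ->.
      have : (3 ^ j + 1 %| 8 * a' ^ 2)%N by rewrite -a8' dvdn_mull.
      rewrite Gauss_dvdl; last by rewrite aE' coprimeXr// coprimeXr// coprime_sym prime_coprime.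
      by move/dvdn_leq; move: big; clear; lia.
    have : (3 ^ j - 1 %| 8 * a' ^ 2)%N by rewrite -a8' dvdn_mulr.
    rewrite Gauss_dvdl; last by rewrite aE' coprimeXr// coprimeXr// coprime_sym prime_coprime.
    by move/dvdn_leq; move: big; clear; lia.
  have [j1|j2'] : j = 1%N \/ j = 2%N by move: j0 j2; clear; lia.
    by move: a8' a1; rewrite j1 -mulnn; clear; nia.
  have : (a' * a' = 10)%N.
    by move: a8'; rewrite j2' -!mulnn; move: (a' * a')%N; clear; lia.
  by clear; case: (a') => [|[|[|[|z]]]] //; nia.
(* As 9 divides [a'^2], [B] is prime to 3, which leaves [3 ^ i = 1], against size. *)
- have aW : a'%:Z ^+ 2 = 3 * B%:Z + 3 \/ a'%:Z ^+ 2 = 3 * B%:Z - 3.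
    by move: W3; rewrite /W; clear; lia.
  have [t a9] : exists t, a'%:Z ^+ 2 = 9 * t.
    by case/dvdnP: a3 => t ->; exists (t%:Z ^+ 2); rewrite PoszM -[3%:Z]/(3 : int); ring.
  have a20 : 0 < a'%:Z ^+ 2 by rewrite exprn_gt0// ltz_nat.
  move: aW a9 a20 UE; move: (a'%:Z ^+ 2) => z.
  case: i => [|i]; [rewrite expn0 | rewrite expnS; move: (3 ^ i)%N]; clear -B0; lia.
Qed.

Lemma root_norm_half a' b' : odd y -> `|a|%N = (k * a')%N -> `|b|%N = (k * b')%N ->
  (a' ^ 2 + P * b' ^ 2 = y ^ m)%N.
Proof.
move=> oy aE bE; have kE : k = 2%N by case: hk => -[-> // y2]; rewrite y2 in oy.
apply/eqP; rewrite -eqz_nat PoszD PoszM !PoszX -/M; apply/eqP.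
apply: (@mulfI _ (4 : int)) => //; rewrite -root_norm (root_sq_b bE) kE.
rewrite -(real_normK (num_real a)) -abszE aE kE PoszM -[2%:Z]/(2 : int); ring.
Qed.

(** A prime factor of [a'] divides [U], hence [c], hence the discriminant and [4 M], so it is 2.
    Then [y] is odd, yet [a'] and [P b'^2] are both even, and so is their norm [y ^ m]. *)
Lemma root_4_a (a' : nat) : r = 4%N -> `|a|%N = (k * a')%N -> a' = 1%N.
Proof.
move=> r4 aE; have [b' bE Qb] := root_b; have cE := root_c bE.
have UE : lucU a M r = a * (a ^+ 2 - 2 * M) by rewrite r4 lucU4.
have a0 : (0 < a')%N.
  rewrite lt0n; apply/eqP => a0; move: c_gt0; rewrite cE UE abszM aE a0.
  by rewrite muln0 mul0n muln0.
have [a1|a1] := leqP a' 1; first by move: a0 a1; clear; lia.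
exfalso; have hp := pdiv_prime a1; have pa := pdiv_dvd a'.
have pU : (pdiv a' %| lucU a M r)%Z.
  by rewrite UE dvdz_mulr// dvdzE aE dvdn_mull.
have pc := prime_dvd_lucU hp pU.
have [h1 h2 py] := prime_dvd_c hp pc.
have : (pdiv a' %| 2%:Z * 2%:Z * M)%Z.
  rewrite -[2%:Z * 2%:Z]/(4 : int) -root_norm rpredD// dvdz_exp// dvdzE aE dvdn_mull//.
rewrite !dvdz_primeM// (negPf h2) orbF orbb dvdzE /= dvdn_prime2// => /eqP p2.
case: hk => -[kE yE]; last by rewrite p2 yE eqxx in py.
have /negP[] : ~~ odd (y ^ m).
  rewrite -(root_norm_half yE aE bE) oddD oddM !oddX /=.
  have -> : odd a' = false by move: pa; rewrite p2 dvdn2 => /negPf.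
  have := hrad hp pc; rewrite p2 dvdn2 oddM negb_and => /orP[/negPf ->//|oQ].
  have -> : odd b' = false; last by rewrite andbF.
  by case/dvdnP: Qb => z ->; rewrite oddM (negPf oQ) andbF.
by rewrite oddX yE orbT.
Qed.

Lemma root_odd_4 : odd y -> r = 4%N -> (x, y, r * m)%N = (7, 3, 4)%N.
Proof.
move=> oy r4; have kE : k = 2%N by case: hk => -[-> // y2]; rewrite y2 in oy.
have [a' aE] := root_a; have [b' bE Qb] := root_b; have cE := root_c bE.
have a1 := root_4_a r4 aE; have := root_norm_half oy aE bE.
rewrite a1 exp1n; set B := (P * b' ^ 2)%N => MBn.
have a4 : a ^+ 2 = 4 by rewrite -(real_normK (num_real a)) -abszE aE kE a1.
have MB : M = 1 + B%:Z by rewrite /M -PoszX -MBn PoszD.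
have UE : (`|lucU a M r| = 4 * `|(1 - B%:Z)%R|)%N.
  rewrite r4 lucU4 abszM aE kE a1 a4 MB.
  have -> : 4 - 2 * (1 + B%:Z) = 2 * (1 - B%:Z) by ring.
  by rewrite abszM mulnA.
(* A prime dividing [1 - B] divides [U], hence [c], hence [B]. *)
have B1 : `|(1 - B%:Z)%R|%N = 1%N.
  have B0 : (0 < `|(1 - B%:Z)%R|)%N.
    by move: c_gt0; rewrite cE UE !muln_gt0 => /and3P[].
  have [|B1] := leqP `|(1 - B%:Z)%R|%N 1; first by move: B0; clear; lia.
  exfalso; set p := pdiv `|(1 - B%:Z)%R|%N; have hp : prime p by apply: pdiv_prime.
  have p1 : (p %| 1 - B%:Z)%Z by rewrite dvdzE pdiv_dvd.
  have pc : (p %| c)%N by rewrite cE UE !dvdn_mull// pdiv_dvd.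
  have pB : (p %| B%:Z)%Z.
    rewrite dvdzE /= /B; have := hrad hp pc; rewrite Euclid_dvdM// => /orP[pP|pQ].
      exact: dvdn_mulr.
    by apply: dvdn_mull; rewrite Euclid_dvdX// andbT; apply: dvdn_trans Qb.
  have : (p %| (1 - B%:Z) + B%:Z)%Z by rewrite rpredD.
  by rewrite subrK dvdzE /= Euclid_dvd1.
have B2 : B = 2%N.
  have [B0|//] : B = 0%N \/ B = 2%N by move: B1; clear; lia.
  have := root_norm_gt1; rewrite MB B0; clear; lia.
have ey : (y ^ m = 3)%N by rewrite -MBn B2.
have y3 : y = 3%N.
  have : (y %| 3)%N by rewrite -ey dvdn_exp.
  by rewrite dvdn_prime2// => /eqP.
have m1 : m = 1%N by move: ey; rewrite y3 -[X in _ = X](expn1 3) => /expnI; apply.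
rewrite r4 m1 y3; congr (_, _, _).
have [eV _] := root_pow; move: eV; rewrite (lucV_abs M r aE) kE a1 MB B2 r4.
by rewrite !lucVSS lucV1 lucV0; clear; lia.
Qed.

Lemma root_two_ge5 : y = 2%N -> prime r -> (3 < r)%N ->
  (x, y, r * m + 2)%N \in [:: (11, 2, 7); (181, 2, 15); (61, 2, 12); (13, 2, 9)]%N.
Proof.
move=> y2 hr r3; have or : odd r by apply: contraLR r3 => /(prime_oddPn hr) ->.
have kE : k = 1%N by case: hk => -[-> // oy]; rewrite y2 in oy.
have [aE UE] := root_core hr r3; have [eV _] := root_pow.
have r1 := prime_gt1 hr; have r0 := prime_gt0 hr.
have ME : M = (2 ^ m)%N%:Z by rewrite /M y2 PoszX.
have M2 : (2%:Z %| M)%Z by rewrite /M y2 dvdz_exp.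
have M0 : 0 < M by apply: lt_trans root_norm_gt1.
have UE' : lucU 1 M r = lucU a M r by rewrite (lucU_abs M or aE) kE.
have VE' : `|lucV 1 M r|%N = x by rewrite -(mul1n x) -{1}kE -eV (lucV_abs M r aE) kE.
case: UE => U1; last first.
  have : `|lucU 1 (2 ^ m)%N r|%N = r by rewrite -ME UE'.
  move/(lucU1_prime_eq m_gt0 hr r3); rewrite !inE !xpair_eqE => /orP[] /andP[/eqP rE /eqP mE].
    have xE : x = 13%N by rewrite -VE' ME rE mE !lucVSS lucV1 lucV0; clear; lia.
    by rewrite xE y2 rE mE.
  have xE : x = 61%N by rewrite -VE' ME rE mE !lucVSS lucV1 lucV0; clear; lia.
  by rewrite xE y2 rE mE.
have [U1'|U1'] : lucU 1 M r = 1 \/ lucU 1 M r = -1 by rewrite UE'; move: U1; clear; lia.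
  by case: (lucU1_neq1 M0 M2 or r1).
have MM := lucU1_eqN1 M0 M2 r0 U1'.
have m1 : m = 1%N.
  apply/eqP; rewrite -(@eqn_exp2l 2)// expn1 -eqz_nat -ME MM//.
move: U1' VE'; rewrite MM => /(lucU12_eqN1 or); rewrite !inE => /or3P[] /eqP rE.
- by rewrite rE in r3.
- move=> VE'; have xE : x = 11%N by rewrite -VE' rE !lucVSS lucV1 lucV0; clear; lia.
  by rewrite xE y2 rE m1.
- move=> VE'; have xE : x = 181%N by rewrite -VE' rE !lucVSS lucV1 lucV0; clear; lia.
  by rewrite xE y2 rE m1.
Qed.

Lemma root_two_3 : y = 2%N -> r = 3%N ->
  (x, y, r * m + 2)%N \in [:: (5, 2, 5); (11, 2, 8)]%N.
Proof.
move=> y2 r3; have kE : k = 1%N by case: hk => -[-> // oy]; rewrite y2 in oy.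
have or : odd r by rewrite r3. have hr : prime r by rewrite r3.
have [a' aE0] := root_a; have aE : `|a|%N = a' by rewrite aE0 kE mul1n.
have [eV0 _] := root_pow; have eV : `|lucV a M r|%N = x by rewrite eV0 kE mul1n.
have [i UE0] := root_U_power or hr.
have ME : M = (2 ^ m)%N%:Z by rewrite /M y2 PoszX.
have M1 := root_norm_gt1.
have a2 : a ^+ 2 = a'%:Z ^+ 2 by rewrite -(real_normK (num_real a)) -abszE aE.
have oa : odd a'.
  have [_ _] := ra; move=> /(_ m_gt0); rewrite y2 coprimez_sym prime_coprimez//.
  by rewrite dvdzE aE /= dvdn2 negbK.
have UE : `|(a'%:Z ^+ 2 - M)%R|%N = (3 ^ i)%N by have := UE0; rewrite r3 lucU3 a2.
pose W := a'%:Z ^+ 2 - 3 * M.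
have xE : x = (a' * `|W|)%N by rewrite -eV r3 lucV3 abszM aE a2.
have W0 : (0 < `|W|)%N by move: x_gt0; rewrite xE muln_gt0 => /andP[].
have [a1|a1] : a' = 1%N \/ (1 < a')%N.
  by move: oa; case: (a') => [|[|]] //; [left|right].
  have M3 : (2 ^ m = 3 ^ i + 1)%N.
    by move: UE M1; rewrite ME a1 expr1n; move: (2 ^ m)%N (3 ^ i)%N; clear; lia.
  (* [3 ^ i + 1] is 2 or 4 modulo 8. *)
  have : (m < 3)%N.
    rewrite ltnNge; apply/negP => m3.
    have : (2 ^ 3 %| 3 ^ i + 1)%N by rewrite -M3 dvdn_exp2l.
    by have := pow3_mod8 i; case: ifP => _; move: (3 ^ i)%N; clear; lia.
  move=> m3; have [mE|mE] : m = 1%N \/ m = 2%N by move: m3 m_gt0; clear; lia.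
    have xE5 : x = 5%N by rewrite xE /W a1 ME mE; clear; lia.
    by rewrite xE5 y2 r3 mE.
  have xE11 : x = 11%N by rewrite xE /W a1 ME mE; clear; lia.
  by rewrite xE11 y2 r3 mE.
exfalso; have hp := pdiv_prime a1; set p := pdiv a' in hp.
have pa : (p %| a')%N by exact: pdiv_dvd.
have Wp q : prime q -> (q %| `|W|)%N -> q = p.
  by move=> hq qa; apply: (@primes_le1_eq x) => //; rewrite xE; [exact: dvdn_mull|exact: dvdn_mulr].
have op : odd p by case/dvdnP: pa => z zE; move: oa; rewrite zE oddM => /andP[].
have pM : ~~ (p %| M)%Z.
  by apply: prime_ndvd_norm => //; rewrite y2; apply: contraTneq op => ->.
have pa2 : (p %| a'%:Z ^+ 2)%Z by rewrite dvdz_exp// dvdzE.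
have W13 : `|W|%N = 1%N \/ `|W|%N = 3%N /\ (3 %| a')%N.
  have [W1|W1] := leqP `|W|%N 1; first by left; move: W0 W1; clear; lia.
  right; have pW : (p %| W)%Z.
    by rewrite dvdzE -(Wp _ (pdiv_prime W1) (pdiv_dvd _)) pdiv_dvd.
  have p3 : p = 3%N.
    have : (p %| 3%:Z * M)%Z.
      have -> : 3%:Z * M = a'%:Z ^+ 2 - W by rewrite /W; ring.
      by rewrite rpredB.
    by rewrite dvdz_primeM// (negPf pM) orbF dvdzE /= dvdn_prime2// => /eqP.
  have h3a : (3 %| a')%N by rewrite -p3.
  have [W1'|->//] : `|W|%N = 1%N \/ `|W|%N = 3%N.
    apply: eq1_or_prime => //; first by move=> q hq /(Wp q hq) ->.
    apply/negP => W9; case/negP: pM; rewrite p3.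
    have : ((3 * 3)%N %| 3%:Z * M)%Z.
      have -> : 3%:Z * M = a'%:Z ^+ 2 - W by rewrite /W; ring.
      by rewrite rpredB//; rewrite expr2 PoszM dvdz_mul.
    by rewrite PoszM dvdz_mul2l.
  by rewrite W1' in W1.
case: W13 => [W1|[W3 a3]]; last first.
  have [t a9] : exists t, a'%:Z ^+ 2 = 9 * t.
    by case/dvdnP: a3 => t ->; exists (t%:Z ^+ 2); rewrite PoszM -[3%:Z]/(3 : int); ring.
  have nM3 : ~~ (3%:Z %| M)%Z by rewrite ME dvdzE /= Euclid_dvdX.
  have a20 : 9 <= a'%:Z ^+ 2.
    have : 0 < a'%:Z ^+ 2 by rewrite exprn_gt0// ltz_nat ltnW.
    by rewrite a9; clear; lia.
  move: W3 a9 a20 nM3 M1 UE; rewrite /W; move: (a'%:Z ^+ 2) M => z N.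
  case: (i) => [|j]; [rewrite expn0 | rewrite expnS; move: (3 ^ j)%N]; clear; lia.
have aM : a'%:Z ^+ 2 = 3 * M + 1.
  have par : exists t, a'%:Z ^+ 2 = 3 * t \/ a'%:Z ^+ 2 = 3 * t + 1.
    have [t [e|[e|e]]] : exists t, a'%:Z = 3 * t \/ a'%:Z = 3 * t + 1 \/ a'%:Z = 3 * t + 2.
      by exists (a'%:Z %/ 3)%Z; clear; lia.
    + by exists (3 * t ^+ 2); left; rewrite e; ring.
    + by exists (3 * t ^+ 2 + 2 * t); right; rewrite e; ring.
    + by exists (3 * t ^+ 2 + 4 * t + 1); right; rewrite e; ring.
  case: par => t ht; move: W1 ht; rewrite /W; move: (a'%:Z ^+ 2); clear; lia.
have [z zE] : exists z, a' = (2 * z + 1)%N by exists (a'./2); move: oa; clear; lia.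
have [w wE] := even_mulz_succ z%:Z.
have M8 : (8%:Z %| M)%Z.
  have : 3 * M = 8 * w.
    transitivity (4 * (z%:Z * (z%:Z + 1))); last by rewrite wE; ring.
    transitivity (a'%:Z ^+ 2 - 1); first by rewrite aM; ring.
    by rewrite zE PoszD PoszM -[2%:Z]/(2 : int); ring.
  by move: (M); clear; lia.
(* This is 1 modulo 16. Since 3 has order 4 modulo 16 and modulo 80, it is 1 modulo 80 as well, and
   5 would divide a power of 2. *)
have U2 : (3 ^ i = 2 * 2 ^ m + 1)%N.
  by rewrite -UE aM ME; move: (2 ^ m)%N; clear; lia.
have h16 : (3 ^ i %% 16 = 1)%N.
  by move: M8; rewrite ME U2; move: (2 ^ m)%N; clear; lia.
have h80 : (3 ^ i %% 80 \in [:: 1; 3; 9; 27])%N.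
  by elim: (i) => // j; rewrite expnS -modnMmr !inE => /or4P[] /eqP ->.
have : (5 %| 2 ^ m)%N.
  move: h80 h16; rewrite U2 !inE; move: (2 ^ m)%N => t.
  by case/or4P => /eqP; clear; lia.
by rewrite Euclid_dvdX.
Qed.

(** A prime factor of [1 - 2 M] divides [U], hence [c], hence [P b ^ 2 = 4 M - 1], hence
    [2 (1 - 2 M) + (4 M - 1) = 1]. *)
Lemma root_two_4 : y = 2%N -> r = 4%N -> False.
Proof.
move=> y2 r4; have kE : k = 1%N by case: hk => -[-> // oy]; rewrite y2 in oy.
have [a' aE] := root_a; have [b' bE _] := root_b; have cE := root_c bE.
have a1 := root_4_a r4 aE; have M1 := root_norm_gt1.
have a2 : a ^+ 2 = 1 by rewrite -(real_normK (num_real a)) -abszE aE kE a1.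
have UE : `|lucU a M r|%N = `|(1 - 2 * M)%R|%N.
  by rewrite r4 lucU4 abszM aE kE a1 a2 !mul1n.
have W1 : (1 < `|(1 - 2 * M)%R|)%N by move: M1; clear; lia.
set p := pdiv `|(1 - 2 * M)%R|%N; have hp : prime p by apply: pdiv_prime.
have p1 : (p %| 1 - 2 * M)%Z by rewrite dvdzE pdiv_dvd.
have pc : (p %| c)%N by rewrite cE UE dvdn_mull// pdiv_dvd.
have [h1 _ _] := prime_dvd_c hp pc.
have : (p %| 2 * (1 - 2 * M) + P%:Z * b ^+ 2)%Z by rewrite rpredD// dvdz_mull.
have -> : 2 * (1 - 2 * M) + P%:Z * b ^+ 2 = 1.
  have -> : P%:Z * b ^+ 2 = 4 * M - a ^+ 2 by rewrite -root_norm; ring.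
  by rewrite a2; ring.
by rewrite dvdzE /= Euclid_dvd1.
Qed.

End Power.

End Roots.

(** * The divisibility *)

(** Write [N = t d] with [d = gcdn N H]. For [t = j r], subtracting [d] from [N] [t - j] times
    reaches the exponent [j d = N / r], so every divisor [r] of [t] comes with an element to which
    the root analysis applies. *)
Lemma rep_index_dvd (P f y N H : nat) (x c u w : int) :
  prime y -> coprime P y -> coprime f y -> (0 < N)%N -> (0 < H)%N ->
  rep P f y N x c -> rep P f y H u w ->
  (forall r m a b, (0 < r)%N -> (0 < m)%N -> N = (r * m)%N -> rep P f y m a b ->
     (prime r /\ (2 < r)%N) \/ r = 4%N -> False) ->
  (N %| 2 * H)%N.
Proof.
move=> hy cP cf N0 H0 rN rH hr.
have [a [b rd]] := rep_gcd hy cP cf rN rH N0 H0.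
set d := gcdn N H in rd; have d0 : (0 < d)%N by rewrite gcdn_gt0 N0.
have /dvdnP[t tE] : (d %| N)%N by exact: dvdn_gcdl.
have t0 : (0 < t)%N by move: N0; rewrite tE muln_gt0 => /andP[].
have main r : (r %| t)%N -> (prime r /\ (2 < r)%N) \/ r = 4%N -> False.
  move=> rt; have r0 : (0 < r)%N by exact: dvdn_gt0 rt.
  case/dvdnP: rt => j jE hr'.
  have j0 : (0 < j)%N by move: t0; rewrite jE muln_gt0 => /andP[].
  have le : ((t - j) * d <= N)%N by rewrite tE leq_mul2r leq_subr orbT.
  have [a' [b' rm]] := rep_sub_mul hy cP cf rN rd d0 le.
  apply: (hr r (N - (t - j) * d)%N a' b') => //.
    rewrite tE -mulnBl subKn; first by rewrite muln_gt0 j0.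
    by rewrite jE leq_pmulr.
  rewrite tE -mulnBl subKn; first by rewrite mulnA [(r * j)%N]mulnC -jE.
  by rewrite jE leq_pmulr.
have [t1|t2] : t = 1%N \/ t = 2%N.
  apply: eq1_or_prime => //; last by apply/negP => t4; apply: (main 4%N) => //; right.
  move=> q hq qt; have := prime_gt1 hq; rewrite leq_eqVlt => /predU1P[<-//|q2].
  by case: (main q qt); left.
- by rewrite tE t1 mul1n dvdn_mull// dvdn_gcdr.
- by rewrite tE t2 dvdn_mul// dvdn_gcdr.
Qed.

Lemma squarefreeM_prime q n : prime q -> squarefree n -> ~~ (q %| n)%N ->
  squarefree (q * n).
Proof.
move=> hq sn qn d dqn; have [qd|qd] := boolP (q %| d)%N.
  case/negP: qn; rewrite -(@dvdn_pmul2l q) ?prime_gt0//.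
  by apply: dvdn_trans dqn; rewrite -mulnn dvdn_mul.
apply: sn; rewrite -(@Gauss_dvdr _ q)// coprime_sym prime_coprime//.
by rewrite Euclid_dvdX// negb_and qd.
Qed.

Lemma radical_prime C R q : (0 < C)%N -> largest_squarefree_divisor C R ->
  prime q -> (q %| C)%N -> (q %| R)%N.
Proof.
move=> C0 [RC sR hmax] hq qC; apply: contraT => qR.
have : (q * R <= R)%N.
  apply: hmax; last exact: squarefreeM_prime.
  by rewrite Gauss_dvd ?qC// prime_coprime.
have R0 : (0 < R)%N by exact: dvdn_gt0 RC.
by have := prime_gt1 hq; move: R0; clear; nia.
Qed.

(** This settles [P = Q = 1]. Here [x] is a power of 2; for odd [n] the cofactor
    [(y ^ n - 1) / (y - 1)] is odd and divides a power of 2, and for even [n] two positive squares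
    would differ by 1. *)
Lemma sq_add1_prime_power (x y n : nat) : (0 < x)%N -> prime y -> odd y ->
  (size (primes x) <= 1)%N -> (x ^ 2 + 1 = y ^ n)%N -> n = 1%N.
Proof.
move=> x0 hy oy hx e; have y1 := prime_gt1 hy.
have ex : ~~ odd x.
  have : odd (x ^ 2 + 1) by rewrite e oddX oy orbT.
  by rewrite oddD oddX /= addbT.
have [k xE] : exists k, x = (2 ^ k)%N.
  apply: prime_power_of => // q hq qx; apply: (@primes_le1_eq x) => //.
  by rewrite dvdn2.
have k0 : (0 < k)%N by move: ex; rewrite xE; case: k {xE}.
have [on|en] := boolP (odd n); last first.
  have nE : n = (n./2 * 2)%N by rewrite muln2; have := odd_double_half n; rewrite (negPf en).
  move: e; rewrite nE expnM; move: (y ^ n./2)%N => z e.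
  have xz : (x < z)%N by rewrite -ltn_sqr -e addn1.
  by move: e x0 xz; rewrite -!mulnn; clear; nia.
have nE : n = n./2.*2.+1 by have := odd_double_half n; rewrite on.
have [n1|n1] : n./2 = 0%N \/ (0 < n./2)%N by case: (n./2); [left|right].
  by rewrite nE n1.
exfalso; pose s := (\sum_(i < n) y ^ i)%N.
have sE : ((y - 1) * s = 2 ^ (k * 2))%N.
  have -> : (2 ^ (k * 2) = y ^ n - 1)%N by rewrite -e xE -expnM addn1 subn1.
  by rewrite !subn1 predn_exp.
have os : odd s.
  suff os l : odd (\sum_(i < l) y ^ i)%N = odd l by rewrite /s os.
  elim: l => [|l IH]; first by rewrite big_ord0.
  by rewrite big_ord_recr oddD oddX /= IH oy orbT addbT.
have : (s %| 2 ^ (k * 2))%N by rewrite -sE dvdn_mull.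
case/(dvdn_pfactor _ _ (isT : prime 2)) => j _ jE.
have s1 : s = 1%N by move: os; rewrite jE oddX orbF => /eqP ->.
have : (y ^ 1 = y ^ n)%N.
  by rewrite expn1 -e xE -expnM -sE s1 muln1 subnK// ltnW.
by move/(expnI y1) => n1'; rewrite -n1' in n1.
Qed.

Lemma shift_index_dvd (N : nat) (P Q h : nat) :
  (N %| 2 * (h * 3 ^ ell P * `|apparition_lcm P Q|))%N -> (N%:Z %| bigN P Q h)%Z.
Proof.
move=> hN; rewrite dvdzE; suff -> : `|bigN P Q h|%N =
  (2 * (h * 3 ^ ell P * `|apparition_lcm P Q|))%N by [].
rewrite /bigN -/(apparition_lcm P Q) !abszM abszX !mulnA.
by congr (_ * _)%N; rewrite mulnAC.
Qed.

Theorem theorem4p1 (C P Q h x y n : nat) :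
  (0 < C)%N -> (0 < P)%N ->
  largest_squarefree_divisor C (P * Q)%N ->
  (exists c : nat, C = (P * c ^ 2)%N) ->
  is_class_exponent P h ->
  (0 < x)%N -> (0 < y)%N -> (0 < n)%N ->
  (x ^ 2 + C = y ^ n)%N ->
  prime y ->
  (size (primes x) <= 1)%N ->
  coprime x y ->
  (x, y, n) \notin exceptional_solutions ->
  n = 3%N \/ (n%:Z - (shift y)%:Z %| bigN P Q h)%Z.
Proof.
move=> C0 P0 hC [c cE] [h0 kill _] x0 _ n0 e hy hx cxy hexc.
have y1 := prime_gt1 hy.
have c0 : (0 < c)%N by move: C0; rewrite cE; case: (c) => //; rewrite muln0.
have [PQC sPQ _] := hC.
have sP : squarefree P by apply: squarefree_dvdl sPQ _; rewrite dvdn_mulr.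
have sQ : squarefree Q by apply: squarefree_dvdl sPQ _; rewrite dvdn_mull.
have cPQ := squarefree_coprime sPQ.
have Q0 := squarefree_gt0 sQ.
have cCy : coprime C y.
  rewrite coprime_sym prime_coprime//; apply/negP => yC.
  have : (y %| x ^ 2 + C)%N by rewrite e dvdn_exp.
  rewrite dvdn_addl// Euclid_dvdX// andbT.
  by move: cxy; rewrite coprime_sym prime_coprime// => /negPf ->.
have cPy : coprime P y by apply: coprime_dvdl cCy; rewrite cE dvdn_mulr.
have ccy : coprime c y by apply: coprime_dvdl cCy; rewrite cE dvdn_mull// dvdn_exp.
have cQy : coprime Q y by apply: coprime_dvdl cCy; apply: dvdn_trans PQC; rewrite dvdn_mull.
have hrad q : prime q -> (q %| c)%N -> (q %| P * Q)%N.
  by move=> hq qc; apply: (radical_prime C0 hC hq); rewrite cE dvdn_mull// dvdn_exp.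
have Qc : (Q %| c)%N.
  apply: squarefree_dvd => // q hq qQ.
  have : (q %| P * c ^ 2)%N by rewrite -cE; apply: dvdn_trans PQC; rewrite dvdn_mull.
  rewrite Euclid_dvdM// Euclid_dvdX// andbT => /orP[qP|//].
  have : (q %| gcdn P Q)%N by rewrite dvdn_gcd qP.
  by rewrite (eqP cPQ) Euclid_dvd1.
have eyn : y%:Z ^+ n = x%:Z ^+ 2 + P%:Z * c%:Z ^+ 2.
  by rewrite -!PoszX -PoszM -PoszD -cE e.
have m0 : (0 < `|apparition_lcm P Q|)%N by rewrite absz_gt0 gt_eqF// apparition_lcm_gt0.
have [oy|/(prime_oddPn hy) y2] := boolP (odd y).
- have -> : shift y = 0%N by rewrite /shift; case: eqP => // y2; rewrite y2 in oy.
  rewrite subr0.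
  have [PQ1|PQ1] := leqP (P * Q) 1.
    have [P1 Q1] : P = 1%N /\ Q = 1%N by move: PQ1 P0 Q0; clear; nia.
    have c1 : c = 1%N.
      have [|c1] := leqP c 1; first by move: c0; clear; lia.
      have := hrad _ (pdiv_prime c1) (pdiv_dvd c).
      by rewrite P1 Q1 Euclid_dvd1// pdiv_prime.
    right; have -> : n = 1%N; last exact: dvd1z.
    by apply: (sq_add1_prime_power x0 hy oy hx); rewrite -e cE P1 c1.
  have hPQ : (4 < P * (2 * Q) ^ 2)%N by move: PQ1 Q0 P0; rewrite -mulnn; clear; nia.
  have c2Qy : coprime (2 * Q) y.
    rewrite coprimeMl cQy andbT coprime_sym prime_coprime// dvdn_prime2//.
    by apply: contraTneq oy => ->.
  have r2c : rep P (2 * Q) y n (2 * x)%N (2 * c)%N.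
    split.
    - by rewrite eyn !PoszM -[2%:Z]/(2 : int); ring.
    - by rewrite dvdzE /= dvdn_pmul2l.
    - move=> _; rewrite coprimezE /= coprimeMl cxy andbT.
      by move: c2Qy; rewrite coprimeMl => /andP[].
  have [eN _ cN] := r2c.
  have [u [w [eu cu]]] := class_exponent_norm P0 sP hy n0 h0 kill eN (cN n0).
  have ru : rep P 1 y h u w by split=> //; rewrite dvd1z.
  have [u1 [w1 ru1]] := rep_conductor2 hy oy sP cPy h0 ru.
  have c2y : coprime 2 y by move: c2Qy; rewrite coprimeMl => /andP[].
  have h30 : (0 < h * 3 ^ ell P)%N by rewrite muln_gt0 h0 expn_gt0.
  have [u2 [w2 ru2]] := rep_apparition hy cPy c2y h30 sQ cPQ cQy (or_introl erefl) ru1.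
  have [n3|n3] := eqVneq n 3%N; [by left | right].
  apply: shift_index_dvd; apply: (rep_index_dvd hy cPy c2Qy n0 _ r2c ru2).
    by rewrite muln_gt0 h30.
  move=> r l a b r0 l0 nE rl hr.
  rewrite nE in r2c.
  have hk : 2%N = 2%N /\ odd y \/ 2%N = 1%N /\ y = 2%N by left.
  case: hr => [[hr r2]|r4].
    move: r2; rewrite leq_eqVlt => /predU1P[r3|r3].
      have l1 := root_odd_3 hy hk P0 x0 c0 hx cxy cPy ccy c2Qy hPQ hrad l0 r0 r2c rl oy (esym r3).
      by move: n3; rewrite nE l1 -r3.
    have := root_odd_ge5 hy hk P0 x0 c0 hx cxy cPy ccy c2Qy hPQ hrad l0 r0 r2c rl oy hr r3.
    by rewrite -nE => E; move: hexc; rewrite E.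
  have := root_odd_4 hy hk c0 cPy ccy c2Qy hPQ hrad l0 r0 r2c rl oy r4.
  by rewrite -nE => E; move: hexc; rewrite E.
- right; rewrite /shift y2 eqxx.
  have ox : odd x by move: cxy; rewrite y2 coprime_sym coprime2n.
  have oP : odd P by move: cPy; rewrite y2 coprime_sym coprime2n.
  have oc : odd c by move: ccy; rewrite y2 coprime_sym coprime2n.
  have oQ : odd Q by move: cQy; rewrite y2 coprime_sym coprime2n.
  (* For [n = 1] the difference [n - 2] is -1, and [n = 2] forces the exception [(1, 2, 2)];
     afterwards [n - 2] is a positive natural number. *)
  have [n2|n3] := leqP n 2.
    have [n1|nE2] : n = 1%N \/ n = 2%N by move: n0 n2; clear; lia.
      by rewrite n1 dvdzE /= dvd1n.
    exfalso; move: hexc; rewrite nE2 y2; suff -> : x = 1%N by [].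
    by move: e ox C0; rewrite nE2 y2 -mulnn; clear; nia.
  pose N := (n - 2)%N; have N0 : (0 < N)%N by rewrite subn_gt0.
  have nE : n%:Z - 2%:Z = N%:Z by rewrite subzn// ltnW.
  rewrite nE.
  have rxc : rep P (1 * Q) y N (1 * x)%N (1 * c)%N.
    rewrite !mul1n; split=> //; rewrite -eyn y2 -[4]/(2%:Z ^+ 2) -exprD.
    by congr (_ ^+ _); rewrite /N subnKC// ltnW.
  (* [x] and [c] are odd and 8 divides [2 ^ n], so [P = -1] modulo 8 and the factor [3 ^ ell] is
     1. *)
  have P7 : (P %% 8 = 7)%N.
    have [x' xE] : exists x', x = (2 * x' + 1)%N by exists (x./2); move: ox; clear; lia.
    have [c' c'E] : exists c', c = (2 * c' + 1)%N by exists (c./2); move: oc; clear; lia.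
    have [t1 t1E] := even_mulz_succ x'; have [t2 t2E] := even_mulz_succ c'.
    have [z zE] : exists z, (2 ^ n = 8 * z)%N.
      by exists (2 ^ (n - 3))%N; rewrite -[8%N]/(2 ^ 3)%N -expnD subnKC.
    have : (8 * (t1 + P%:Z * t2) + 1 + P%:Z = 8 * z%:Z)%R.
      have -> : 8 * z%:Z = x%:Z ^+ 2 + P%:Z * c%:Z ^+ 2 by rewrite -eyn y2 -PoszX zE PoszM.
      transitivity (4 * (x'%:Z * (x'%:Z + 1)) + 4 * P%:Z * (c'%:Z * (c'%:Z + 1)) + 1 + P%:Z).
        by rewrite t1E t2E; ring.
      rewrite xE c'E (PoszD (2 * x')) (PoszD (2 * c')) !PoszM.
      by rewrite -[2%:Z]/(2 : int) -[1%:Z]/(1 : int); ring.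
    by move: (t1 + _) => k; clear; lia.
  have ell0 : ell P = 0%N by rewrite /ell P7 andbF.
  have [eN _ cN] := rxc; rewrite !mul1n in eN cN.
  have [u [w [eu cu]]] := class_exponent_norm P0 sP hy N0 h0 kill eN (cN N0).
  have ru : rep P 1 y h u w by split=> //; rewrite dvd1z.
  have c1y : coprime 1 y by exact: coprime1n.
  have [u2 [w2 ru2]] := rep_apparition hy cPy c1y h0 sQ cPQ cQy (or_intror (conj erefl oQ)) ru.
  have c1Qy : coprime (1 * Q) y by rewrite mul1n.
  have hPQ : (4 < P * (1 * Q) ^ 2)%N.
    apply: (@leq_trans P); first by move: P7; clear; lia.
    by rewrite leq_pmulr// expn_gt0 mul1n Q0.
  apply: shift_index_dvd; rewrite ell0 expn0 muln1.
  apply: (rep_index_dvd hy cPy c1Qy N0 _ rxc ru2); first by rewrite muln_gt0 h0.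
  move=> r l a b r0 l0 NE rl hr.
  have nE' : n = (r * l + 2)%N by rewrite -NE /N subnK// ltnW.
  rewrite NE in rxc.
  have hk : 1%N = 2%N /\ odd y \/ 1%N = 1%N /\ y = 2%N by right.
  case: hr => [[hr r2]|r4].
    move: r2; rewrite leq_eqVlt => /predU1P[r3|r3].
      have := root_two_3 hy hk x0 c0 hx cPy ccy c1Qy hPQ hrad l0 r0 rxc rl y2 (esym r3).
      by rewrite -nE' !inE => /orP[] /eqP E; move: hexc; rewrite E.
    have := root_two_ge5 hy hk x0 hx cxy cPy ccy c1Qy hPQ hrad l0 r0 rxc rl y2 hr r3.
    by rewrite -nE' !inE => /or4P[] /eqP E; move: hexc; rewrite E.
  exact: (root_two_4 hy hk c0 cPy ccy c1Qy hPQ hrad l0 r0 rxc rl y2 r4).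
Qed.
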